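(* Let $n\ge1$ and $0\le k\le n$. We have the exact sequences $$0\rightarrow\mathcal{H}(\mathbb{R}^n,\Lambda^k)\rightarrow\mathcal{P}(\mathbb{R}^n,\Lambda^k)\overset{\Delta}{\rightarrow}\mathcal{P}(\mathbb{R}^n,\Lambda^k)\rightarrow0$$ and $$0\rightarrow\mathcal{H}(\mathbb{R}^n,\Lambda^k)\rightarrow\mathcal{S}'(\mathbb{R}^n,\Lambda^k)\overset{\Delta}{\rightarrow}\mathcal{S}'(\mathbb{R}^n,\Lambda^k)\rightarrow0,$$ where the first map in each is the inclusion. In particular, any temperate current $\theta\in\mathcal{S}'(\mathbb{R}^n,\Lambda^k)$ is the sum of an exact plus a coexact current; more precisely, $$\theta=\Delta\omega=\delta(d\omega)+d(\delta\omega)$$ for some $\omega\in\mathcal{S}'(\mathbb{R}^n,\Lambda^k)$, well defined up to a harmonic current (an element of $\mathcal{H}(\mathbb{R}^n,\Lambda^k)$).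
   Context: $\Lambda^k=\Lambda^k(\mathbb{R}^{n*})$ is the space of alternating $k$-forms on $\mathbb{R}^n$ (zero if $k<0$ or $k>n$). $\mathcal{S}'(\mathbb{R}^n,\Lambda^k)$ is the space of temperate currents of degree $k$: continuous linear forms on the space $\mathcal{S}(\mathbb{R}^n,\Lambda^k)$ of $k$-forms with Schwartz coefficients, equivalently $k$-forms whose coefficients are tempered distributions. $\mathcal{P}(\mathbb{R}^n,\Lambda^k)$ is the space of $k$-forms with (complex) polynomial coefficients and $\mathcal{H}(\mathbb{R}^n,\Lambda^k)$ the space of $k$-forms whose coefficients are harmonic polynomials. On currents, $d=\sum_{\mu}dx_\mu\wedge\partial_\mu$, $\delta=-\sum_\mu \iota_\mu\partial_\mu$ with $\iota_\mu$ the interior product with $\partial/\partial x_\mu$, and $\Delta=d\delta+\delta d=-\sum_\mu\partial_\mu^2$ (acting coefficientwise). *)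

(* Defs.v *)
From HB Require Import structures.
From mathcomp Require Import all_boot all_order all_algebra.
From mathcomp Require Import all_classical all_reals all_analysis.
From mathcomp Require Import complex.
From mathcomp Require mpoly.
(* The notations of mpoly clash with those of the analysis library. *)
Import -(notations) mpoly.

Set Implicit Arguments.
Unset Strict Implicit.
Unset Printing Implicit Defensive.

Import Order.TTheory GRing.Theory Num.Theory.
Import numFieldNormedType.Exports.

Local Open Scope classical_set_scope.
Local Open Scope ring_scope.
Local Open Scope complex_scope.

Definition short_exact (K : pzRingType) (U V W : lmodType K)
    (A : set U) (B : set V) (C : set W)
    (f : {linear U -> V}) (g : {linear V -> W}) : Prop :=
  [/\ set_fun A B f, set_inj A f, B `&` g @^-1` [set 0] = f @` A,
      set_fun B C g & set_surj B C g].

(* An element w of [ext_form n V] is an element of the whole exterior algebra of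
   (R^n)^* tensored with V: the sum over I = {i_1 < ... < i_k} of
   w I dx_{i_1} /\ ... /\ dx_{i_k}. The forms of degree k, k an integer, are
   singled out by [of_degree k]. *)
Notation ext_form n V := {ffun {set 'I_n} -> V}.

Section Forms.
Variables (K : pzRingType) (n : nat) (V : lmodType K).
Implicit Types (w : ext_form n V) (I : {set 'I_n}) (mu : 'I_n).

Definition of_degree (k : int) : set (ext_form n V) :=
  [set w | forall I : {set 'I_n}, #|I|%:Z != k -> w I = 0].

(* The sign that moves dx_mu to its place among the dx_j, j in I:
   dx_mu /\ dx_I = wedge_sign mu I dx_(I :|: {mu}) if mu is not in I, and
   iota_mu dx_I = wedge_sign mu I dx_(I :\ mu) if mu is in I. *)
Definition wedge_sign mu I : K := (-1) ^+ #|[set j in I | (j < mu)%N]%SET|.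

Definition wedge_dx mu w : ext_form n V :=
  [ffun I : {set 'I_n} => if mu \in I then wedge_sign mu I *: w (I :\ mu) else 0].

Definition interior_product mu w : ext_form n V :=
  [ffun I : {set 'I_n} => if mu \in I then 0 else wedge_sign mu I *: w (mu |: I)].

(* [D mu] is the derivation d/dx_mu of the space V of coefficients. *)
Variable D : 'I_n -> {linear V -> V}.

Definition coef_partial mu w : ext_form n V :=
  [ffun I : {set 'I_n} => D mu (w I)].

Definition form_d w : ext_form n V :=
  \sum_mu wedge_dx mu (coef_partial mu w).

Definition form_delta w : ext_form n V :=
  - \sum_mu interior_product mu (coef_partial mu w).

Definition form_laplacian w : ext_form n V :=
  form_d (form_delta w) + form_delta (form_d w).

End Forms.

Section FormsLinear.
Variables (K : comPzRingType) (n : nat) (V : lmodType K).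
Variable D : 'I_n -> {linear V -> V}.

Lemma form_d_is_linear : linear (form_d D).
Proof.
move=> a u v; rewrite /form_d scaler_sumr -big_split /=; apply: eq_bigr => mu _.
apply/ffunP => I; rewrite !ffunE; case: ifP => _; last by rewrite scaler0 addr0.
by rewrite [D mu _]linearP scalerDr !scalerA mulrC.
Qed.

HB.instance Definition _ :=
  @GRing.isLinear.Build K (ext_form n V) (ext_form n V) *:%R
    (form_d D) form_d_is_linear.

Lemma form_delta_is_linear : linear (form_delta D).
Proof.
move=> a u v; rewrite /form_delta scalerN -opprD; congr (- _).
rewrite scaler_sumr -big_split /=; apply: eq_bigr => mu _.
apply/ffunP => I; rewrite !ffunE; case: ifP => _; first by rewrite scaler0 addr0.
by rewrite [D mu _]linearP scalerDr !scalerA mulrC.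
Qed.

HB.instance Definition _ :=
  @GRing.isLinear.Build K (ext_form n V) (ext_form n V) *:%R
    (form_delta D) form_delta_is_linear.

Lemma form_laplacian_is_linear : linear (form_laplacian D).
Proof.
by move=> a u v; rewrite /form_laplacian !linearP scalerDr addrACA.
Qed.

HB.instance Definition _ :=
  @GRing.isLinear.Build K (ext_form n V) (ext_form n V) *:%R
    (form_laplacian D) form_laplacian_is_linear.

End FormsLinear.

Section Schwartz.
Variables (R : realType) (n : nat).
Local Notation C := R[i].
Local Notation E := 'rV[R]_n.
(* Not Num.Re and Num.Im, which take their values in C. *)
Local Notation Re := (@complex.Re R).
Local Notation Im := (@complex.Im R).
Implicit Types (f g : E -> C) (s : seq 'I_n).

Definition basis_vector (i : 'I_n) : E := delta_mx 0 i.

Definition partial (i : 'I_n) f : E -> C := fun x =>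
  ('D_(basis_vector i) (fun y => Re (f y)) x) +i*
  ('D_(basis_vector i) (fun y => Im (f y)) x).

(* Multi-indices are encoded as words s = [:: i_1; ...; i_m] in the indices of
   the coordinates, with x^s = x_{i_1} ... x_{i_m} and
   d^s = d_{i_1} ... d_{i_m}. *)
Definition coord_monomial s (x : E) : R := \prod_(i <- s) x 0 i.

Definition iter_partial s f : E -> C := foldr partial f s.

Definition C1_fun f : Prop :=
  [/\ continuous (fun x => Re (f x)), continuous (fun x => Im (f x)) &
      forall i x, derivable (fun y => Re (f y)) x (basis_vector i) /\
                  derivable (fun y => Im (f y)) x (basis_vector i)].

Definition smooth_fun f : Prop := forall s, C1_fun (iter_partial s f).

Definition schwartz_weight a b f (x : E) : C :=
  (coord_monomial a x)%:C * iter_partial b f x.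

Definition is_schwartz f : Prop :=
  smooth_fun f /\
  forall a b, exists M : R, forall x, `|schwartz_weight a b f x| <= M%:C.

Definition schwartz_pred : {pred E -> C^o} := fun f => `[< is_schwartz f >].

Record schwartz := Schwartz {
  schwartz_fun :> E -> C^o ;
  schwartz_funP : schwartz_fun \in schwartz_pred }.

HB.instance Definition _ := [isSub for schwartz_fun].
HB.instance Definition _ := [Choice of schwartz by <:].

Lemma schwartzP (f : schwartz) : is_schwartz f.
Proof. exact/asboolP/schwartz_funP. Qed.


Lemma re_comb (a z w : C) :
  Re (a * z + w) = Re a * Re z + (- Im a) * Im z + Re w.
Proof. by case: a z w => [a1 a2] [z1 z2] [w1 w2] /=; rewrite mulNr. Qed.

Lemma im_comb (a z w : C) :
  Im (a * z + w) = Re a * Im z + Im a * Re z + Im w.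
Proof. by case: a z w => [a1 a2] [z1 z2] [w1 w2] /=. Qed.

Lemma is_derive_comb (u v w : E -> R) (p q : R) (x e : E) :
  derivable u x e -> derivable v x e -> derivable w x e ->
  is_derive x e (fun y => p * u y + q * v y + w y)
    (p * 'D_e u x + q * 'D_e v x + 'D_e w x).
Proof.
move=> /derivableP du /derivableP dv /derivableP dw.
have := is_deriveD (is_deriveD (is_deriveZ p du) (is_deriveZ q dv)) dw.
exact.
Qed.

Lemma C1_comb (a : C) f g :
  C1_fun f -> C1_fun g -> C1_fun (fun x => a * f x + g x).
Proof.
move=> [cf1 cf2 df] [cg1 cg2 dg]; split.
- rewrite (_ : (fun _ => _) = (fun x => Re a * Re (f x) +
    (- Im a) * Im (f x) + Re (g x))); last by apply/funext => x; exact: re_comb.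
  move=> x; apply: cvgD (cg1 x); apply: cvgD.
    exact: cvgMr (cf1 x).
  exact: cvgMr (cf2 x).
- rewrite (_ : (fun _ => _) = (fun x => Re a * Im (f x) +
    Im a * Re (f x) + Im (g x))); last by apply/funext => x; exact: im_comb.
  move=> x; apply: cvgD (cg2 x); apply: cvgD.
    exact: cvgMr (cf2 x).
  exact: cvgMr (cf1 x).
move=> i x; have [df1 df2] := df i x; have [dg1 dg2] := dg i x; split.
  under eq_fun do rewrite re_comb.
  by case: (is_derive_comb (Re a) (- Im a) df1 df2 dg1).
under eq_fun do rewrite im_comb.
by case: (is_derive_comb (Re a) (Im a) df2 df1 dg2).
Qed.

Lemma partial_comb (a : C) f g : C1_fun f -> C1_fun g -> forall i,
  partial i (fun x => a * f x + g x) =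
  (fun x => a * partial i f x + partial i g x).
Proof.
move=> [_ _ df] [_ _ dg] i; apply/funext => x.
have [df1 df2] := df i x; have [dg1 dg2] := dg i x.
have [_ e1] := is_derive_comb (Re a) (- Im a) df1 df2 dg1.
have [_ e2] := is_derive_comb (Re a) (Im a) df2 df1 dg2.
rewrite /partial; under eq_fun do rewrite re_comb.
under [X in _ +i* 'D__ X _]eq_fun do rewrite im_comb.
rewrite e1 e2; apply/eqP; rewrite eq_complex re_comb im_comb /=.
by rewrite !eqxx.
Qed.

Lemma iter_partial_comb (a : C) f g : smooth_fun f -> smooth_fun g -> forall s,
  iter_partial s (fun x => a * f x + g x) =
  (fun x => a * iter_partial s f x + iter_partial s g x).
Proof.
move=> sf sg; elim=> [//|i s IHs] /=.
by rewrite -/(iter_partial s _) IHs partial_comb.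
Qed.

Lemma is_schwartz_comb (a : C) f g :
  is_schwartz f -> is_schwartz g -> is_schwartz (fun x => a * f x + g x).
Proof.
move=> [sf bf] [sg bg]; split.
  by move=> s; rewrite iter_partial_comb //; exact: C1_comb.
move=> p q; have [M hM] := bf p q; have [N hN] := bg p q.
have [A hA] : exists A : R, `|a| = A%:C by eexists; exact: normc_def.
exists (A * M + N) => x.
rewrite /schwartz_weight iter_partial_comb // mulrDr mulrCA.
rewrite (le_trans (ler_normD _ _)) // normrM rmorphD rmorphM /= -hA.
by apply: lerD; [apply: ler_wpM2l (hM x)|exact: hN].
Qed.

Lemma is_schwartz_submod_closed :
  submod_closed schwartz_pred.
Proof.
have schwartz0 : is_schwartz (fun=> 0 : C).
  have itp0 s : iter_partial s (fun=> 0 : C) = fun=> 0.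
    elim: s => //= i s ->; apply/funext => x.
    by rewrite /partial !derive_cst.
  split=> [s|a b].
    rewrite itp0; split=> [x|x|i x]; [exact: (@cst_continuous _ _ (0 : R))|exact: (@cst_continuous _ _ (0 : R))|].
    by split; exact: derivable_cst.
  by exists 0 => x; rewrite /schwartz_weight itp0 mulr0 normr0.
split=> [|a f g]; first exact/asboolP.
by move=> /asboolP sf /asboolP sg; apply/asboolP; exact: is_schwartz_comb.
Qed.

HB.instance Definition _ := GRing.isSubmodClosed.Build C (E -> C^o)
  schwartz_pred is_schwartz_submod_closed.
HB.instance Definition _ := [SubChoice_isSubLmodule of schwartz by <:].

Lemma is_schwartz_partial i f : is_schwartz f -> is_schwartz (partial i f).
Proof.
have iterE s : iter_partial s (partial i f) = iter_partial (rcons s i) f.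
  by rewrite /iter_partial foldr_rcons.
move=> [sf bf]; split=> [s|a b]; first by rewrite iterE.
have [M hM] := bf a (rcons b i); exists M => x.
by rewrite /schwartz_weight iterE; exact: hM.
Qed.

Lemma schwartz_partial_subproof i (f : schwartz) :
  (partial i f : E -> C^o) \in schwartz_pred.
Proof. exact/asboolP/is_schwartz_partial/schwartzP. Qed.

Definition schwartz_partial i (f : schwartz) : schwartz :=
  Schwartz (schwartz_partial_subproof i f).

Lemma schwartz_partial_is_linear i : linear (schwartz_partial i).
Proof.
move=> a f g; apply: val_inj => /=.
have [sf _] := schwartzP f; have [sg _] := schwartzP g.
exact: (partial_comb a (sf [::]) (sg [::])).
Qed.

HB.instance Definition _ i :=
  @GRing.isLinear.Build C schwartz schwartz *:%R
    (schwartz_partial i) (schwartz_partial_is_linear i).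

(* The sets [schwartz_ball f N d] with d > 0 form a basis of neighborhoods of f
   in the Frechet topology defined by the seminorms sup_x |x^a d^b f(x)|. *)
Definition schwartz_ball (f : schwartz) (N : nat) (d : R) : set schwartz :=
  [set g : schwartz | forall a b, (size a <= N)%N -> (size b <= N)%N ->
    forall x, `|schwartz_weight a b (g - f) x| < d%:C].

Definition schwartz_continuous (T : schwartz -> C) : Prop :=
  forall (f : schwartz) (e : R), 0 < e ->
  exists N, exists2 d : R, 0 < d &
  forall g : schwartz, schwartz_ball f N d g -> `|T g - T f| < e%:C.

Definition is_tempered (T : schwartz -> C^o) : Prop :=
  linear T /\ schwartz_continuous T.

Definition tempered_pred : {pred schwartz -> C^o} := fun T => `[< is_tempered T >].

Record tempered := Tempered {
  tempered_fun :> schwartz -> C^o ;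
  tempered_funP : tempered_fun \in tempered_pred }.

HB.instance Definition _ := [isSub for tempered_fun].
HB.instance Definition _ := [Choice of tempered by <:].

Lemma temperedP (T : tempered) : is_tempered T.
Proof. exact/asboolP/tempered_funP. Qed.

Lemma is_tempered_submod_closed : submod_closed tempered_pred.
Proof.
split=> [|a S T]; first apply/asboolP.
  split=> [b f g|f e e0]; first by rewrite scaler0 addr0.
  by exists 0, 1 => // g _; rewrite subrr normr0 ltcR.
move=> /asboolP[lS cS] /asboolP[lT cT]; apply/asboolP; split=> [b f g|f e e0].
  have aE h : (a *: S + T) h = a * S h + T h by [].
  have lE U : linear U -> U (b *: f + g) = b * U f + U g by exact.
  rewrite !aE (lE _ lS) (lE _ lT) -[RHS]/(b * (a * S f + T f) + (a * S g + T g)).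
  by rewrite !mulrDr mulrCA addrACA.
have [A hA] : exists A : R, `|a| = A%:C by eexists; exact: normc_def.
have A0 : 0 <= A by rewrite -lecR -hA; exact: normr_ge0.
have A1 : 0 < A + 1 by rewrite ltr_wpDl.
have [N1 [d1 d10 h1]] := cS f (e / 2 / (A + 1)) ltac:(by rewrite !divr_gt0).
have [N2 [d2 d20 h2]] := cT f (e / 2) ltac:(by rewrite divr_gt0).
exists (maxn N1 N2), (Order.min d1 d2); first by rewrite lt_min d10.
move=> g hg.
have {}h1 : `|S g - S f| < (e / 2 / (A + 1))%:C.
  apply: h1 => p q hp hq x; apply: lt_le_trans (hg p q _ _ x) _.
  - by rewrite leq_max hp.
  - by rewrite leq_max hq.
  - by rewrite lecR ge_min lexx.
have {}h2 : `|T g - T f| < (e / 2)%:C.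
  apply: h2 => p q hp hq x; apply: lt_le_trans (hg p q _ _ x) _.
  - by rewrite leq_max hp orbT.
  - by rewrite leq_max hq orbT.
  - by rewrite lecR ge_min lexx orbT.
have -> : (a *: S + T) g - (a *: S + T) f = a * (S g - S f) + (T g - T f).
  by rewrite mulrBr opprD addrACA.
apply: le_lt_trans (ler_normD _ _) _; rewrite normrM hA.
rewrite [e]splitr rmorphD; apply: ler_ltD h2.
apply: le_trans (_ : (A + 1)%:C * (e / 2 / (A + 1))%:C <= _).
  apply: ler_pM; [by rewrite lecR|by []| |exact: ltW].
  by rewrite lecR lerDl.
by rewrite -rmorphM /= mulrC divfK // gt_eqF.
Qed.

HB.instance Definition _ := GRing.isSubmodClosed.Build C (schwartz -> C^o)
  tempered_pred is_tempered_submod_closed.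
HB.instance Definition _ := [SubChoice_isSubLmodule of tempered by <:].

Lemma tempered_partial_subproof i (T : tempered) :
  (fun f : schwartz => - T (schwartz_partial i f)) \in tempered_pred.
Proof.
have [lT cT] := temperedP T; apply/asboolP; split=> [a f g|f e e0].
  by rewrite linearP lT opprD scalerN.
have [N [d d0 h]] := cT (schwartz_partial i f) e e0.
exists N.+1, d => // g hg; rewrite -opprD normrN; apply: h => a b ha hb x.
rewrite -linearB /schwartz_weight /=.
have -> : iter_partial b (partial i (g - f)) = iter_partial (rcons b i) (g - f).
  by rewrite /iter_partial foldr_rcons.
by apply: hg; rewrite ?size_rcons ?ltnS // ltnW.
Qed.

Definition tempered_partial i (T : tempered) : tempered :=
  Tempered (tempered_partial_subproof i T).

Lemma tempered_partial_is_linear i : linear (tempered_partial i).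
Proof.
move=> a S T; apply: val_inj; apply/funext => f /=.
by rewrite opprD -scalerN.
Qed.

HB.instance Definition _ i :=
  @GRing.isLinear.Build C tempered tempered *:%R
    (tempered_partial i) (tempered_partial_is_linear i).

End Schwartz.

(* The Lebesgue integral over R^n, as an iterated integral. It is only applied
   to products of polynomials and Schwartz functions. *)
Fixpoint integral_rV (R : realType) (n : nat) : ('rV[R]_n -> R) -> R :=
  if n is m.+1 then fun f =>
    \int[lebesgue_measure]_t
      integral_rV (fun y : 'rV[R]_m => f (row_mx (t%:M : 'rV[R]_1) y))
  else fun f => f 0.

Definition cintegral_rV (R : realType) (n : nat) (f : 'rV[R]_n -> R[i]) : R[i] :=
  integral_rV (fun x => complex.Re (f x)) +i*
  integral_rV (fun x => complex.Im (f x)).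

Section Currents.
Variables (R : realType) (n : nat).
Local Notation C := R[i].

(* Forms with complex polynomial coefficients, and forms with tempered
   distributions as coefficients; all degrees together. *)
Local Notation poly_form := (ext_form n (mpoly n C)).
Local Notation current := (ext_form n (tempered R n)).

Definition poly_partial (i : 'I_n) : {linear mpoly n C -> mpoly n C} :=
  @mderiv n C i.

Definition poly_laplacian : {linear poly_form -> poly_form} :=
  form_laplacian poly_partial.

Definition current_d : {linear current -> current} :=
  form_d (@tempered_partial R n).

Definition current_delta : {linear current -> current} :=
  form_delta (@tempered_partial R n).

Definition current_laplacian : {linear current -> current} :=
  form_laplacian (@tempered_partial R n).

Definition harmonic (p : mpoly n C) : Prop :=
  \sum_i mderiv i (mderiv i p) = 0.

Definition poly_forms (k : int) : set poly_form := of_degree k.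

Definition harmonic_forms (k : int) : set poly_form :=
  [set w | of_degree k w /\ forall I, harmonic (w I)].

Definition currents (k : int) : set current := of_degree k.

Definition exact_current (k : int) (theta : current) : Prop :=
  exists2 alpha, currents (k - 1) alpha & theta = current_d alpha.

Definition coexact_current (k : int) (theta : current) : Prop :=
  exists2 beta, currents (k + 1) beta & theta = current_delta beta.

Definition poly_fun (p : mpoly n C) (x : 'rV[R]_n) : C :=
  meval (fun i => (x 0 i)%:C) p.

(* The polynomial form w seen as a current: its coefficients are the tempered
   distributions f |-> int w_I(x) f(x) dx. *)
Definition is_inclusion (iota : poly_form -> current) : Prop :=
  forall (w : poly_form) (I : {set 'I_n}) (f : schwartz R n),
    iota w I f = cintegral_rV (fun x => poly_fun (w I) x * f x).

End Currents.

Arguments poly_laplacian {R n}.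
Arguments current_d {R n}.
Arguments current_delta {R n}.
Arguments current_laplacian {R n}.

(* Main.v *)
Require Import Defs.
From HB Require Import structures.
From mathcomp Require Import all_boot all_order all_algebra.
From mathcomp Require Import all_classical all_reals all_analysis.
From mathcomp Require Import measurable_realfun.
From mathcomp Require Import complex lra ring zify.
From mathcomp Require mpoly.
Import -(notations) mpoly.
Set Implicit Arguments.
Unset Strict Implicit.
Unset Printing Implicit Defensive.
Import Order.TTheory GRing.Theory Num.Theory.
Import numFieldNormedType.Exports.
Local Open Scope classical_set_scope.
Local Open Scope ring_scope.

(** On forms in R^n the cross terms of d delta + delta d cancel because partial
    derivatives commute, so the Hodge Laplacian acts on each coefficient as
    - sum_mu d_mu^2 (form_laplacianE). Everything thus reduces to the scalar
    Laplacian on polynomials and on tempered distributions; solutions are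
    chosen coefficient by coefficient, and the decomposition of a current is
    Delta omega = d (delta omega) + delta (d omega).

    Polynomials: integrating a monomial twice in one variable solves the
    equation up to monomials of smaller degree in the other variables
    (monomial_sum_sqr_mderiv).

    Tempered distributions: the Fourier transform turns the Laplacian into
    multiplication by - |xi|^2, so both its surjectivity and its kernel are read
    off from the family of operators f |-> f / (|xi|^2 + e). These are bounded
    uniformly in e on functions that vanish to a high order at 0
    (resolvent_bound), so every tempered distribution can be divided by |xi|^2
    up to finitely many derivatives of the Dirac mass at 0
    (division_by_normsq), and a distribution killed by |xi|^2 is a combination
    of such derivatives (kernel_mul_normsq). These are Fourier transforms of
    polynomials (jet_fourier). In the division they are corrected by the
    surjectivity on polynomials (tempered_laplacian_surj); for the kernel they
    give Liouville's theorem, that a tempered harmonic distribution is a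
    harmonic polynomial (tempered_laplacian_kernel).

    Fourier inversion on the Schwartz space rests on the same tool. A tempered
    functional that kills all the x_j f only depends on f(0)
    (kernel_mul_coord), and an operator that commutes with all x_j is therefore
    multiplication by a function; evaluation on a Gaussian gives that function
    (fourier_inversion). The iterated Lebesgue integral is only ever applied to
    continuous functions dominated by the product of the 1 / (1 + x_i^2), for
    which linearity, dominated convergence and translation invariance follow by
    induction on the dimension from the one-dimensional theory. *)

(** * The Hodge Laplacian in coordinates *)

Section HodgeLaplacian.
Variables (K : comPzRingType) (n : nat) (V : lmodType K).
Variable D : 'I_n -> {linear V -> V}.
Hypothesis D_comm : forall mu nu v, D mu (D nu v) = D nu (D mu v).
Implicit Types (w : ext_form n V) (I : {set 'I_n}) (mu nu : 'I_n).

Lemma form_dE w I : form_d D w I =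
  \sum_(mu | mu \in I) wedge_sign K mu I *: D mu (w (I :\ mu)).
Proof.
rewrite sum_ffunE [RHS]big_mkcond; apply: eq_bigr => mu _.
by rewrite !ffunE; case: ifP.
Qed.

Lemma form_deltaE w I : form_delta D w I =
  - \sum_(mu | mu \notin I) wedge_sign K mu I *: D mu (w (mu |: I)).
Proof.
rewrite ffunE sum_ffunE [X in _ = - X]big_mkcond; congr (- _).
by apply: eq_bigr => mu _; rewrite !ffunE; case: ifP.
Qed.

Lemma wedge_signD1 mu nu I : mu \in I ->
  wedge_sign K nu (I :\ mu) = (-1) ^+ (mu < nu)%N * wedge_sign K nu I.
Proof.
move=> muI; rewrite /wedge_sign.
have -> : [set j in I :\ mu | (j < nu)%N] = [set j in I | (j < nu)%N] :\ mu.
  by apply/setP => j; rewrite !inE andbA.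
rewrite [in RHS](cardsD1 mu) !inE muI /= exprD mulrA -exprD addnn.
by rewrite -mul2n exprM sqrrN expr1n expr1n mul1r.
Qed.

Lemma wedge_signU1 mu nu I : nu \notin I ->
  wedge_sign K mu (nu |: I) = (-1) ^+ (nu < mu)%N * wedge_sign K mu I.
Proof.
move=> nuI; have := @wedge_signD1 nu mu (nu |: I) (setU11 _ _).
rewrite setU1K // => ->; rewrite mulrA -exprD addnn -mul2n exprM sqrrN !expr1n.
by rewrite mul1r.
Qed.

Lemma wedge_sign_sqr mu I : wedge_sign K mu I * wedge_sign K mu I = 1.
Proof. by rewrite -expr2 sqrr_sign. Qed.

(** On dx_I the terms with mu <> nu of d delta and delta d cancel in pairs:
   moving dx_mu and dx_nu past each other changes the sign once. *)
Lemma form_laplacianE w I :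
  form_laplacian D w I = - \sum_mu D mu (D mu (w I)).
Proof.
rewrite ffunE form_dE form_deltaE.
under eq_bigr => mu _ do rewrite form_deltaE linearN scalerN linear_sum scaler_sumr.
under [X in _ - X]eq_bigr => nu _ do rewrite form_dE linear_sum scaler_sumr.
rewrite sumrN -opprD; congr (- _).
rewrite (eq_bigr (fun i => D i (D i (w I)) + \sum_(j | j \notin I)
    (wedge_sign K i I * wedge_sign K j (I :\ i)) *: D i (D j (w (j |: I :\ i)))));
  last first.
  move=> i iI; rewrite (bigD1 i) /=; last by rewrite !inE eqxx.
  congr (_ + _).
    rewrite linearZ scalerA wedge_signD1 // ltnn mul1r wedge_sign_sqr scale1r.
    by rewrite finset.setD1K.
  apply: eq_big => [j|j _]; last by rewrite linearZ scalerA.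
  by rewrite !inE; have [->|] := eqVneq j i; rewrite ?iI ?andbF // andbT.
rewrite [X in _ + X](eq_bigr (fun j => D j (D j (w I)) + \sum_(i in I)
    (wedge_sign K j I * wedge_sign K i (j |: I)) *: D j (D i (w ((j |: I) :\ i)))));
  last first.
  move=> j jI; rewrite big_setU1 //=; congr (_ + _).
    rewrite linearZ scalerA wedge_signU1 // ltnn mul1r wedge_sign_sqr scale1r.
    by rewrite finset.setU1K.
  by apply: eq_bigr => i _; rewrite linearZ scalerA.
rewrite !big_split /= addrACA [RHS](bigID (mem I)) /= -[RHS]addr0; congr (_ + _).
rewrite [X in _ + X]exchange_big /= -big_split /= big1 // => i iI.
rewrite -big_split /= big1 // => j jI.
have ij : j != i by apply: contraNneq jI => ->.
have -> : (j |: I) :\ i = j |: I :\ i.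
  by apply/setP => k; rewrite !inE; case: eqVneq => [->|] //=; rewrite eq_sym (negbTE ij).
rewrite D_comm -scalerDl wedge_signD1 // wedge_signU1 //.
rewrite mulrCA [wedge_sign K j I * _]mulrCA [wedge_sign K j I * _]mulrC -mulrDl.
suff -> : (-1) ^+ (i < j)%N + (-1) ^+ (j < i)%N = 0 :> K by rewrite mul0r scale0r.
by case: (ltngtP i j) ij => [||/val_inj ->]; rewrite ?eqxx // ?addNr ?subrr.
Qed.

Lemma of_degree_form_d k w : of_degree k w -> of_degree (k + 1) (form_d D w).
Proof.
move=> wk I Ik; rewrite form_dE big1 // => mu muI; rewrite wk ?linear0 ?scaler0 //.
apply: contra Ik => /eqP <-; rewrite (cardsD1 mu I) muI addrC.
by rewrite -PoszD add1n.
Qed.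

Lemma of_degree_form_delta k w : of_degree k w -> of_degree (k - 1) (form_delta D w).
Proof.
move=> wk I Ik; rewrite form_deltaE big1 ?oppr0 // => mu muI; rewrite wk ?linear0 ?scaler0 //.
apply: contra Ik => /eqP <-; rewrite cardsU1 muI add1n -addn1 PoszD addrK.
exact: eqxx.
Qed.

Lemma of_degree_form_laplacian k w : of_degree k w -> of_degree k (form_laplacian D w).
Proof.
by move=> wk I Ik; rewrite form_laplacianE big1 ?oppr0 // => mu _; rewrite wk // !linear0.
Qed.

End HodgeLaplacian.

(** * Iterated integrals over R^n *)

Section IteratedIntegral.
Variable R : realType.
Local Notation mu := (@lebesgue_measure R).

Lemma integrable_oneDsqrV : mu.-integrable setT (EFin \o (fun t : R => (oneDsqr t)^-1)).
Proof.
have m : measurable_fun setT (fun t : R => (oneDsqr t)^-1).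
  by apply: continuous_measurable_fun; exact: continuous_oneDsqrV.
apply/integrableP; split; first exact/measurable_EFinP.
have e : (\int[mu]_x (oneDsqr x)^-1%:E = 2%:E * \int[mu]_(x in [set x | (0 <= x)%R]) (oneDsqr x)^-1%:E)%E.
  apply: ge0_symfun_integralT.
  - by move=> x; rewrite invr_ge0.
  - exact: continuous_oneDsqrV.
  - by move=> x /=; rewrite /oneDsqr sqrrN.
under eq_integral => x _ do rewrite /= ger0_norm ?invr_ge0 //.
by rewrite e -set_itvcy integral0y_oneDsqr -EFinM ltry.
Qed.

Lemma integrable_le_oneDsqrV (g : R -> R) C : continuous g ->
  (forall t, `|g t| <= C * (oneDsqr t)^-1) -> mu.-integrable setT (EFin \o g).
Proof.
move=> cg gC; apply: (@le_integrable _ _ _ mu setT measurableT _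
    (fun t => (C%:E * ((oneDsqr t)^-1)%:E)%E)).
- by apply/measurable_EFinP; exact: continuous_measurable_fun.
- move=> t _ /=; rewrite lee_fin (le_trans (gC t)) // ler_norm //.
- exact: integrableZl integrable_oneDsqrV.
Qed.

(** A product over the coordinates rather than a power of |x|: it factors
    through slices, so that in each variable of the iterated integral the
    domination is by 1 / (1 + t^2). *)
Definition weight n (x : 'rV[R]_n) : R := \prod_i (oneDsqr (x 0 i))^-1.

(** The first condition makes the inner integrals continuous in the outer
    variable, hence measurable, and the second one makes them integrable; both
    pass to slices. *)
Definition integrand n (u : 'rV[R]_n -> R) :=
  continuous u /\ exists C, forall x, `|u x| <= C * weight x.

Definition slice n (u : 'rV[R]_n.+1 -> R) (t : R) : 'rV[R]_n -> R :=
  fun y => u (row_mx (t%:M : 'rV[R]_1) y).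

Lemma weight_gt0 n (x : 'rV[R]_n) : 0 < weight x.
Proof. by apply: prodr_gt0 => i _; rewrite invr_gt0 (lt_le_trans ltr01). Qed.

Lemma row_mx_ord0 n (t : R) (y : 'rV[R]_n) :
  (row_mx (t%:M : 'rV[R]_1) y : 'rV[R]_n.+1) 0 ord0 = t.
Proof.
have -> : (ord0 : 'I_n.+1) = lshift n (ord0 : 'I_1) by exact: val_inj.
by apply: etrans (row_mxEl (t%:M : 'rV[R]_1) y 0 ord0) _; rewrite mxE.
Qed.

Lemma row_mx_lift n (t : R) (y : 'rV[R]_n) (i : 'I_n) :
  (row_mx (t%:M : 'rV[R]_1) y : 'rV[R]_n.+1) 0 (lift ord0 i) = y 0 i.
Proof.
have -> : (lift ord0 i : 'I_n.+1) = rshift 1 i by exact: val_inj.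
exact: (row_mxEr (t%:M : 'rV[R]_1) y 0 i).
Qed.

Lemma weight_row n (t : R) (y : 'rV[R]_n) :
  weight (row_mx (t%:M : 'rV[R]_1) y : 'rV[R]_n.+1) = (oneDsqr t)^-1 * weight y.
Proof.
rewrite /weight big_ord_recl row_mx_ord0; congr (_ * _).
by apply: eq_bigr => i _; rewrite row_mx_lift.
Qed.

Lemma rowE n (x : 'rV[R]_n.+1) :
  x = row_mx ((x 0 ord0)%:M : 'rV[R]_1) (\row_i x 0 (lift ord0 i)).
Proof.
apply/rowP => i; case: (unliftP ord0 i) => [j ->|->]; last by rewrite row_mx_ord0.
by rewrite row_mx_lift mxE.
Qed.

Lemma cvg_row n (T : Type) (F : set_system T) {FF : Filter F} (s : T -> R) (p : T -> 'rV[R]_n) t y :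
  s @ F --> t -> p @ F --> y ->
  (fun a => row_mx ((s a)%:M : 'rV[R]_1) (p a) : 'rV[R]_n.+1) @ F -->
  (row_mx (t%:M : 'rV[R]_1) y : 'rV[R]_n.+1).
Proof.
move=> st py; apply/cvg_ballP => e e0.
move/cvg_ballP : st => /(_ e e0) hs; move/cvg_ballP : py => /(_ e e0) hp.
apply: filterS2 hs hp => a hs [_ hp]; split => // i j.
rewrite (ord1 i); case: (unliftP ord0 j) => [k ->|->].
  by rewrite !row_mx_lift.
by rewrite !row_mx_ord0.
Qed.

Lemma continuous_slice n (u : 'rV[R]_n.+1 -> R) t : continuous u -> continuous (slice u t).
Proof.
move=> cu y; apply: (@cvg_comp _ _ _ (fun y => row_mx (t%:M : 'rV[R]_1) y : 'rV[R]_n.+1) u) (cu _).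
apply: (@cvg_row n _ (nbhs y) _ (fun=> t) id); first exact: cvg_cst.
exact: cvg_id.
Qed.

Lemma integrand_slice n (u : 'rV[R]_n.+1 -> R) t : integrand u -> integrand (slice u t).
Proof.
move=> [cu [C uC]]; split.
  exact: continuous_slice.
exists (C * (oneDsqr t)^-1) => y; rewrite -mulrA -weight_row; exact: uC.
Qed.

(** Dominated convergence concerns sequences; this is how it yields continuity
    of an integral in a parameter. *)
Lemma cvg_seq_continuous (f : R -> R) :
  (forall x (u : R^nat), u @ \oo --> x -> f \o u @ \oo --> f x) -> continuous f.
Proof.
move=> h x; have /cvgr_dnbhsP : forall u : R^nat, (forall n, u n != x) /\ (u n @[n --> \oo] --> x) ->
    f (u n) @[n --> \oo] --> f x by move=> u [_]; exact: h.
move=> hx; apply/cvgrPdist_lt => e e0.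
move/cvgrPdist_lt : hx => /(_ e e0); rewrite !near_simpl /= => hx.
move/nbhs_ballP : hx => [d d0 hd]; apply/nbhs_ballP; exists d => //= y xy.
have [->|yx] := eqVneq y x; first by rewrite subrr normr0.
by apply: hd.
Qed.

Let c1 : R := \int[mu]_t (oneDsqr t)^-1.

Lemma slice_bound n (u : 'rV[R]_n.+1 -> R) C t : (forall x, `|u x| <= C * weight x) ->
  forall y, `|slice u t y| <= C * (oneDsqr t)^-1 * weight y.
Proof. by move=> h y; rewrite -mulrA -weight_row; exact: h. Qed.

Definition dominated_cvg_rV n :=
  forall (u_ : nat -> 'rV[R]_n -> R) u C, (forall k, continuous (u_ k)) -> continuous u ->
    (forall k x, `|u_ k x| <= C * weight x) -> (forall x, u_ ^~ x @ \oo --> u x) ->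
    (fun k => integral_rV (u_ k)) @ \oo --> integral_rV u.

Lemma dominated_cvg_continuous_slice n (u : 'rV[R]_n.+1 -> R) C : dominated_cvg_rV n ->
  continuous u -> (forall x, `|u x| <= C * weight x) ->
  continuous (fun t => integral_rV (slice u t)).
Proof.
move=> dct cu uC; apply: cvg_seq_continuous => t s st.
have C0 : 0 <= C.
  by have := le_trans (normr_ge0 _) (uC 0); rewrite pmulr_lge0 // weight_gt0.
apply: (dct _ _ C).
- by move=> k; exact: continuous_slice.
- exact: continuous_slice.
- move=> k x; apply: le_trans (slice_bound _ uC _) _.
  by rewrite ler_wpM2r ?(ltW (weight_gt0 _)) // ler_piMr // invf_le1.
- move=> y; apply: (@cvg_comp _ _ _ (fun k => row_mx ((s k)%:M : 'rV[R]_1) y : 'rV[R]_n.+1) u) (cu _).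
  by apply: (@cvg_row _ _ _ _ s (fun=> y)) => //; exact: cvg_cst.
Qed.

(** One induction for both: continuity of the inner integrals is dominated
    convergence in dimension n, their domination is the bound in dimension n,
    and the two together give both statements for the outer integral. *)
Lemma integral_rV_bound_cvg n :
  (forall (u : 'rV[R]_n -> R) C, continuous u -> (forall x, `|u x| <= C * weight x) ->
    `|integral_rV u| <= C * c1 ^+ n) /\
  dominated_cvg_rV n.
Proof.
elim: n => [|n [IHb IHc]].
  split=> [u C _ h|u_ u C _ _ _ h]; last exact: h.
  by rewrite /= expr0; apply: le_trans (h 0) _; rewrite /weight big_ord0.
have Gb (u : 'rV[R]_n.+1 -> R) C : continuous u -> (forall x, `|u x| <= C * weight x) ->
    forall t, `|integral_rV (slice u t)| <= C * c1 ^+ n * (oneDsqr t)^-1.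
  move=> cu uC t; rewrite mulrAC; apply: IHb; first exact: continuous_slice.
  exact: slice_bound.
have Gc (u : 'rV[R]_n.+1 -> R) C : continuous u -> (forall x, `|u x| <= C * weight x) ->
    continuous (fun t => integral_rV (slice u t)).
  exact: dominated_cvg_continuous_slice.
split=> [u C cu uC|u_ u C cu_ cu uC h].
  have iG := integrable_le_oneDsqrV (Gc _ _ cu uC) (Gb _ _ cu uC).
  apply: le_trans (le_normr_Rintegral _ iG) _ => //.
  rewrite exprSr mulrA -RintegralZl //; last exact: integrable_oneDsqrV.
  apply: le_Rintegral => //.
  - by have := integrable_norm iG.
  - exact: integrableZl integrable_oneDsqrV.
  - by move=> t _; exact: Gb.
have uC' x : `|u x| <= C * weight x.
  have hx : (fun k => `|u_ k x|) @ \oo --> `|u x| by apply: cvg_norm; exact: h.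
  rewrite -(cvg_lim (@norm_hausdorff _ _) hx) //; apply: limr_le; first by apply/cvg_ex; eexists; exact: hx.
  by apply: nearW => k; exact: uC.
pose G k t := integral_rV (slice (u_ k) t).
pose g t := integral_rV (slice u t).
rewrite /= /Rintegral.
apply: fine_cvg; rewrite fineK; last first.
  apply: integrable_fin_num => //.
  exact: integrable_le_oneDsqrV (Gc _ _ cu uC') (Gb _ _ cu uC').
apply: (@dominated_cvg _ _ _ mu setT measurableT (fun k t => (G k t)%:E) (fun t => (g t)%:E)
   (fun t => ((C * c1 ^+ n)%:E * ((oneDsqr t)^-1)%:E)%E)).
- move=> k; apply/measurable_EFinP; apply: continuous_measurable_fun.
  exact: Gc _ _ (cu_ k) (uC k).
- move=> t _; apply: cvg_EFin; first exact: nearW.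
  apply: (IHc _ _ (C * (oneDsqr t)^-1)).
  + by move=> k; exact: continuous_slice.
  + exact: continuous_slice.
  + by move=> k; exact: slice_bound.
  + by move=> y; exact: h.
- by [].
- exact: integrableZl integrable_oneDsqrV.
- by move=> k t _; rewrite lee_fin; exact: Gb _ _ (cu_ k) (uC k) t.
Qed.

Lemma integral_rV_bound n (u : 'rV[R]_n -> R) C : continuous u ->
  (forall x, `|u x| <= C * weight x) -> `|integral_rV u| <= C * c1 ^+ n.
Proof. exact: (integral_rV_bound_cvg n).1. Qed.

Lemma integral_rV_cvg n (u_ : nat -> 'rV[R]_n -> R) u C :
  (forall k, continuous (u_ k)) -> continuous u ->
  (forall k x, `|u_ k x| <= C * weight x) -> (forall x, u_ ^~ x @ \oo --> u x) ->
  (fun k => integral_rV (u_ k)) @ \oo --> integral_rV u.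
Proof. exact: (integral_rV_bound_cvg n).2. Qed.

Lemma continuous_integral_slice n (u : 'rV[R]_n.+1 -> R) : integrand u ->
  continuous (fun t => integral_rV (slice u t)).
Proof.
by move=> [cu [C uC]]; apply: dominated_cvg_continuous_slice cu uC; exact: integral_rV_cvg.
Qed.

Lemma bound_integral_slice n (u : 'rV[R]_n.+1 -> R) : integrand u ->
  exists C, forall t, `|integral_rV (slice u t)| <= C * (oneDsqr t)^-1.
Proof.
move=> [cu [C uC]]; exists (C * c1 ^+ n) => t; rewrite mulrAC; apply: integral_rV_bound.
  exact: continuous_slice.
exact: slice_bound.
Qed.

Lemma integrable_slice n (u : 'rV[R]_n.+1 -> R) : integrand u ->
  mu.-integrable setT (EFin \o (fun t => integral_rV (slice u t))).
Proof.
move=> iu; have [C uC] := bound_integral_slice iu.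
exact: integrable_le_oneDsqrV (continuous_integral_slice iu) uC.
Qed.

Lemma integrand_comb n a (u v : 'rV[R]_n -> R) : integrand u -> integrand v ->
  integrand (fun x => a * u x + v x).
Proof.
move=> [cu [C uC]] [cv [D vD]]; split.
  by move=> x; apply: cvgD (cv x); apply: cvgMr; exact: cu.
exists (`|a| * C + D) => x; rewrite mulrDl -mulrA.
apply: le_trans (ler_normD _ _) _; rewrite normrM lerD //.
exact: ler_wpM2l.
Qed.

Lemma integral_rV_comb n a (u v : 'rV[R]_n -> R) : integrand u -> integrand v ->
  integral_rV (fun x => a * u x + v x) = a * integral_rV u + integral_rV v.
Proof.
elim: n u v => [//|n IH] u v iu iv /=.
rewrite -RintegralZl //; last exact: integrable_slice iu.
rewrite -RintegralD //; last 2 first.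
- have := integrableZl measurableT a (integrable_slice iu).
  exact.
- exact: integrable_slice iv.
apply: eq_Rintegral => t _; apply: IH; exact: integrand_slice.
Qed.

Lemma integral_rV_ge0 n (u : 'rV[R]_n -> R) : (forall x, 0 <= u x) -> 0 <= integral_rV u.
Proof.
elim: n u => [|n IH] u u0 /=; first exact: u0.
apply: Rintegral_ge0 => t _.
by apply: IH => y.
Qed.

Lemma Rintegral_continuous_eq0 (g : R -> R) : continuous g -> (forall t, 0 <= g t) ->
  mu.-integrable setT (EFin \o g) -> \int[mu]_t g t = 0 -> forall t, g t = 0.
Proof.
move=> cg g0 ig h t; apply/eqP; rewrite eq_le g0 andbT leNgt; apply/negP => gt0.
have [e e0 he] : exists2 e, 0 < e & forall s, `|t - s| < e -> g t / 2 <= g s.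
  have /cvgrPdist_lt := cg t => /(_ (g t / 2)) []; first by rewrite divr_gt0.
  move=> e /= e0 he; exists e => // s ts.
  by have := he s ts; rewrite ltr_norml => /andP[_]; lra.
have i0 : (\int[mu]_t (g t)%:E = 0)%E.
  by rewrite -[LHS]fineK ?(integrable_fin_num _ ig) //= -/(Rintegral _ _ _) h.
pose A := `](t - e), (t + e)[%classic : set R.
have mA : measurable A by exact: measurable_itv.
suff : (0 < \int[mu]_t (g t)%:E)%E by rewrite i0 ltxx.
apply: (@lt_le_trans _ _ (\int[mu]_(s in A) (g s)%:E)%E); last first.
  apply: ge0_subset_integral => //.
  - by apply/measurable_EFinP; exact: continuous_measurable_fun.
  - by move=> x _; rewrite lee_fin.
apply: (@lt_le_trans _ _ (\int[mu]_(s in A) (cst (g t / 2)%:E s))%E); last first.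
  apply: ge0_le_integral => //.
  - by move=> x _; rewrite lee_fin divr_ge0 // ltW.
  - apply/measurable_EFinP; apply: measurable_funTS; exact: continuous_measurable_fun.
  - move=> s; rewrite /A /= in_itv /= => /andP[s1 s2]; rewrite lee_fin; apply: he.
    by rewrite ltr_distl; apply/andP; split; lra.
have mAE : mu A = _ := lebesgue_measure_itv `](t - e), (t + e)[.
have -> : (\int[mu]_(s in A) cst (g t / 2)%:E s = (g t / 2)%:E * mu A)%E by exact: integral_cst.
rewrite mAE /= lte_fin; case: ifPn => [_|]; last first.
  by move/negP; case; lra.
by rewrite -EFinB -EFinM lte_fin mulr_gt0 // ?divr_gt0 //; lra.
Qed.

Lemma integral_rV_eq0 n (u : 'rV[R]_n -> R) : integrand u -> (forall x, 0 <= u x) ->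
  integral_rV u = 0 -> forall x, u x = 0.
Proof.
elim: n u => [|n IH] u iu u0 h x.
  by rewrite -h /=; congr u; apply/rowP => -[].
rewrite (rowE x); apply: (IH (slice u (x 0 ord0))); first exact: integrand_slice.
  by move=> y; exact: u0.
apply: (Rintegral_continuous_eq0 (continuous_integral_slice iu)) => //.
  by move=> t; apply: integral_rV_ge0 => y; exact: u0.
exact: integrable_slice.
Qed.

(** Substitution for nonnegative functions applies to h = |C| / (1 + t^2) and
    to g + h, whose difference is g. *)
Lemma Rintegral_translate (g : R -> R) C a : continuous g ->
  (forall t, `|g t| <= C * (oneDsqr t)^-1) -> \int[mu]_t g (t + a) = \int[mu]_t g t.
Proof.
move=> cg gC.
have pos (h : R -> R) : continuous h -> (forall t, 0 <= h t) ->
    (\int[mu]_t (h t)%:E = \int[mu]_t (h (t + a))%:E)%E.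
  move=> ch h0.
  have dF (x : R) : is_derive x 1 (fun t => t + a) 1.
    by apply: is_derive_eq; rewrite addr0.
  have F' : derive1 (fun t : R => t + a) = fun=> 1.
    by apply/funext => x; rewrite derive1E derive_val.
  rewrite (@increasing_ge0_integration_by_substitutionT _ (fun t => t + a) h) //.
  - by apply: eq_integral => x _; rewrite F' /= mulr1.
  - by move=> x y; rewrite ltrD2r.
  - by rewrite F' => x; exact: cvg_cst.
  - by rewrite F'; exact: is_cvg_cst.
  - by rewrite F'; exact: is_cvg_cst.
  - exact: cvg_addrr_Ny.
  - exact: cvg_addrr.
pose h (t : R) := `|C| * (oneDsqr t)^-1.
have ch : continuous h by move=> x; apply: cvgMr; exact: continuous_oneDsqrV.
have h0 t : 0 <= h t by rewrite mulr_ge0 // invr_ge0.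
have hC t : `|h t| <= `|C| * (oneDsqr t)^-1 by rewrite ger0_norm.
have ih : mu.-integrable setT (EFin \o h) by exact: integrable_le_oneDsqrV hC.
have ig : mu.-integrable setT (EFin \o g) by exact: integrable_le_oneDsqrV gC.
have sh (f : R -> R) : continuous f -> continuous (fun t => f (t + a)).
  move=> cf x; apply: (@cvg_comp _ _ _ (fun t => t + a) f) (cf _).
  by apply: cvgD; [exact: cvg_id|exact: cvg_cst].
have gh0 t : 0 <= g t + h t.
  have := gC t; rewrite ler_norml => /andP[+ _] => p.
  rewrite -lerBlDr sub0r; apply: le_trans p; rewrite lerN2 ler_wpM2r ?invr_ge0 //.
  exact: ler_norm.
have cgh : continuous (fun t => g t + h t) by move=> x; apply: cvgD; [exact: cg|exact: ch].
have integrable_shift (f : R -> R) : continuous f -> (forall t, 0 <= f t) ->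
   mu.-integrable setT (EFin \o f) -> mu.-integrable setT (EFin \o (fun t => f (t + a))).
  move=> cf f0 /integrableP[_ fi]; apply/integrableP; split.
    by apply/measurable_EFinP; apply: continuous_measurable_fun; exact: sh.
  move: fi; under eq_integral => x _ do rewrite /= ger0_norm //.
  by rewrite pos // => fi; under eq_integral => x _ do rewrite /= ger0_norm //.
have i1 := integrable_shift _ ch h0 ih.
have igh : mu.-integrable setT (EFin \o (fun t => g t + h t)).
  by have := integrableD measurableT ig ih; apply: eq_integrable.
have i2 := integrable_shift _ cgh gh0 igh.
have -> : \int[mu]_t g (t + a) = \int[mu]_t ((g (t + a) + h (t + a)) - h (t + a)).
  by apply: eq_Rintegral => x _; rewrite addrK.
have -> : \int[mu]_t g t = \int[mu]_t ((g t + h t) - h t).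
  by apply: eq_Rintegral => x _; rewrite addrK.
rewrite !RintegralB //.
by rewrite /Rintegral (pos _ cgh gh0) (pos _ ch h0).
Qed.

Lemma weight_translate n (x : 'rV[R]_n) j a : `|a| <= 1 ->
  weight (x + a *: delta_mx 0 j) <= 3 * weight x.
Proof.
move=> a1; rewrite /weight (bigD1 j) //= [in leRHS](bigD1 j) //= mulrA.
rewrite (eq_bigr (fun i => (oneDsqr (x 0 i))^-1)); last first.
  by move=> i ij; rewrite !mxE eqxx /= (negbTE ij) mulr0 addr0.
apply: ler_wpM2r.
  by apply: prodr_ge0 => i _; rewrite invr_ge0 (le_trans ler01) // oneDsqr_ge1.
rewrite !mxE !eqxx mulr1 ler_pdivlMr ?(lt_le_trans ltr01) ?oneDsqr_ge1 // mulrC.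
rewrite ler_pdivrMr ?(lt_le_trans ltr01) ?oneDsqr_ge1 // /oneDsqr.
have a2 : a ^+ 2 <= 1 by rewrite -real_normK ?num_real // expr_le1.
(* with y = x_j + a: 3 (1 + y^2) - (1 + x_j^2) = (y + a)^2 + y^2 + 2 (1 - a^2) *)
have := sqr_ge0 (x 0 j + a + a); have := sqr_ge0 (x 0 j + a); nra.
Qed.

Lemma integrand_translate n (u : 'rV[R]_n -> R) j a : `|a| <= 1 -> integrand u ->
  integrand (fun x => u (x + a *: delta_mx 0 j)).
Proof.
move=> a1 [cu [C uC]]; split.
  move=> x; apply: (@cvg_comp _ _ _ (fun x => x + a *: delta_mx 0 j) u) (cu _).
  apply: (@cvgD _ _ _ (nbhs x) _ id (fun=> a *: delta_mx 0 j)); last exact: cvg_cst.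
  exact: cvg_id.
exists (`|C| * 3) => x; apply: le_trans (uC _) _.
rewrite -mulrA; apply: le_trans (ler_wpM2l (normr_ge0 C) (weight_translate x j a1)).
by apply: ler_wpM2r (ler_norm _); exact/ltW/weight_gt0.
Qed.

Lemma integral_rV_translate n (u : 'rV[R]_n -> R) j a : integrand u ->
  integral_rV (fun x => u (x + a *: delta_mx 0 j)) = integral_rV u.
Proof.
elim: n u j => [u []//|n IH u j iu] /=.
case: (unliftP ord0 j) => [k ->|->].
  apply: eq_Rintegral => t _; rewrite -(IH (slice u t) k); last exact: integrand_slice.
  congr integral_rV; apply/funext => y; rewrite /slice; congr u.
  apply/rowP => i; rewrite mxE; case: (unliftP ord0 i) => [l ->|->].
    by rewrite !row_mx_lift !mxE (inj_eq lift_inj).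
  by rewrite !row_mx_ord0 !mxE /= mulr0 addr0.
have [C uC] := bound_integral_slice iu.
rewrite -(Rintegral_translate a (continuous_integral_slice iu) uC).
apply: eq_Rintegral => t _; congr integral_rV; apply/funext => y; rewrite /slice; congr u.
apply/rowP => i; rewrite mxE; case: (unliftP ord0 i) => [l ->|->].
  by rewrite !row_mx_lift !mxE /= mulr0 addr0.
by rewrite !row_mx_ord0 !mxE /= mulr1.
Qed.

Lemma line_derive n (u : 'rV[R]_n -> R) (e x : 'rV[R]_n) :
  (forall y, derivable u y e) ->
  forall t : R, is_derive t 1 (fun t => u (x + t *: e)) ('D_e u (x + t *: e)).
Proof.
move=> du t.
have eq h : h != 0 -> h^-1 *: ((fun t => u (x + t *: e)) (h *: 1 + t) - u (x + t *: e)) =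
   h^-1 *: (u (h *: e + (x + t *: e)) - u (x + t *: e)).
  by move=> _; congr (_ *: (u _ - _)); rewrite [h *: 1]mulr1 scalerDl addrCA addrA.
have c : (fun h => h^-1 *: ((fun t => u (x + t *: e)) (h *: 1 + t) - u (x + t *: e))) @ 0^' --> 'D_e u (x + t *: e).
  under eq_fun do rewrite [_ *: 1]mulr1 scalerDl addrCA.
  exact: du.
split; first by apply/cvg_ex; exists ('D_e u (x + t *: e)).
exact: cvg_lim c.
Qed.

Lemma line_MVT n (u : 'rV[R]_n -> R) (e x : 'rV[R]_n) (a : R) :
  (forall y, derivable u y e) ->
  exists2 c, `|c| <= `|a| & u (x + a *: e) - u x = 'D_e u (x + c *: e) * a.
Proof.
move=> du; have D := line_derive x du.
have cont : continuous (fun t : R => u (x + t *: e)).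
  by move=> t; apply/differentiable_continuous/derivable1_diffP; case: (D t).
have [a0|a0] := leP 0 a.
  have [c] := @MVT_segment _ (fun t => u (x + t *: e)) _ 0 a a0 (fun t _ => D t)
     (continuous_subspaceT cont).
  rewrite in_itv /= scale0r addr0 subr0 => /andP[c0 ca] h; exists c => //.
  by rewrite !ger0_norm.
have [c] := @MVT_segment _ (fun t => u (x + t *: e)) _ a 0 (ltW a0) (fun t _ => D t)
     (continuous_subspaceT cont).
rewrite in_itv /= scale0r addr0 sub0r => /andP[ca c0] h; exists c => //.
  by rewrite !ler0_norm // ?lerN2 // ltW.
by rewrite -[LHS]opprB h mulrN opprK.
Qed.

(** The difference quotients of u have integral 0 by translation invariance,
    and by the mean value theorem they are dominated, uniformly in the step,
    by the bound on the derivative: dominated convergence applies. *)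
Lemma integral_rV_derive n (u : 'rV[R]_n -> R) j : integrand u ->
  (forall x, derivable u x (delta_mx 0 j)) -> integrand ('D_(delta_mx 0 j) u) ->
  integral_rV ('D_(delta_mx 0 j) u) = 0.
Proof.
move=> iu du [cD [C DC]]; set e := delta_mx 0 j.
pose d k x := k.+1%:R * (u (x + k.+1%:R^-1 *: e) - u x).
have k1 k : `|k.+1%:R^-1| <= 1 :> R.
  by rewrite ger0_norm // invf_le1 // ler1n.
have id k : integrand (d k).
  have iv := integrand_comb (-1) iu (integrand_translate j (k1 k) iu).
  have := integrand_comb (k.+1%:R - 1) iv iv; congr (integrand _).
  by apply/funext => x; rewrite /d; ring.
have I0 k : integral_rV (d k) = 0.
  have it := integrand_translate j (k1 k) iu.
  have iv := integrand_comb (-1) iu it.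
  have -> : d k = (fun x => (k.+1%:R - 1) * (-1 * u x + u (x + k.+1%:R^-1 *: e)) +
       (-1 * u x + u (x + k.+1%:R^-1 *: e))).
    by apply/funext => x; rewrite /d; ring.
  rewrite integral_rV_comb // integral_rV_comb // integral_rV_translate //.
  by rewrite mulN1r addNr mulr0 addr0.
have : (fun k => integral_rV (d k)) @ \oo --> integral_rV ('D_e u).
  apply: (@integral_rV_cvg _ _ _ (`|C| * 3)).
  - by move=> k; case: (id k).
  - exact: cD.
  - move=> k x; have [c ck h] := line_MVT x (k.+1%:R^-1) du.
    rewrite /d h mulrCA mulfV // mulr1.
    apply: le_trans (DC _) _.
    have c1' : `|c| <= 1 by exact: le_trans ck (k1 k).
    rewrite -mulrA; apply: le_trans (ler_wpM2l (normr_ge0 C) (weight_translate x j c1')).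
    by apply: ler_wpM2r (ler_norm _); exact/ltW/weight_gt0.
  - move=> x; have := du x; rewrite /derivable -/('D_e u x) => dx.
    have /cvgr_dnbhsP : (fun h : R => h^-1 *: ((u \o shift x) (h *: e) - u x)) @ 0^' --> 'D_e u x by exact: dx.
    have n0 (k : nat) : k.+1%:R^-1 != 0 :> R by rewrite invr_eq0 pnatr_eq0.
    have h0 : (fun k : nat => k.+1%:R^-1 : R) @ \oo --> (0 : R) by exact: cvg_harmonic.
    move=> hs; have := hs _ (conj n0 h0).
    apply: cvg_trans; apply: near_eq_cvg; apply: nearW => k /=.
    by rewrite /d invrK (addrC _ x).
under eq_fun do rewrite I0.
move=> h; apply/esym; apply: (cvg_unique _ _ h) => //; exact: cvg_cst.
Qed.

End IteratedIntegral.

(** * Partial derivatives of complex-valued functions *)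

Section Calculus.
Variables (R : realType) (n : nat).
Local Notation C := R[i].
Local Notation E := 'rV[R]_n.
Local Notation Re := (@complex.Re R).
Local Notation Im := (@complex.Im R).
Implicit Types (f g : E -> C) (s : seq 'I_n) (i j : 'I_n) (x : E).

Definition cabs (z : C) : R := Num.sqrt (Re z ^+ 2 + Im z ^+ 2).

Lemma cabsE z : `|z| = (cabs z)%:C%C.
Proof. exact: normc_def. Qed.

Lemma cabs_ge0 z : 0 <= cabs z. Proof. exact: sqrtr_ge0. Qed.

Lemma cabsM z w : cabs (z * w) = cabs z * cabs w.
Proof. by apply: complexI; rewrite rmorphM /= -!cabsE normrM. Qed.

Lemma cabsD z w : cabs (z + w) <= cabs z + cabs w.
Proof. by rewrite -lecR rmorphD /= -!cabsE ler_normD. Qed.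

Lemma cabsN z : cabs (- z) = cabs z.
Proof. by apply: complexI; rewrite -!cabsE normrN. Qed.

Lemma cabs0 : cabs 0 = 0.
Proof. by apply: complexI; rewrite -!cabsE normr0. Qed.

Lemma cabs1 : cabs 1 = 1.
Proof. by apply: complexI; rewrite -!cabsE normr1. Qed.

Lemma cabs_eq0 z : cabs z = 0 -> z = 0.
Proof. by move=> z0; apply/eqP; rewrite -normr_eq0 cabsE z0. Qed.

Lemma cabs_real (a : R) : cabs (a%:C)%C = `|a|.
Proof. by rewrite /cabs /= expr0n /= addr0 sqrtr_sqr. Qed.

Lemma Re_le_cabs z : `|Re z| <= cabs z.
Proof. by rewrite -lecR -cabsE normc_ge_Re. Qed.

Lemma Im_le_cabs z : `|Im z| <= cabs z.
Proof.
by rewrite /cabs -[leLHS]sqrtr_sqr ler_wsqrtr // lerDr sqr_ge0.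
Qed.

Lemma cabs_le_ReIm z : cabs z <= `|Re z| + `|Im z|.
Proof.
case: z => a b /=; rewrite -[leLHS]ger0_norm ?cabs_ge0 //.
rewrite -ler_sqr ?nnegrE ?addr_ge0 // real_normK ?num_real //.
rewrite sqr_sqrtr ?addr_ge0 ?sqr_ge0 //= sqrrD !real_normK ?num_real //.
by rewrite -addrA lerD2l lerDr mulrn_wge0 // mulr_ge0.
Qed.

Lemma complex_ext (z w : C) : Re z = Re w -> Im z = Im w -> z = w.
Proof. by case: z w => [a b] [c d] /= -> ->. Qed.

Lemma cReD z w : Re (z + w) = Re z + Re w.
Proof. by case: z w => [a b] [c d]. Qed.

Lemma cImD z w : Im (z + w) = Im z + Im w.
Proof. by case: z w => [a b] [c d]. Qed.

Lemma cReM z w : Re (z * w) = Re z * Re w - Im z * Im w.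
Proof. by case: z w => [a b] [c d]. Qed.

Lemma cImM z w : Im (z * w) = Re z * Im w + Im z * Re w.
Proof. by case: z w => [a b] [c d]. Qed.

(** The relation carries differentiability along with the value, so that it
    composes without side conditions, unlike the function partial. *)
Definition has_partial i f g := forall x,
  is_derive x (basis_vector R i) (fun y => Re (f y)) (Re (g x)) /\
  is_derive x (basis_vector R i) (fun y => Im (f y)) (Im (g x)).

Definition ccont f :=
  continuous (fun x => Re (f x)) /\ continuous (fun x => Im (f x)).

Lemma has_partialE i f g : has_partial i f g -> partial i f = g.
Proof.
move=> h; apply/funext => x; rewrite /partial; have [h1 h2] := h x.
by case: h1 h2 => _ -> [_ ->]; case: (g x).
Qed.

Lemma C1_funP f : C1_fun f <-> ccont f /\ forall i, has_partial i f (partial i f).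
Proof.
split=> [[c1 c2 d]|[[c1 c2] d]]; split=> //.
  by move=> i x; have [d1 d2] := d i x; split; exact/derivableP.
by move=> i x; have [[d1 _] [d2 _]] := d i x.
Qed.

Lemma is_derive_eqfun (u v : E -> R) (a b : R) x (e : E) :
  is_derive x e u a -> u =1 v -> a = b -> is_derive x e v b.
Proof. by move=> h /funext <- <-. Qed.

Lemma has_partialD i f g f' g' : has_partial i f f' -> has_partial i g g' ->
  has_partial i (fun x => f x + g x) (fun x => f' x + g' x).
Proof.
move=> hf hg x; have [f1 f2] := hf x; have [g1 g2] := hg x; split.
  by apply: is_derive_eqfun (is_deriveD f1 g1) _ _ => [y|] /=; rewrite raddfD.
by apply: is_derive_eqfun (is_deriveD f2 g2) _ _ => [y|] /=; rewrite raddfD.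
Qed.

Lemma has_partial_cst i (c : C) : has_partial i (fun=> c) (fun=> 0).
Proof. by move=> x; split; exact: is_derive_cst. Qed.

Lemma has_partialM i f g f' g' : has_partial i f f' -> has_partial i g g' ->
  has_partial i (fun x => f x * g x) (fun x => f' x * g x + f x * g' x).
Proof.
move=> hf hg x; have [f1 f2] := hf x; have [g1 g2] := hg x; split.
  apply: is_derive_eqfun (is_deriveB (is_deriveM f1 g1) (is_deriveM f2 g2)) _ _.
    by move=> y /=; rewrite cReM.
  by rewrite cReD !cReM /GRing.scale /=; ring.
apply: is_derive_eqfun (is_deriveD (is_deriveM f1 g2) (is_deriveM f2 g1)) _ _.
  by move=> y /=; rewrite cImM.
by rewrite cImD !cImM /GRing.scale /=; ring.
Qed.

Lemma has_partial_real i (u u' : E -> R) :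
  (forall x, is_derive x (basis_vector R i) u (u' x)) ->
  has_partial i (fun x => (u x)%:C)%C (fun x => (u' x)%:C)%C.
Proof. by move=> h x; split => //=; exact: is_derive_cst. Qed.

Lemma is_derive_coord i j x :
  is_derive x (basis_vector R i) (fun y : E => y 0 j) (i == j)%:R.
Proof.
have e h : h != 0 -> h^-1 *: (((fun y : E => y 0 j) \o shift x) (h *: basis_vector R i) - x 0 j) = (i == j)%:R.
  move=> h0; rewrite /= !mxE eqxx /= addrK /GRing.scale /= mulrA mulVf // mul1r.
  by rewrite eq_sym.
have c : (fun h : R => h^-1 *: (((fun y : E => y 0 j) \o shift x) (h *: basis_vector R i) - x 0 j)) @ 0^'
    --> ((i == j)%:R : R).
  apply: cvg_near_cst; near=> h; apply: e; near: h.
  exact: nbhs_dnbhs_neq.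
split; first by apply/cvg_ex; exists (i == j)%:R.
exact: cvg_lim c.
Unshelve. all: by end_near. Qed.

Lemma ccontD f g : ccont f -> ccont g -> ccont (fun x => f x + g x).
Proof.
move=> [f1 f2] [g1 g2]; split.
  rewrite (_ : (fun _ => _) = (fun x => Re (f x) + Re (g x))).
    by move=> x; exact: cvgD (f1 x) (g1 x).
  by apply/funext => x; rewrite raddfD.
rewrite (_ : (fun _ => _) = (fun x => Im (f x) + Im (g x))).
  by move=> x; exact: cvgD (f2 x) (g2 x).
by apply/funext => x; rewrite raddfD.
Qed.

Lemma ccontM f g : ccont f -> ccont g -> ccont (fun x => f x * g x).
Proof.
move=> [f1 f2] [g1 g2]; split.
  rewrite (_ : (fun _ => _) = (fun x => Re (f x) * Re (g x) - Im (f x) * Im (g x))).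
    by move=> x; exact: cvgB (cvgM (f1 x) (g1 x)) (cvgM (f2 x) (g2 x)).
  by apply/funext => x; rewrite cReM.
rewrite (_ : (fun _ => _) = (fun x => Re (f x) * Im (g x) + Im (f x) * Re (g x))).
  by move=> x; exact: cvgD (cvgM (f1 x) (g2 x)) (cvgM (f2 x) (g1 x)).
by apply/funext => x; rewrite cImM.
Qed.

Lemma ccont_cst c : ccont (fun=> c).
Proof. by split; exact: (@cst_continuous _ R). Qed.

Lemma ccont_real (u : E -> R) : continuous u -> ccont (fun x => (u x)%:C)%C.
Proof. by move=> cu; split => //=; exact: (@cst_continuous _ R). Qed.

(** One recursive notion for the two classes B of interest, rapidly decreasing
    and slowly increasing functions: to prove regularity it is enough to
    exhibit a derivative at each step. *)
Fixpoint regular (B : set (E -> C)) m f : Prop :=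
  [/\ ccont f, B f & if m is m'.+1 then
     forall i, exists2 g, has_partial i f g & regular B m' g else True].

Lemma regular_bound B m f : regular B m f -> B f.
Proof. by case: m => [|m] []. Qed.

Lemma regular_ccont B m f : regular B m f -> ccont f.
Proof. by case: m => [|m] []. Qed.

Lemma regular_partial B m f i : regular B m.+1 f ->
  has_partial i f (partial i f) /\ regular B m (partial i f).
Proof. by move=> [_ _ /(_ i)[g hg rg]]; rewrite (has_partialE hg). Qed.

Lemma regularS B m f : regular B m.+1 f -> regular B m f.
Proof.
elim: m f => [|m IH] f [c b h]; split=> // i.
by have [g hg rg] := h i; exists g => //; exact: IH.
Qed.

Lemma regular_iter B m s f : regular B (size s + m) f -> regular B m (iter_partial s f).
Proof.
elim: s m => [//|i s IH] m; rewrite [size _]/= addSnnS => /IH h.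
exact: (regular_partial i h).2.
Qed.

Lemma regularP B f : (forall m, regular B m f) <->
  smooth_fun f /\ forall s, B (iter_partial s f).
Proof.
split=> [h|[sf bf] m].
  split=> s.
    apply/C1_funP; have r1 := regular_iter (h (size s + 1)).
    split; first exact: regular_ccont r1.
    by move=> i; have [] := regular_partial i r1.
  exact/(@regular_bound _ 0)/regular_iter/h.
elim: m f sf bf => [|m IH] f sf bf; have /C1_funP[cf df] := sf [::]; split=> //;
  do ?exact: (bf [::]).
move=> i; exists (partial i f); first exact: df.
have e s : iter_partial s (partial i f) = iter_partial (rcons s i) f.
  by rewrite /iter_partial foldr_rcons.
by apply: IH => s; rewrite e.
Qed.

Lemma regularD (B B' B'' : set (E -> C)) m f g :
  (forall f g, B f -> B' g -> B'' (fun x => f x + g x)) ->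
  regular B m f -> regular B' m g -> regular B'' m (fun x => f x + g x).
Proof.
move=> BD; elim: m f g => [|m IH] f g [cf bf hf] [cg bg hg].
  by split => //; [exact: ccontD|exact: BD].
split; [exact: ccontD|exact: BD|move=> i].
have [f' pf rf] := hf i; have [g' pg rg] := hg i.
by eexists; [exact: has_partialD pf pg|exact: IH].
Qed.

Lemma regularM (B B' B'' : set (E -> C)) m f g :
  (forall f g, B f -> B' g -> B'' (fun x => f x * g x)) ->
  (forall f g, B'' f -> B'' g -> B'' (fun x => f x + g x)) ->
  regular B m f -> regular B' m g -> regular B'' m (fun x => f x * g x).
Proof.
move=> BM BD; elim: m f g => [|m IH] f g.
  by move=> [cf bf _] [cg bg _]; split => //; [exact: ccontM|exact: BM].
move=> rf rg; have [cf bf hf] := rf; have [cg bg hg] := rg.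
split; [exact: ccontM|exact: BM|move=> i].
have [f' pf rf'] := hf i; have [g' pg rg'] := hg i.
eexists; first exact: has_partialM pf pg.
apply: (regularD BD); apply: IH => //; exact: regularS.
Qed.

End Calculus.

(** * Seminorms and multipliers of Schwartz functions *)

Section SchwartzSpace.
Variables (R : realType) (n : nat).
Local Notation C := R[i].
Local Notation E := 'rV[R]_n.
Local Notation schwartz := (schwartz R n).
Implicit Types (f g : E -> C) (s a b : seq 'I_n) (i j : 'I_n) (x : E) (k m : nat).

(** The square of the Japanese bracket, so as to stay polynomial in x. *)
Definition jap x : R := 1 + \sum_i x 0 i ^+ 2.

Lemma jap_ge1 x : 1 <= jap x.
Proof. by rewrite lerDl sumr_ge0 // => i _; rewrite sqr_ge0. Qed.

Lemma jap_gt0 x : 0 < jap x. Proof. exact: lt_le_trans ltr01 (jap_ge1 x). Qed.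

Lemma jap_ge0 x : 0 <= jap x. Proof. exact: ltW (jap_gt0 x). Qed.

Lemma coord_sqr_le_jap x i : 1 + x 0 i ^+ 2 <= jap x.
Proof. by rewrite lerD2l (bigD1 i) //= lerDl sumr_ge0 // => j _; rewrite sqr_ge0. Qed.

Lemma coord_le_jap x i : `|x 0 i| <= jap x.
Proof.
apply: le_trans (coord_sqr_le_jap x i).
rewrite -(real_normK (num_real (x 0 i))).
have := sqr_ge0 (`|x 0 i| - 2^-1); have := normr_ge0 (x 0 i); nra.
Qed.

Lemma coord_monomial_le_jap a x : `|coord_monomial a x| <= jap x ^+ size a.
Proof.
rewrite /coord_monomial; elim: a => [|i a IH]; first by rewrite big_nil normr1.
by rewrite big_cons normrM exprS ler_pM // coord_le_jap.
Qed.

Lemma jap_expn_le x k k' : (k <= k')%N -> jap x ^+ k <= jap x ^+ k'.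
Proof. by move=> kk; apply: ler_weXn2l => //; exact: jap_ge1. Qed.

Definition slow : set (E -> C) := fun f => exists k M, forall x, cabs (f x) <= M * jap x ^+ k.

Definition rapid : set (E -> C) := fun f => forall k, exists M, forall x, jap x ^+ k * cabs (f x) <= M.

Lemma scale_jap_le x k k' M : (k <= k')%N -> M * jap x ^+ k <= `|M| * jap x ^+ k'.
Proof.
move=> kk; apply: (@le_trans _ _ (`|M| * jap x ^+ k)).
  by rewrite ler_wpM2r ?ler_norm // exprn_ge0 // jap_ge0.
by rewrite ler_wpM2l // jap_expn_le.
Qed.

Lemma slowD f g : slow f -> slow g -> slow (fun x => f x + g x).
Proof.
move=> [k [M fM]] [l [N gN]]; exists (k + l)%N, (`|M| + `|N|) => x.
apply: le_trans (cabsD _ _) _; rewrite mulrDl; apply: lerD.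
  by apply: le_trans (fM x) (scale_jap_le _ _ _); exact: leq_addr.
by apply: le_trans (gN x) (scale_jap_le _ _ _); exact: leq_addl.
Qed.

Lemma slowM f g : slow f -> slow g -> slow (fun x => f x * g x).
Proof.
move=> [k [M fM]] [l [N gN]]; exists (k + l)%N, (M * N) => x.
by rewrite cabsM exprD mulrACA ler_pM ?cabs_ge0.
Qed.

Lemma rapidD f g : rapid f -> rapid g -> rapid (fun x => f x + g x).
Proof.
move=> hf hg k; have [M fM] := hf k; have [N gN] := hg k; exists (M + N) => x.
apply: le_trans (lerD (fM x) (gN x)); rewrite -mulrDr ler_wpM2l ?cabsD //.
by rewrite exprn_ge0 // jap_ge0.
Qed.

Lemma slow_rapidM f g : slow f -> rapid g -> rapid (fun x => f x * g x).
Proof.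
move=> [l [N fN]] hg k; have [M gM] := hg (k + l)%N; exists (`|N| * M) => x.
rewrite cabsM; apply: le_trans (ler_wpM2l (normr_ge0 N) (gM x)).
rewrite (_ : `|N| * _ = jap x ^+ k * ((`|N| * jap x ^+ l) * cabs (g x))); last first.
  by rewrite exprD; ring.
apply: ler_wpM2l; first by rewrite exprn_ge0 // jap_ge0.
apply: ler_wpM2r; first exact: cabs_ge0.
exact: le_trans (fN x) (scale_jap_le _ _ (leqnn l)).
Qed.

(** By induction on the exponent: jap times u satisfies the same hypothesis as
    u, since jap x is a sum of squares of coordinates. *)
Lemma monomials_rapid f :
  (forall a, exists M : R, forall x, `|coord_monomial a x| * cabs (f x) <= M) -> rapid f.
Proof.
move=> h k.
suff : forall u : E -> R, (forall a, exists M : R, forall x, `|coord_monomial a x| * u x <= M) ->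
    exists M, forall x, jap x ^+ k * u x <= M by move=> /(_ (fun x => cabs (f x)) h).
elim: k => [|k IH] u hu.
  have [M uM] := hu [::]; exists M => x; have := uM x.
  by rewrite expr0 /coord_monomial big_nil normr1.
have [M uM] := choice hu.
have [|N uN] := IH (fun x => jap x * u x); last first.
  by exists N => x; rewrite exprSr -mulrA; exact: uN.
move=> a; exists (M a + \sum_i M (i :: i :: a)) => x.
rewrite mulrCA /jap mulrDl mul1r lerD //.
rewrite mulr_suml; apply: ler_sum => i _; apply: le_trans (uM _ x).
by rewrite /coord_monomial !big_cons !normrM !mulrA -normrM -expr2 ger0_norm ?sqr_ge0.
Qed.

(** Expanding jap x ^+ k yields (1 + n)^k monomials, counted with
    multiplicity, of degree at most 2 k. *)
Lemma jap_le_monomials x (v d : R) k :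
  (forall a, (size a <= 2 * k)%N -> `|coord_monomial a x| * v <= d) ->
  jap x ^+ k * v <= (1 + n%:R) ^+ k * d.
Proof.
elim: k v d => [|k IH] v d h.
  by have := h [::] (leqnn _); rewrite !expr0 !mul1r /coord_monomial big_nil normr1 mul1r.
rewrite exprSr -mulrA [in leRHS]exprSr -mulrA; apply: IH => a ha.
rewrite mulrCA /jap mulrDl mul1r mulrDl mul1r lerD //.
  by apply: h; rewrite (leq_trans ha) // leq_mul2l leqnSn orbT.
rewrite mulr_suml -[n in n%:R]card_ord -sumr_const mulr_suml; apply: ler_sum => i _.
rewrite mul1r; apply: le_trans (h (i :: i :: a) _).
  by rewrite /coord_monomial !big_cons !normrM !mulrA -normrM -expr2 ger0_norm ?sqr_ge0.
by rewrite mulnS add2n /= !ltnS.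
Qed.

Lemma schwartz_regularP f : is_schwartz f <-> forall m, regular rapid m f.
Proof.
rewrite regularP; split=> -[sf bf]; split; [exact: sf|move=> s|exact: sf|move=> a b].
  apply: monomials_rapid => a; have [M hM] := bf a s; exists M => x.
  by have := hM x; rewrite /schwartz_weight normrM !cabsE -rmorphM lecR /= cabs_real.
have [M hM] := bf b (size a); exists M => x.
rewrite /schwartz_weight normrM !cabsE -rmorphM lecR /= cabs_real.
apply: le_trans (hM x); apply: ler_wpM2r; first exact: cabs_ge0.
exact: coord_monomial_le_jap.
Qed.

Lemma schwartz_regular (f : schwartz) m : regular rapid m f.
Proof. exact: (schwartz_regularP f).1 (schwartzP f) m. Qed.

Lemma mk_schwartz_subproof f : (forall m, regular rapid m f) ->
  (f : E -> C^o) \in @schwartz_pred R n.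
Proof. by move=> h; apply/asboolP/schwartz_regularP. Qed.

Definition mk_schwartz f (h : forall m, regular rapid m f) : schwartz :=
  Schwartz (mk_schwartz_subproof h).

Lemma schwartz_eq (f g : schwartz) : (forall x, f x = g x) -> f = g.
Proof. by move=> fg; apply: val_inj; apply/funext. Qed.

Lemma schwartz_has_partial i (f : schwartz) : has_partial i f (partial i f).
Proof. exact: (regular_partial i (schwartz_regular f 1)).1. Qed.

Section Multiplier.
Variable h : E -> C.
Hypothesis hh : forall m, regular slow m h.

Lemma multiply_subproof (f : schwartz) m : regular rapid m (fun x => h x * f x).
Proof.
exact: (regularM slow_rapidM rapidD) (hh m) (schwartz_regular f m).
Qed.

Definition multiply (f : schwartz) : schwartz := mk_schwartz (multiply_subproof f).

Lemma multiply_is_linear : linear multiply.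
Proof. by move=> a f g; apply: schwartz_eq => x; rewrite /= mulrDr mulrCA. Qed.

End Multiplier.

Lemma regular_slow_cst c m : regular slow m (fun _ : E => c).
Proof.
elim: m c => [|m IH] c; split=> //; do ?exact: ccont_cst;
  do ?by exists 0%N, (cabs c) => x; rewrite mulr1.
by move=> i; exists (fun=> 0) => //; exact: has_partial_cst.
Qed.

Lemma coord_has_partial i j : has_partial i (fun x => (x 0 j)%:C%C) (fun=> (i == j)%:R).
Proof.
have e : (i == j)%:R = ((i == j)%:R : R)%:C%C by case: eqP.
rewrite e; apply: (@has_partial_real _ _ _ _ (fun=> _)) => x; exact: is_derive_coord.
Qed.

Lemma regular_slow_coord j m : regular slow m (fun x => (x 0 j)%:C%C).
Proof.
case: m => [|m]; split=> //; do ?(apply: ccont_real; exact: coord_continuous);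
  do ?by exists 1%N, 1 => x; rewrite cabs_real mul1r expr1 coord_le_jap.
by move=> i; exists (fun=> (i == j)%:R); [exact: coord_has_partial|exact: regular_slow_cst].
Qed.

Lemma regular_slowM m f g : regular slow m f -> regular slow m g ->
  regular slow m (fun x => f x * g x).
Proof. exact: (regularM slowM slowD). Qed.

Lemma regular_slowD m f g : regular slow m f -> regular slow m g ->
  regular slow m (fun x => f x + g x).
Proof. exact: (regularD slowD). Qed.

Definition mul_coord j : schwartz -> schwartz := multiply (regular_slow_coord j).

(** Bounds instead of suprema; decay and differentiability have separate
    orders, because each operation costs one or the other. *)
Definition seminorm_le k m (B : R) f := forall b x, (size b <= m)%N ->
  jap x ^+ k * cabs (iter_partial b f x) <= B.

Lemma seminorm_le0 k m B f : seminorm_le k m B f -> forall x, jap x ^+ k * cabs (f x) <= B.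
Proof. by move=> h x; exact: (h [::]). Qed.

Lemma seminorm_le_ge0 k m B f : seminorm_le k m B f -> 0 <= B.
Proof.
move=> /seminorm_le0/(_ 0); apply: le_trans.
by rewrite mulr_ge0 ?cabs_ge0 // exprn_ge0 // jap_ge0.
Qed.

(** The innermost derivative is the one that is peeled off, so that inductions
    on m stay inside the Schwartz space. *)
Lemma seminorm_leS k m B f : seminorm_le k m.+1 B f <->
  (forall x, jap x ^+ k * cabs (f x) <= B) /\ forall i, seminorm_le k m B (partial i f).
Proof.
have e s i : iter_partial s (partial i f) = iter_partial (rcons s i) f.
  by rewrite /iter_partial foldr_rcons.
split=> [h|[h0 h]].
  split=> [x|i b x bm]; first exact: seminorm_le0 h x.
  by rewrite e; apply: h; rewrite size_rcons.
case/lastP => [|b i] x; first by move=> _; exact: h0.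
by rewrite size_rcons -e => bm; exact: h.
Qed.

Lemma seminorm_leW k k' m m' B B' f : (k <= k')%N -> (m <= m')%N -> B' <= B ->
  seminorm_le k' m' B' f -> seminorm_le k m B f.
Proof.
move=> kk mm BB h b x bm; apply: le_trans BB; apply: le_trans (h b x (leq_trans bm mm)).
by rewrite ler_wpM2r ?cabs_ge0 // jap_expn_le.
Qed.

Lemma seminorm_ex k m (f : schwartz) : exists B, seminorm_le k m B f.
Proof.
elim: m f => [|m IH] f.
  have [M hM] := regular_bound (schwartz_regular f 0) k.
  by exists M => b x; rewrite leqn0 size_eq0 => /eqP ->; exact: hM.
have [M hM] := regular_bound (schwartz_regular f 0) k.
have [N hN] := choice (fun i => IH (schwartz_partial i f)).
have N0 i : 0 <= N i by exact: seminorm_le_ge0 (hN i).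
exists (`|M| + \sum_i N i); apply/seminorm_leS; split=> [x|i].
  by apply: le_trans (hM x) _; rewrite (le_trans (ler_norm _)) // lerDl sumr_ge0.
apply: seminorm_leW (hN i) => //.
rewrite (bigD1 i) //= addrCA lerDl addr_ge0 // sumr_ge0 //.
Qed.

Lemma seminorm_comb k m (c : C) B B' (f g : schwartz) :
  seminorm_le k m B f -> seminorm_le k m B' g -> seminorm_le k m (cabs c * B + B') (c *: f + g).
Proof.
move=> hf hg b x bm; have [sf _] := schwartzP f; have [sg _] := schwartzP g.
have -> : iter_partial b (c *: f + g) x = c * iter_partial b f x + iter_partial b g x.
  by have := iter_partial_comb c sf sg b => /(congr1 (@^~ x)).
apply: le_trans (lerD (ler_wpM2l (cabs_ge0 c) (hf b x bm)) (hg b x bm)).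
by rewrite mulrCA -mulrDr -cabsM ler_wpM2l ?cabsD // exprn_ge0 // jap_ge0.
Qed.

Lemma seminorm_scale k m (c : C) B (f : schwartz) :
  seminorm_le k m B f -> seminorm_le k m (cabs c * B) (c *: f).
Proof.
move=> hf; have h0 : seminorm_le k m 0 (0 : schwartz).
  move=> b x bm; have [s0 _] := schwartzP (0 : schwartz).
  have := iter_partial_comb (-1) s0 s0 b => /(congr1 (@^~ x)).
  have -> : (fun x0 => -1 * (0 : schwartz) x0 + (0 : schwartz) x0) = (0 : schwartz).
    by apply/funext => y; rewrite mulN1r addNr.
  by move=> ->; rewrite mulN1r addNr cabs0 mulr0.
by have := seminorm_comb c hf h0; rewrite !addr0.
Qed.

Lemma seminormD k m B B' (f g : schwartz) :
  seminorm_le k m B f -> seminorm_le k m B' g -> seminorm_le k m (B + B') (f + g).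
Proof. by move=> hf hg; have := seminorm_comb 1 hf hg; rewrite scale1r cabs1 mul1r. Qed.

Lemma seminorm_partial k m B i (f : schwartz) : seminorm_le k m.+1 B f ->
  seminorm_le k m B (schwartz_partial i f).
Proof. by move=> /seminorm_leS[_]; exact. Qed.

Lemma partial_mul_coord i j (f : schwartz) :
  schwartz_partial i (mul_coord j f) =
  (i == j)%:R *: f + mul_coord j (schwartz_partial i f).
Proof.
apply: val_inj => /=; apply: has_partialE.
exact: has_partialM (coord_has_partial i j) (schwartz_has_partial i f).
Qed.

(** By the Leibniz rule each of the at most m derivatives may hit the
    coordinate once, hence the constant m.+1. *)
Lemma seminorm_mul_coord k m B j (f : schwartz) : seminorm_le k.+1 m B f ->
  seminorm_le k m (m.+1%:R * B) (mul_coord j f).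
Proof.
have b0 (g : schwartz) B' : (forall x, jap x ^+ k.+1 * cabs (g x) <= B') ->
    forall x, jap x ^+ k * cabs (mul_coord j g x) <= B'.
  move=> h x; apply: le_trans (h x).
  rewrite /= cabsM cabs_real exprSr -mulrA ler_wpM2l ?exprn_ge0 ?jap_ge0 //.
  by rewrite ler_wpM2r ?cabs_ge0 ?coord_le_jap.
elim: m f => [|m IH] f hf.
  rewrite mul1r => b x; rewrite leqn0 size_eq0 => /eqP ->.
  by apply: b0; exact: seminorm_le0 hf.
have B0 := seminorm_le_ge0 hf.
apply/seminorm_leS; split=> [x|i].
  apply: le_trans (b0 _ _ (seminorm_le0 hf) x) _.
  by rewrite ler_peMl // ler1n.
rewrite -[partial i _]/(schwartz_fun (schwartz_partial i (mul_coord j f))) partial_mul_coord.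
rewrite -[m.+2]add1n natrD mulrDl mul1r.
have := seminorm_comb (i == j)%:R (seminorm_leW (leqnSn k) (leqnSn m) (lexx _) hf) (IH _ (seminorm_partial i hf)).
apply: seminorm_leW => //; rewrite lerD2r; case: eqP => _; rewrite ?cabs1 ?cabs0 ?mul1r ?mul0r //.
Qed.

End SchwartzSpace.

(** * Multiplication by powers of 1 / (|x|^2 + e) *)

Section LineDerivatives.
Variables (R : realType) (n : nat).
Local Notation E := 'rV[R]_n.

Lemma is_derive_line (u : E -> R) (x e : E) (a : R) :
  is_derive x e u a <-> is_derive (0 : R) 1 (fun t : R => u (x + t *: e)) a.
Proof.
have E : (fun h : R => h^-1 *: ((u \o shift x) (h *: e) - u x)) =
   (fun h : R => h^-1 *: (((fun t : R => u (x + t *: e)) \o shift 0) (h *: 1) - u (x + (0 : R) *: e))).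
  apply/funext => h /=; rewrite [h *: 1]mulr1 addr0 scale0r addr0.
  by rewrite (addrC _ x).
split=> -[d1 d2]; split; move: d1 d2; rewrite /derivable /derive;
  by rewrite ?E // -?E.
Qed.

(** Restricted to the line through x in the direction e, this is the chain rule
    in one variable. *)
Lemma is_derive_comp_line (h : R -> R) (u : E -> R) (x e : E) (a b : R) :
  is_derive x e u a -> is_derive (u x) 1 h b -> is_derive x e (h \o u) (b * a).
Proof.
move=> /is_derive_line du dh; apply/is_derive_line.
apply: (@is_derive1_comp _ h (fun t : R => u (x + t *: e)) 0).
by rewrite scale0r addr0.
Qed.

End LineDerivatives.

Section Resolvent.
Variables (R : realType) (n : nat).
Local Notation C := R[i].
Local Notation E := 'rV[R]_n.
Local Notation schwartz := (schwartz R n).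
Implicit Types (f g : schwartz) (s a b : seq 'I_n) (i j : 'I_n) (x : E) (k m : nat).

Definition normsq x : R := \sum_i x 0 i ^+ 2.

Lemma normsq_ge0 x : 0 <= normsq x.
Proof. by apply: sumr_ge0 => i _; rewrite sqr_ge0. Qed.

Lemma japE x : jap x = 1 + normsq x. Proof. by []. Qed.

Lemma is_derive_normsq i x : is_derive x (basis_vector R i) normsq (2 * x 0 i).
Proof.
have h j : is_derive x (basis_vector R i) (fun y : E => y 0 j ^+ 2) (2 * x 0 j * (i == j)%:R).
  have := is_deriveM (is_derive_coord i j x) (is_derive_coord i j x).
  by move=> d; apply: is_derive_eqfun d _ _ => //; rewrite /GRing.scale /=; ring.
have := is_derive_sum (h := fun j (y : E) => y 0 j ^+ 2) h.
move=> d; apply: is_derive_eqfun d _ _ => [y|].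
  by rewrite fct_sumE.
rewrite (bigD1 i) //= eqxx mulr1 big1 ?addr0 // => j ij.
by rewrite eq_sym (negbTE ij) mulr0.
Qed.

Lemma continuous_normsq : continuous normsq.
Proof.
suff h (r : seq 'I_n) : continuous (fun x : E => \sum_(i <- r) x 0 i ^+ 2) by exact: h.
elim: r => [|i r IH].
  rewrite (_ : (fun _ => _) = fun=> 0); last by apply/funext => x; rewrite big_nil.
  exact: (@cst_continuous _ R).
rewrite (_ : (fun _ => _) = fun x : E => x 0 i * x 0 i + \sum_(i <- r) x 0 i ^+ 2).
  by move=> x; apply: cvgD (IH x); apply: cvgM; exact: coord_continuous.
by apply/funext => x; rewrite big_cons.
Qed.

Definition resolv (e : R) k x : R := (normsq x + e)^-1 ^+ k.

Lemma normsqDe_gt0 e x : 0 < e -> 0 < normsq x + e.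
Proof. by move=> e0; rewrite ltr_wpDl // normsq_ge0. Qed.

Lemma resolv_ge0 e k x : 0 < e -> 0 <= resolv e k x.
Proof. by move=> e0; rewrite exprn_ge0 // invr_ge0 ltW // normsqDe_gt0. Qed.

Lemma continuous_resolv (e : R) k : 0 < e -> continuous (resolv e k).
Proof.
move=> e0; have ce : continuous (fun _ : E => e) by exact: (@cst_continuous E R).
have c : continuous (fun y : E => normsq y + e).
  by move=> y; exact: cvgD (continuous_normsq (x:=y)) (ce y).
have cV : continuous (fun y : E => (normsq y + e)^-1).
  by move=> y; apply: cvgV (c y); rewrite gt_eqF // normsqDe_gt0.
move=> x; apply: (@continuous_comp _ _ _ (fun x => (normsq x + e)^-1) (fun t => t ^+ k)).
  exact: cV.
exact: exprn_continuous.
Qed.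

Lemma is_derive_resolv e k i x : 0 < e ->
  is_derive x (basis_vector R i) (resolv e k) (- (2 * k%:R) * x 0 i * resolv e k.+1 x).
Proof.
move=> e0; have ne0 : normsq x + e != 0 by rewrite gt_eqF // normsqDe_gt0.
have d1 : is_derive x (basis_vector R i) (resolv e 1) (- 2 * x 0 i * resolv e 2 x).
  have dV : is_derive (normsq x) 1 (fun t : R => (t + e)^-1) (- (normsq x + e) ^- 2).
    have dt : is_derive (normsq x) 1 (fun t : R => t + e) 1.
      by apply: is_derive_eq; rewrite addr0.
    have d := @is_deriveV R (fun t => t + e) (normsq x) 1 1 ne0 dt.
    by apply: is_derive_eq d _; rewrite /GRing.scale /= mulr1.
  have := is_derive_comp_line (is_derive_normsq i x) dV => d.
  apply: is_derive_eqfun d _ _ => [y|]; first by rewrite /resolv expr1.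
  by rewrite /resolv exprVn; ring.
elim: k => [|k IH].
  rewrite mulr0 oppr0 !mul0r.
  apply: is_derive_eqfun (is_derive_cst (1 : R) x (basis_vector R i)) _ _ => // y.
have := is_deriveM d1 IH => d; apply: is_derive_eqfun d _ _ => [y|].
  by rewrite -[LHS]/(resolv e 1 y * resolv e k y) /resolv -exprD.
rewrite /GRing.scale /= /resolv !exprS -natr1; ring.
Qed.

Lemma resolv_has_partial e k i : 0 < e ->
  has_partial i (fun x => (resolv e k x)%:C%C)
    (fun x => (- (2 * k%:R))%:C%C * ((x 0 i)%:C%C * (resolv e k.+1 x)%:C%C)).
Proof.
move=> e0; rewrite (_ : (fun x => _ * _) = (fun x => (- (2 * k%:R) * x 0 i * resolv e k.+1 x)%:C%C)).
  by apply: has_partial_real => x; exact: is_derive_resolv.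
by apply/funext => x; rewrite !rmorphM /= mulrA.
Qed.

Lemma resolv_slow e k : 0 < e -> slow (fun x => (resolv e k x)%:C%C).
Proof.
move=> e0; exists 0%N, (e^-1 ^+ k) => x; rewrite mulr1 cabs_real ger0_norm ?resolv_ge0 //.
rewrite /resolv lerXn2r ?nnegrE ?invr_ge0 ?(ltW (normsqDe_gt0 _ _)) ?(ltW e0) //.
by rewrite lef_pV2 ?posrE // ?normsqDe_gt0 // lerDr normsq_ge0.
Qed.

Lemma regular_slow_resolv e k m : 0 < e -> regular (@slow R n) m (fun x => (resolv e k x)%:C%C).
Proof.
move=> e0; elim: m k => [|m IH] k.
  split=> //; last exact: resolv_slow.
  by apply: ccont_real; exact: continuous_resolv.
split=> [||i]; last 1 first.
- eexists; first exact: resolv_has_partial.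
  apply: regular_slowM; first exact: regular_slow_cst.
  by apply: regular_slowM (IH _); exact: regular_slow_coord.
- by apply: ccont_real; exact: continuous_resolv.
- exact: resolv_slow.
Qed.

Definition resolvent e (e0 : 0 < e) k : schwartz -> schwartz :=
  multiply (fun m => regular_slow_resolv k m e0).

(** Each derivative raises the exponent by one, so that estimates of the
    derivatives must treat all exponents at once. *)
Lemma partial_resolvent e (e0 : 0 < e) k i f :
  schwartz_partial i (resolvent e0 k f) =
  resolvent e0 k (schwartz_partial i f) +
  (- (2 * k%:R))%:C%C *: resolvent e0 k.+1 (mul_coord i f).
Proof.
apply: val_inj => /=; apply: has_partialE.
have := has_partialM (resolv_has_partial k i e0) (schwartz_has_partial i f).
rewrite addrC; congr has_partial; apply/funext => x.
by rewrite -[RHS]/(_ * (_ * (_ * _)) + _ * _); congr (_ + _); ring.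
Qed.

Definition vanishes M f := forall s, (size s < M)%N -> iter_partial s f 0 = 0.

Lemma vanishesS M f : vanishes M.+1 f <->
  f 0 = 0 /\ forall i, vanishes M (schwartz_partial i f).
Proof.
have e s i : iter_partial s (schwartz_partial i f) = iter_partial (rcons s i) f.
  by rewrite /iter_partial foldr_rcons.
split=> [h|[h0 h]].
  split=> [|i s sM]; first exact: (h [::]).
  by rewrite e; apply: h; rewrite size_rcons.
case/lastP => [|s i] //; rewrite size_rcons ltnS -e; exact: h.
Qed.

Lemma vanishesW M M' f : (M <= M')%N -> vanishes M' f -> vanishes M f.
Proof. by move=> MM h s sM; apply: h; exact: leq_trans sM MM. Qed.

Lemma iter_partial_schwartz s (f : schwartz) :
  iter_partial s f = foldr (@schwartz_partial R n) f s.
Proof. by elim: s => [//|i s IH] /=; rewrite -/(iter_partial s f) IH. Qed.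

Lemma iter_partial_lin s c f g x :
  iter_partial s (c *: f + g) x = c * iter_partial s f x + iter_partial s g x.
Proof.
have [sf _] := schwartzP f; have [sg _] := schwartzP g.
by have := iter_partial_comb c sf sg s => /(congr1 (@^~ x)).
Qed.

Lemma vanishes_comb M c f g : vanishes M f -> vanishes M g -> vanishes M (c *: f + g).
Proof. by move=> hf hg s sM; rewrite iter_partial_lin hf // hg // mulr0 addr0. Qed.

Lemma vanishes_mul_coord M j f : vanishes M f -> vanishes M (mul_coord j f).
Proof.
elim: M f => [|M IH] f hf; first by move=> s.
have [f0 fM] := (vanishesS M f).1 hf.
apply/vanishesS; split=> [|i]; first by rewrite /= f0 mulr0.
rewrite partial_mul_coord; apply: vanishes_comb; first exact: vanishesW hf.
exact/IH/fM.
Qed.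

Lemma vanishes_resolvent M e (e0 : 0 < e) k f : vanishes M f -> vanishes M (resolvent e0 k f).
Proof.
elim: M k f => [|M IH] k f hf; first by move=> s.
have [f0 fM] := (vanishesS M f).1 hf.
apply/vanishesS; split=> [|i]; first by rewrite /= f0 mulr0.
rewrite partial_resolvent addrC; apply: vanishes_comb; apply: IH; last exact: fM.
by apply: vanishes_mul_coord; exact: vanishesW hf.
Qed.

Lemma line_bound (f g : E -> C) i x (c B : R) : has_partial i f g ->
  (forall d, `|d| <= `|c| -> cabs (g (x + d *: basis_vector R i)) <= B) ->
  cabs (f (x + c *: basis_vector R i) - f x) <= 2 * (`|c| * B).
Proof.
move=> hp h.
have MVT (P : C -> R) : (forall z, `|P z| <= cabs z) -> (forall z w, P (z - w) = P z - P w) ->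
    (forall y, is_derive y (basis_vector R i) (fun y => P (f y)) (P (g y))) ->
    `|P (f (x + c *: basis_vector R i) - f x)| <= `|c| * B.
  move=> Pc PB dP.
  have [d dc] := @line_MVT _ _ (fun y => P (f y)) (basis_vector R i) x c (fun y => ltac:(by case: (dP y))).
  have [_ ->] := dP (x + d *: basis_vector R i).
  rewrite PB => ->; rewrite normrM mulrC ler_wpM2l //.
  exact: le_trans (Pc _) (h d dc).
(* the real and imaginary parts have different mean values, hence the factor 2 *)
apply: le_trans (cabs_le_ReIm _) _; rewrite mulr2n mulrDl !mul1r; apply: lerD; apply: MVT => //.
- exact: Re_le_cabs.
- by case=> ? ? [? ?].
- by move=> y; case: (hp y).
- exact: Im_le_cabs.
- by case=> ? ? [? ?].
- by move=> y; case: (hp y).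
Qed.

(** Join 0 to x by a broken line parallel to the axes, which stays in the box,
    and use the mean value inequality on each of its n segments. *)
Lemma box_bound (f : E -> C) (g : 'I_n -> E -> C) (r B : R) :
  (forall i, has_partial i f (g i)) -> f 0 = 0 ->
  (forall i x, (forall j, `|x 0 j| <= r) -> cabs (g i x) <= B) ->
  forall x, (forall j, `|x 0 j| <= r) -> cabs (f x) <= (2 * n)%:R * (r * B).
Proof.
move=> hp f0 h x xr.
pose p k : E := \row_j (if (j < k)%N then x 0 j else 0).
have pn : p n = x by apply/rowP => j; rewrite !mxE ltn_ord.
have p0 : p 0%N = 0 by apply/rowP => j; rewrite !mxE.
suff H k : (k <= n)%N -> cabs (f (p k)) <= (2 * k)%:R * (r * B) by rewrite -pn; exact: H.
elim: k => [|k IH] kn; first by rewrite p0 f0 cabs0 muln0 mul0r.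
pose i := Ordinal kn.
have pS : p k.+1 = p k + x 0 i *: basis_vector R i.
  apply/rowP => j; rewrite !mxE eqxx /= ltnS leq_eqVlt -[j == i :> nat]/(j == i).
  have [->|ji] := eqVneq j i; first by rewrite ltnn add0r mulr1.
  by rewrite mulr0 addr0.
have r0 : 0 <= r by exact: le_trans (normr_ge0 _) (xr i).
have step : cabs (f (p k.+1) - f (p k)) <= 2 * (r * B).
  have B0 : 0 <= B.
    by apply: le_trans (h i 0 _); rewrite ?cabs_ge0 // => j; rewrite mxE normr0.
  rewrite pS; apply: le_trans (_ : 2 * (`|x 0 i| * B) <= _); last first.
    by rewrite ler_wpM2l // ler_wpM2r.
  apply: (line_bound (hp i)) => d dx; apply: h => j; rewrite !mxE eqxx /=.
  have [->|ji] := eqVneq j i; first by rewrite ltnn add0r mulr1 (le_trans dx).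
  by rewrite mulr0 addr0; case: ifP; rewrite ?normr0.
rewrite -[f _](subrK (f (p k))); apply: le_trans (cabsD _ _) _.
rewrite mulnS natrD mulrDl; apply: lerD => //; exact: IH (ltnW kn).
Qed.

(** Iterating box_bound replaces Taylor's formula: the derivatives of f vanish
    to one order less than f does. *)
Lemma taylor_bound k f (B : R) : vanishes k f ->
  (forall s x, size s = k -> cabs (iter_partial s f x) <= B) ->
  forall r x, (forall j, `|x 0 j| <= r) -> cabs (f x) <= ((2 * n)%:R * r) ^+ k * B.
Proof.
elim: k f => [|k IH] f vf h r x xr; first by rewrite expr0 mul1r; exact: (h [::]).
have [f0 fk] := (vanishesS k f).1 vf.
rewrite exprS -!mulrA; apply: (box_bound (g := fun i => schwartz_partial i f)) xr => // [i|i y yr].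
  exact: schwartz_has_partial.
apply: IH (fk i) _ r y yr => s z sk.
have -> : iter_partial s (schwartz_partial i f) = iter_partial (rcons s i) f.
  by rewrite /iter_partial foldr_rcons.
by apply: h; rewrite size_rcons sk.
Qed.

(** For |x| <= 1, vanishing to order 2 k makes f(x) smaller than a multiple of
    |x|^(2 k), and the factor 1 / (|x|^2 + e)^k is at most |x|^(-2 k); for |x|
    > 1 that factor is at most 1. Neither bound depends on e. *)
Lemma resolvent_sup_bound k0 k : exists N M (A : R), 0 <= A /\
  forall e (e0 : 0 < e) f B, vanishes M f -> seminorm_le N N B f ->
  forall x, jap x ^+ k0 * cabs (resolvent e0 k f x) <= A * B.
Proof.
exists (maxn k0 (2 * k))%N, (2 * k)%N, (2 ^+ k0 * (2 * n)%:R ^+ (2 * k) + 1); split.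
  by rewrite addr_ge0 // mulr_ge0 ?exprn_ge0.
move=> e e0 f B vf hf x; have B0 := seminorm_le_ge0 hf.
rewrite /= cabsM cabs_real ger0_norm ?resolv_ge0 //.
have nx := normsq_ge0 x.
have [x1|x1] := leP (normsq x) 1.
  have t : cabs (f x) <= ((2 * n)%:R * Num.sqrt (normsq x)) ^+ (2 * k) * B.
    apply: (taylor_bound vf) => [s y sk|j].
      have := hf s y; rewrite sk leq_maxr => /(_ isT); apply: le_trans.
      rewrite ler_peMl ?cabs_ge0 // exprn_ege1 //; exact: jap_ge1.
    rewrite -[leLHS]sqrtr_sqr -real_normK ?num_real // ler_wsqrtr // real_normK ?num_real //.
    by rewrite /normsq (bigD1 j) //= lerDl sumr_ge0 // => i _; rewrite sqr_ge0.
  rewrite exprMn [X in _ * X * B]exprM sqr_sqrtr // in t.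
  have le1 : normsq x ^+ k * resolv e k x <= 1.
    rewrite /resolv -exprMn exprn_ile1 ?mulr_ge0 ?invr_ge0 ?(ltW (normsqDe_gt0 _ _)) //.
    by rewrite ler_pdivrMr ?normsqDe_gt0 // mul1r lerDl ltW.
  apply: (@le_trans _ _ (2 ^+ k0 * (2 * n)%:R ^+ (2 * k) * B)); last first.
    by rewrite ler_wpM2r // lerDl.
  rewrite -!mulrA; apply: ler_pM.
  - by rewrite exprn_ge0 // jap_ge0.
  - by rewrite mulr_ge0 ?cabs_ge0 // resolv_ge0.
  - rewrite lerXn2r ?nnegrE ?jap_ge0 // japE; lra.
  - apply: le_trans (ler_wpM2l (resolv_ge0 k x e0) t) _.
    rewrite (_ : resolv e k x * (_ * B) =
        (2 * n)%:R ^+ (2 * k) * B * (normsq x ^+ k * resolv e k x)); last by ring.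
    by rewrite ler_piMr // mulr_ge0 // exprn_ge0.
have le1 : resolv e k x <= 1.
  rewrite /resolv exprn_ile1 ?invr_ge0 ?(ltW (normsqDe_gt0 _ _)) //.
  by rewrite invf_le1 ?normsqDe_gt0 //; lra.
apply: (@le_trans _ _ (1 * B)); last by rewrite ler_wpM2r // lerDr mulr_ge0 // exprn_ge0.
rewrite mul1r; have := hf [::] x isT; apply: le_trans.
apply: ler_pM; rewrite ?exprn_ge0 ?jap_ge0 ?mulr_ge0 ?cabs_ge0 ?resolv_ge0 //.
  by rewrite jap_expn_le // leq_maxl.
by rewrite ler_piMl ?cabs_ge0.
Qed.

(** The point is that A does not depend on e: the limit e -> 0 can be taken on
    functions that vanish to a high order at 0, where 1 / |x|^2 acts
    continuously. *)
Lemma resolvent_bound k0 m k : exists N M (A : R), 0 <= A /\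
  forall e (e0 : 0 < e) f B, vanishes M f -> seminorm_le N N B f ->
  seminorm_le k0 m (A * B) (resolvent e0 k f).
Proof.
elim: m k => [|m IH] k.
  have [N [M [A [A0 h]]]] := resolvent_sup_bound k0 k; exists N, M, A; split=> //.
  move=> e e0 f B vf hf b x; rewrite leqn0 size_eq0 => /eqP ->; exact: h.
have [N0 [M0 [A0 [A00 h0]]]] := resolvent_sup_bound k0 k.
have [N1 [M1 [A1 [A10 h1]]]] := IH k.
have [N2 [M2 [A2 [A20 h2]]]] := IH k.+1.
pose N := (N0 + N1 + N2).+1; pose M := (M0 + M1 + M2).+1.
exists N, M, (A0 + (A1 + 2 * k%:R * (A2 * N2.+1%:R))); split.
  by rewrite !addr_ge0 // !mulr_ge0.
move=> e e0 f B vf hf; have B0 := seminorm_le_ge0 hf.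
have W f' N' : (N' <= N)%N -> seminorm_le N N B f' -> seminorm_le N' N' B f'.
  by move=> NN; apply: seminorm_leW.
apply/seminorm_leS; split=> [x|i].
  apply: le_trans (h0 e e0 f B _ _ x) _.
  - by apply: vanishesW vf; rewrite /M; lia.
  - by apply: W hf; rewrite /N; lia.
  - by rewrite mulrDl lerDl mulr_ge0 // addr_ge0 // !mulr_ge0.
rewrite -[partial i _]/(schwartz_fun (schwartz_partial i (resolvent e0 k f))) partial_resolvent.
have v1 : vanishes M1 (schwartz_partial i f).
  by apply: ((vanishesS M1 f).1 _).2 => //; apply: vanishesW vf; rewrite /M; lia.
have v2 : vanishes M2 (mul_coord i f).
  by apply: vanishes_mul_coord; apply: vanishesW vf; rewrite /M; lia.
have s1 : seminorm_le N1 N1 B (schwartz_partial i f).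
  by apply: seminorm_partial; apply: seminorm_leW hf => //; rewrite /N; lia.
have s2 : seminorm_le N2 N2 (N2.+1%:R * B) (mul_coord i f).
  by apply: seminorm_mul_coord; apply: seminorm_leW hf => //; rewrite /N; lia.
have := seminormD (h1 e e0 _ _ v1 s1) (seminorm_scale (- (2 * k%:R))%:C%C (h2 e e0 _ _ v2 s2)).
apply: seminorm_leW => //.
rewrite cabs_real normrN ger0_norm ?mulr_ge0 //.
have := mulr_ge0 A00 B0; lra.
Qed.

End Resolvent.

(** * Division of tempered distributions by |x|^2 *)

(** Gram-Schmidt on linear forms: when the new form vanishes on the common
    kernel of the previous ones it needs no vector of its own; otherwise a
    vector of that kernel is normalized. *)
Lemma dual_vectors (K : fieldType) (V : lmodType K) (l : nat -> {scalar V}) k :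
  exists e : nat -> V, forall v j, (j < k)%N ->
    l j (v - \sum_(i < k) l i v *: e i) = 0.
Proof.
elim: k => [|k [e he]]; first by exists (fun=> 0).
pose p v := v - \sum_(i < k) l i v *: e i.
have lkp v : l k (p v) = l k v - \sum_(i < k) l i v * l k (e i).
  by rewrite linearB linear_sum; congr (_ - _); apply: eq_bigr => i _; rewrite linearZ.
have [h|/existsNP[w hw]] := pselect (forall v, l k (p v) = 0).
  exists (fun i => if (i == k)%N then 0 else e i) => v j.
  rewrite big_ord_recr /= eqxx scaler0 addr0.
  rewrite (eq_bigr (fun i : 'I_k => l i v *: e i)); last first.
    by move=> i _; rewrite ltn_eqF.
  by rewrite ltnS leq_eqVlt => /orP[/eqP ->|]; [exact: h|exact: he].
pose u := (l k (p w))^-1 *: p w.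
have lku : l k u = 1 by rewrite /u linearZ /= mulVf //; exact/eqP.
have lju j : (j < k)%N -> l j u = 0.
  by move=> jk; have hj : l j (p w) = 0 by [exact: he]; rewrite /u linearZ /= hj mulr0.
exists (fun i => if (i == k)%N then u else e i - l k (e i) *: u) => v j jk.
rewrite big_ord_recr /= eqxx.
have -> : v - (\sum_(i < k) l i v *: (if i == k :> nat then u else e i - l k (e i) *: u) + l k v *: u) =
    p v - l k (p v) *: u.
  rewrite lkp scalerBl scaler_suml /p.
  under eq_bigr => i _ do rewrite ltn_eqF // scalerBr scalerA.
  rewrite sumrB; set A := \sum_(_ < k) _; set B := \sum_(_ < k) _.
  rewrite opprD opprB [in RHS]opprB -[RHS]addrA; congr (_ + _).
  by rewrite [B - _]addrC addrA.
rewrite linearB linearZ /=; move: jk; rewrite ltnS leq_eqVlt => /orP[/eqP ->|jk].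
  by rewrite lku mulr1 subrr.
by rewrite lju // mulr0 subr0; exact: he.
Qed.

Section TemperedFunctionals.
Variables (R : realType) (n : nat).
Local Notation C := R[i].
Local Notation E := 'rV[R]_n.
Local Notation Re := (@complex.Re R).
Local Notation Im := (@complex.Im R).
Local Notation schwartz := (schwartz R n).
Local Notation tempered := (tempered R n).
Implicit Types (f g : schwartz) (s a b w : seq 'I_n) (i j : 'I_n) (x : E) (k m : nat).
Implicit Types (T : tempered).

Lemma tempered_eq (T U : tempered) : (forall f, T f = U f) -> T = U.
Proof. by move=> TU; apply: val_inj; apply/funext. Qed.

Lemma tempered_lin T c f g : T (c *: f + g) = c * T f + T g.
Proof. by have [lT _] := temperedP T; exact: lT. Qed.

Lemma tempered0 T : T 0 = 0.
Proof. by have := tempered_lin T (-1) 0 0; rewrite scaler0 addr0 mulN1r addNr. Qed.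

Lemma temperedZ T c f : T (c *: f) = c * T f.
Proof. by have := tempered_lin T c f 0; rewrite !addr0 tempered0 addr0. Qed.

Lemma temperedD T f g : T (f + g) = T f + T g.
Proof. by have := tempered_lin T 1 f g; rewrite scale1r mul1r. Qed.

Lemma temperedB T f g : T (f - g) = T f - T g.
Proof. by rewrite -scaleN1r temperedD temperedZ mulN1r. Qed.

Lemma tempered_sum T (I : Type) (r : seq I) (P : pred I) (F : I -> schwartz) :
  T (\sum_(i <- r | P i) F i) = \sum_(i <- r | P i) T (F i).
Proof.
elim/big_rec2: _ => [|i a b _ <-]; first exact: tempered0.
by rewrite temperedD.
Qed.

Definition seminorm_bounded (L : schwartz -> C) := exists N (A : R), 0 <= A /\
  forall f B, seminorm_le N N B f -> cabs (L f) <= A * B.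

(** Continuity at 0 bounds T on a ball, and homogeneity spreads the bound. *)
Lemma tempered_seminorm_bounded T : seminorm_bounded T.
Proof.
have [lT cT] := temperedP T; have [N [d d0 h]] := cT 0 1 ltr01.
exists N, d^-1; split; first by rewrite invr_ge0 ltW.
move=> f B hf; have B0 := seminorm_le_ge0 hf.
have key B' : B < B' -> cabs (T f) <= B' / d.
  move=> BB; have B'0 : 0 < B' by exact: le_lt_trans BB.
  pose c : C := (d / B')%:C%C.
  have c0 : 0 <= d / B' by rewrite divr_ge0 ?ltW.
  have : `|T (c *: f) - T 0| < 1%:C%C.
    apply: h => a b sa sb x; rewrite subr0 /schwartz_weight normrM !cabsE -rmorphM ltcR /= cabs_real.
    have [sf _] := schwartzP f.
    have -> : iter_partial b (c *: f) x = c * iter_partial b f x.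
      have := iter_partial_lin b c f 0 x; rewrite addr0 => ->.
      have := iter_partial_lin b (-1) 0 0 x; rewrite scaler0 addr0 mulN1r addNr => ->.
      by rewrite addr0.
    rewrite cabsM cabs_real (ger0_norm c0) mulrCA.
    apply: (@le_lt_trans _ _ (d / B' * B)).
      apply: ler_wpM2l => //; apply: le_trans (hf b x sb).
      apply: ler_wpM2r; first exact: cabs_ge0.
      by apply: le_trans (coord_monomial_le_jap _ _) _; exact: jap_expn_le.
    by rewrite -mulrA gtr_pMr // mulrC ltr_pdivrMr // mul1r.
  rewrite tempered0 subr0 temperedZ normrM !cabsE -rmorphM ltcR cabs_real ger0_norm //.
  by rewrite mulrAC ltr_pdivrMr // mul1r mulrC => /ltW; rewrite ler_pdivlMr.
rewrite mulrC ler_pdivlMr //; apply/ler_addgt0Pr => e e0.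
by rewrite -ler_pdivlMr //; apply: key; rewrite ltrDl.
Qed.

Lemma mk_tempered (L : schwartz -> C) :
  (forall c f g, L (c *: f + g) = c * L f + L g) -> seminorm_bounded L ->
  (L : schwartz -> C^o) \in @tempered_pred R n.
Proof.
move=> lL [N [A [A0 h]]]; apply/asboolP; split; first exact: lL.
move=> f e e0; pose K := A * (1 + n%:R) ^+ N.
have K0 : 0 <= K by rewrite mulr_ge0 // exprn_ge0 // addr_ge0.
have K1 : 0 < K + 1 by rewrite ltr_wpDl.
exists (2 * N)%N, (e / (K + 1)); first by rewrite divr_gt0.
move=> g hg.
have -> : L g - L f = L (g - f).
  by have := lL (-1) f g; rewrite scaleN1r mulN1r [- f + g]addrC => ->; rewrite addrC.
have sg : seminorm_le N N ((1 + n%:R) ^+ N * (e / (K + 1))) (g - f).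
  move=> b x sb; apply: jap_le_monomials => a sa.
  have := hg a b sa (leq_trans sb (leq_pmull _ _)) x.
  by rewrite /schwartz_weight normrM !cabsE -rmorphM ltcR /= cabs_real => /(_ isT) /ltW.
rewrite cabsE ltcR; apply: le_lt_trans (h _ _ sg) _.
by rewrite mulrA -/K mulrCA gtr_pMr // ltr_pdivrMr // mul1r ltrDl.
Qed.

Definition words M : seq (seq 'I_n) :=
  flatten [seq [seq val t | t <- enum {: m.-tuple 'I_n}] | m <- iota 0 M].

Lemma mem_words M s : (s \in words M) = (size s < M)%N.
Proof.
apply/flattenP/idP => [[_ /mapP[m + ->] /mapP[t _ ->]]|sM].
  by rewrite mem_iota /= add0n size_tuple.
exists [seq val t | t <- enum {: (size s).-tuple 'I_n}].
  by apply/mapP; exists (size s); rewrite ?mem_iota.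
by apply/mapP; exists (in_tuple s); rewrite ?mem_enum.
Qed.

Definition jet s f : C := iter_partial s f 0.

Lemma jet_is_scalar s : scalar (jet s).
Proof. by move=> c f g; rewrite /jet iter_partial_lin. Qed.

HB.instance Definition _ s :=
  GRing.isLinear.Build C schwartz C *%R (jet s) (jet_is_scalar s).

(** Subtracting finitely many fixed functions, with jets as coefficients,
    makes f vanish to order M at a cost that the seminorms of f control. *)
Lemma flattening M : exists p : schwartz -> schwartz,
  [/\ exists (e : nat -> schwartz), forall f,
        p f = f - \sum_(i < size (words M)) jet (nth [::] (words M) i) f *: e i,
      forall f, vanishes M (p f) &
      forall N, exists (A : R), 0 <= A /\ forall f B, seminorm_le (maxn N M) (maxn N M) B f ->
        seminorm_le N N (A * B) (p f)].
Proof.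
have [e he] := dual_vectors (fun i : nat => jet (nth [::] (words M) i) : {scalar schwartz}) (size (words M)).
exists (fun f => f - \sum_(i < size (words M)) jet (nth [::] (words M) i) f *: e i); split.
- by exists e.
- move=> f s; rewrite -mem_words => sM.
  by have := he f (index s (words M)); rewrite index_mem sM nth_index //; exact.
- move=> N; have [b hb] := choice (fun i : nat => seminorm_ex N N (e i)).
  have b0 (i : nat) : 0 <= b i by exact: seminorm_le_ge0 (hb i).
  exists (1 + \sum_(i < size (words M)) b i); split.
    by rewrite addr_ge0 // sumr_ge0.
  move=> f B hf; have B0 := seminorm_le_ge0 hf.
  have jB (i : 'I_(size (words M))) : cabs (jet (nth [::] (words M) i) f) <= B.
    have := hf (nth [::] (words M) i) 0.
    have : nth [::] (words M) i \in words M by exact: mem_nth.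
    rewrite mem_words => /ltnW sM /(_ (leq_trans sM (leq_maxr _ _))).
    by apply: le_trans; rewrite ler_peMl ?cabs_ge0 // exprn_ege1 // jap_ge1.
  have h0 : seminorm_le N N 0 (0 : schwartz).
    have [B1 hB1] := seminorm_ex N N (0 : schwartz).
    by have := seminorm_scale 0 hB1; rewrite scale0r cabs0 mul0r.
  pose S := \sum_(i < size (words M)) jet (nth [::] (words M) i) f *: e i.
  have hS : seminorm_le N N ((\sum_(i < size (words M)) b i) * B) S.
    rewrite /S; elim/big_rec2: _ => [|i x y _ IH]; first by rewrite mul0r.
    rewrite mulrDl; apply: seminormD IH.
    apply: seminorm_leW (seminorm_scale (jet (nth [::] (words M) i) f) (hb i)) => //.
    by rewrite mulrC ler_wpM2l.
  have hN : seminorm_le N N B f by apply: seminorm_leW hf; rewrite ?leq_maxl.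
  have := seminormD hN (seminorm_scale (-1) hS).
  by rewrite scaleN1r cabsN cabs1 mul1r mulrDl mul1r.
Qed.

(** L does not see the flattened part of f, and what flattening removes has
    jets of f as coefficients. *)
Lemma jet_functional M (L : schwartz -> C) :
  (forall c f g, L (c *: f + g) = c * L f + L g) ->
  (forall f, vanishes M f -> L f = 0) ->
  exists c : nat -> C, forall f,
    L f = \sum_(i < size (words M)) c i * jet (nth [::] (words M) i) f.
Proof.
move=> lL L0; have [p [[e pE] pv _]] := flattening M.
exists (fun i : nat => L (e i)) => f; have := L0 _ (pv f); rewrite pE => h.
have l0 : L 0 = 0 by have := lL (-1) 0 0; rewrite scaler0 addr0 mulN1r addNr.
rewrite -[f in LHS](subrK (\sum_(i < size (words M)) jet (nth [::] (words M) i) f *: e i)).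
have lD g g' : L (g + g') = L g + L g' by rewrite -[g]scale1r lL mul1r scale1r.
rewrite lD h add0r (big_morph _ lD l0); apply: eq_bigr => i _.
by rewrite -[X in L X]addr0 lL l0 addr0 mulrC.
Qed.

Definition mul_normsq f : schwartz := \sum_j mul_coord j (mul_coord j f).

Lemma schwartz_sumE (I : Type) (r : seq I) (P : pred I) (F : I -> schwartz) x :
  (\sum_(i <- r | P i) F i) x = \sum_(i <- r | P i) F i x.
Proof. by elim/big_rec2: _ => [//|i a b _ <-]. Qed.

Lemma mul_normsqE f x : mul_normsq f x = (normsq x)%:C%C * f x.
Proof.
rewrite schwartz_sumE rmorph_sum /= mulr_suml; apply: eq_bigr => j _.
by rewrite rmorphXn /= expr2 mulrA.
Qed.

Lemma vanishes_mul_normsq M f : vanishes M f -> vanishes M (mul_normsq f).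
Proof.
move=> vf; rewrite /mul_normsq; elim/big_rec: _ => [|j g _ vg].
  by have := vanishes_comb (-1) vf vf; rewrite scaleN1r addNr.
have := vanishes_comb 1 (vanishes_mul_coord j (vanishes_mul_coord j vf)) vg.
by rewrite scale1r.
Qed.

Lemma resolvent_mul_normsq e (e0 : 0 < e) f :
  resolvent e0 1 (mul_normsq f) = f - e%:C%C *: resolvent e0 1 f.
Proof.
apply: schwartz_eq => x; rewrite -[RHS]/(f x - e%:C%C * ((resolv e 1 x)%:C%C * f x)).
rewrite -[LHS]/((resolv e 1 x)%:C%C * mul_normsq f x) mul_normsqE.
rewrite !mulrA -!rmorphM /= -[X in X - _]mul1r -mulrBl; congr (_ * _).
rewrite -(rmorph1 (real_complex R)) -rmorphB; congr (real_complex R _).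
by rewrite /resolv expr1; field; rewrite gt_eqF // normsqDe_gt0.
Qed.

(** The resolvent identity: with bounds uniform in e and e' it makes T (f /
    (|x|^2 + e)) a Cauchy family as e -> 0. *)
Lemma resolvent_sub e e' (e0 : 0 < e) (e'0 : 0 < e') f :
  resolvent e0 1 f - resolvent e'0 1 f =
  (e' - e)%:C%C *: resolvent e0 1 (resolvent e'0 1 f).
Proof.
apply: schwartz_eq => x.
rewrite -[LHS]/((resolv e 1 x)%:C%C * f x - (resolv e' 1 x)%:C%C * f x).
rewrite -[RHS]/((e' - e)%:C%C * ((resolv e 1 x)%:C%C * ((resolv e' 1 x)%:C%C * f x))).
rewrite -mulrBl !mulrA -!rmorphM -rmorphB /=; congr (_%:C%C * _).
by rewrite /resolv !expr1; field; rewrite !gt_eqF // normsqDe_gt0.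
Qed.

Lemma resolvent_lin e (e0 : 0 < e) k c f g :
  resolvent e0 k (c *: f + g) = c *: resolvent e0 k f + resolvent e0 k g.
Proof. exact: multiply_is_linear. Qed.

Lemma tempered_resolvent T k : exists N M (A : R), 0 <= A /\
  forall e (e0 : 0 < e) f B, vanishes M f -> seminorm_le N N B f ->
  cabs (T (resolvent e0 k f)) <= A * B.
Proof.
have [N [A [A0 hT]]] := tempered_seminorm_bounded T.
have [N' [M [A' [A'0 hR]]]] := resolvent_bound R n N N k.
exists N', M, (A * A'); split; first by rewrite mulr_ge0.
by move=> e e0 f B vf hf; rewrite -mulrA; apply: hT; exact: hR.
Qed.

Lemma le0_of_le_eps (a K : R) : 0 <= K -> (forall e, 0 < e -> a <= e * K) -> a <= 0.
Proof.
move=> K0 h; apply/ler_addgt0Pr => e e0; rewrite add0r.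
have K1 : 0 < K + 1 by rewrite ltr_wpDl.
apply: le_trans (h (e / (K + 1)) _) _; first by rewrite divr_gt0.
by rewrite -mulrA ler_piMr ?(ltW e0) // mulrC ler_pdivrMr // mul1r lerDl.
Qed.

(** The hypothesis gives T f = e * T (f / (|x|^2 + e)) for all e > 0, and this
    tends to 0 with e when f vanishes to a high order. *)
Lemma kernel_mul_normsq T : (forall f, T (mul_normsq f) = 0) ->
  exists M, forall f, vanishes M f -> T f = 0.
Proof.
move=> hT; have [N [M [A [A0 h]]]] := tempered_resolvent T 1; exists M => f vf.
have [B hB] := seminorm_ex N N f; have B0 := seminorm_le_ge0 hB.
apply/cabs_eq0/eqP; rewrite eq_le cabs_ge0 andbT.
apply: (@le0_of_le_eps _ (A * B)); first exact: mulr_ge0.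
move=> e e0; have -> : T f = e%:C%C * T (resolvent e0 1 f).
  have := hT (resolvent e0 1 f).
  have -> : mul_normsq (resolvent e0 1 f) = resolvent e0 1 (mul_normsq f).
    by apply: schwartz_eq => x; rewrite mul_normsqE /= mul_normsqE; ring.
  rewrite resolvent_mul_normsq temperedB temperedZ => /eqP; rewrite subr_eq0.
  by move=> /eqP.
by rewrite cabsM cabs_real gtr0_norm // ler_pM2l //; exact: h.
Qed.

(** The real and imaginary parts are squeezed between monotone sequences; each
    contributes K / j.+1 to the rate. *)
Lemma complex_limit (z : nat -> C) (K : R) :
  (forall i j : nat, cabs (z i - z j) <= K * `|i.+1%:R^-1 - j.+1%:R^-1|) ->
  exists l, forall j : nat, cabs (z j - l) <= 2 * K / j.+1%:R.
Proof.
move=> hz.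
have K0 : 0 <= K.
  have := le_trans (cabs_ge0 _) (hz 0%N 1%N); rewrite pmulr_lge0 //.
  by rewrite normr_gt0 subr_eq0 (inj_eq invr_inj) eqr_nat.
have real_limit (u : nat -> R) : (forall i j : nat, `|u i - u j| <= K * `|i.+1%:R^-1 - j.+1%:R^-1|) ->
    exists l, forall j : nat, `|u j - l| <= K / j.+1%:R.
  move=> hu.
  pose v (j : nat) := u j - K / j.+1%:R.
  have inv_le (i j : nat) : (i <= j)%N -> j.+1%:R^-1 <= i.+1%:R^-1 :> R.
    by move=> ij; rewrite lef_pV2 ?posrE // ler_nat.
  have bnd (i j : nat) : (i <= j)%N -> `|u i - u j| <= K * (i.+1%:R^-1 - j.+1%:R^-1).
    by move=> ij; have := hu i j; rewrite [`|_^-1 - _|]ger0_norm // subr_ge0 inv_le.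
  have vnd : nondecreasing_seq v.
    move=> i j ij; have := bnd _ _ ij; rewrite ler_norml /v => /andP[].
    by move: (i.+1%:R^-1) (j.+1%:R^-1) => a b; rewrite mulrBr => ? ?; lra.
  have wni : forall i j : nat, (i <= j)%N -> u j + K / j.+1%:R <= u i + K / i.+1%:R.
    move=> i j ij; have := bnd _ _ ij; rewrite ler_norml => /andP[].
    by move: (i.+1%:R^-1) (j.+1%:R^-1) => a b; rewrite mulrBr => ? ?; lra.
  have Kp (j : nat) : 0 <= K / j.+1%:R by rewrite divr_ge0.
  have vw (i j : nat) : v i <= u j + K / j.+1%:R.
    apply: (@le_trans _ _ (v (maxn i j))); first exact/vnd/leq_maxl.
    apply: (@le_trans _ _ (u (maxn i j) + K / (maxn i j).+1%:R)); last exact/wni/leq_maxr.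
    by have := Kp (maxn i j); rewrite /v; move: (K / _) => q ?; lra.
  have vcv : cvgn v.
    apply: nondecreasing_is_cvgn => //; exists (u 0%N + K / 1%:R) => _ [i _ <-]; exact: vw.
  exists (limn v) => j; rewrite ler_distl; apply/andP; split.
    by rewrite lerBlDr; apply: limr_le => //; apply: nearW => i; exact: vw.
  by have := nondecreasing_cvgn_le vnd vcv j; rewrite {1}/v; move: (K / _) => q ?; lra.
have [|lr hr] := real_limit (fun j : nat => Re (z j)).
  move=> i j; apply: le_trans (hz i j); apply: le_trans (Re_le_cabs _).
  by case: (z i) (z j) => ? ? [].
have [|li hi] := real_limit (fun j : nat => Im (z j)).
  move=> i j; apply: le_trans (hz i j); apply: le_trans (Im_le_cabs _).
  by case: (z i) (z j) => ? ? [].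
exists (lr +i* li)%C => j; apply: le_trans (cabs_le_ReIm _) _.
rewrite mulr2n mulrDl mul1r mulrDl; apply: lerD.
  by have := hr j; case: (z j).
by have := hi j; case: (z j).
Qed.

Lemma le_of_le_harmonic (a b K : R) : (forall j : nat, a <= b + K / j.+1%:R) -> a <= b.
Proof.
move=> h; rewrite -subr_le0; apply: (@le0_of_le_eps _ `|K|) => // e e0.
pose j := Num.truncn e^-1.
have je : j.+1%:R^-1 <= e.
  rewrite -[leRHS]invrK lef_pV2 ?posrE ?invr_gt0 //.
  by apply: ltW; rewrite truncnS_gt.
rewrite lerBlDl; apply: le_trans (h j) _; rewrite lerD2l.
apply: (@le_trans _ _ (`|K| * j.+1%:R^-1)); first by rewrite ler_wpM2r ?ler_norm ?invr_ge0.
by rewrite mulrC ler_wpM2r.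
Qed.

(** Convergence at the rate of e = 1 / j.+1, which the resolvent identity
    provides and which makes uniqueness and bounds of limits elementary. *)
Definition quick_limit (z : nat -> C) l := exists K, forall j : nat, cabs (z j - l) <= K / j.+1%:R.

Lemma quick_limit_unique z l l' : quick_limit z l -> quick_limit z l' -> l = l'.
Proof.
move=> [K hK] [K' hK']; apply/eqP; rewrite -subr_eq0; apply/eqP/cabs_eq0/eqP.
rewrite eq_le cabs_ge0 andbT; apply: (@le_of_le_harmonic _ _ (K + K')) => j.
rewrite add0r mulrDl -[l - l'](subrKA (z j)) -[l - z j]opprB.
by apply: le_trans (cabsD _ _) _; rewrite cabsN lerD.
Qed.

Lemma quick_limit_comb c z z' l l' : quick_limit z l -> quick_limit z' l' ->
  quick_limit (fun j : nat => c * z j + z' j) (c * l + l').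
Proof.
move=> [K hK] [K' hK']; exists (cabs c * K + K') => j.
rewrite opprD addrACA -mulrBr mulrDl -mulrA; apply: le_trans (cabsD _ _) _.
by rewrite cabsM lerD // ler_wpM2l ?cabs_ge0.
Qed.

Lemma quick_limit_le z l (b : R) : quick_limit z l -> (forall j : nat, cabs (z j) <= b) -> cabs l <= b.
Proof.
move=> [K hK] h; apply: (@le_of_le_harmonic _ _ K) => j.
rewrite -[l](subKr (z j)); apply: le_trans (cabsD _ _) _; rewrite cabsN.
by rewrite lerD.
Qed.

(** U f is the limit of T (p f / (|x|^2 + e)), with p the flattening to a high
    order M. If f vanishes to order M then p leaves |x|^2 f unchanged and U
    (|x|^2 f) = T f; hence the defect U (|x|^2 f) - T f sees only jets of f at
    0. *)
Theorem division_by_normsq T : exists U : tempered, exists M (c : nat -> C), forall f,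
  U (mul_normsq f) = T f + \sum_(i < size (words M)) c i * jet (nth [::] (words M) i) f.
Proof.
have [N0 [A0 [A00 hT]]] := tempered_seminorm_bounded T.
have [N1 [M1 [A1 [A10 h1]]]] := resolvent_bound R n N0 N0 1.
have [N2 [M2 [A2 [A20 h2]]]] := resolvent_bound R n N1 N1 1.
pose M := maxn M1 M2.
have [p [[e pE] pv pN]] := flattening M.
have plin c f g : p (c *: f + g) = c *: p f + p g.
  rewrite !pE scalerBr scaler_sumr [RHS]addrACA; congr (_ + _).
  rewrite -opprD -big_split /=; congr (- _); apply: eq_bigr => i _.
  by rewrite linearP /= scalerDl scalerA.
have ep (j : nat) : 0 < j.+1%:R^-1 :> R by rewrite invr_gt0.
pose z f (j : nat) := T (resolvent (ep j) 1 f).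
have zlin c f g (j : nat) : z (c *: f + g) j = c * z f j + z g j.
  by rewrite /z resolvent_lin tempered_lin.
have v1 f : vanishes M (p f) -> vanishes M1 (p f) by apply: vanishesW; exact: leq_maxl.
have zC f B : vanishes M f -> seminorm_le N2 N2 B f -> forall i j : nat,
    cabs (z f i - z f j) <= A0 * (A1 * (A2 * B)) * `|i.+1%:R^-1 - j.+1%:R^-1|.
  move=> vf hf i j; rewrite /z -temperedB resolvent_sub temperedZ cabsM cabs_real distrC.
  rewrite mulrC ler_wpM2r //; apply: hT; apply: h1.
    by apply: vanishes_resolvent; apply: vanishesW vf; exact: leq_maxl.
  by apply: h2 => //; apply: vanishesW vf; exact: leq_maxr.
have zex f : exists l, quick_limit (z (p f)) l.
  have [B hB] := seminorm_ex N2 N2 (p f).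
  by have [l hl] := complex_limit (zC _ _ (pv f) hB); exists l; eexists; exact: hl.
have [U hU] := choice zex.
have Ulin c f g : U (c *: f + g) = c * U f + U g.
  apply: quick_limit_unique (hU _) _; rewrite plin.
  have := quick_limit_comb c (hU f) (hU g); congr (quick_limit _ _).
  by apply/funext => j; rewrite zlin.
have Ub : seminorm_bounded U.
  have [A3 [A30 h3]] := pN N1.
  exists (maxn N1 M), (A0 * (A1 * A3)); split; first by rewrite !mulr_ge0.
  move=> f B hf; apply: quick_limit_le (hU f) _ => j; rewrite -!mulrA.
  by apply: hT; apply: h1; [exact/v1/pv|exact: h3].
exists (Tempered (mk_tempered Ulin Ub)), M.
pose W f := U (mul_normsq f) - T f.
have sqlin c f g : mul_normsq (c *: f + g) = c *: mul_normsq f + mul_normsq g.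
  by apply: schwartz_eq => x; rewrite mul_normsqE /= -[RHS]/(c * mul_normsq f x + mul_normsq g x) !mul_normsqE mulrDr mulrCA.
have Wlin c f g : W (c *: f + g) = c * W f + W g.
  rewrite /W sqlin Ulin tempered_lin; ring.
have W0 f : vanishes M f -> W f = 0.
  move=> vf; apply/eqP; rewrite subr_eq0; apply/eqP.
  apply: quick_limit_unique (hU _) _.
  have -> : p (mul_normsq f) = mul_normsq f.
    rewrite pE big1 ?subr0 // => i _.
    rewrite /jet (vanishes_mul_normsq vf) ?scale0r // -mem_words; exact: mem_nth.
  have [B hB] := seminorm_ex N1 N1 f.
  exists (A0 * (A1 * B)) => j; rewrite /z resolvent_mul_normsq temperedB temperedZ.
  rewrite addrC addKr cabsN cabsM cabs_real ger0_norm // mulrC ler_wpM2r //.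
  by apply: hT; apply: h1 => //; apply: vanishesW vf; exact: leq_maxl.
have [c hc] := jet_functional Wlin W0.
by exists c => f; rewrite -hc /W addrC subrK.
Qed.

End TemperedFunctionals.

(** * The Fourier transform of Schwartz functions *)

Section SchwartzIntegral.
Variables (R : realType) (n : nat).
Local Notation C := R[i].
Local Notation E := 'rV[R]_n.
Local Notation Re := (@complex.Re R).
Local Notation Im := (@complex.Im R).
Local Notation schwartz := (schwartz R n).
Implicit Types (f g : schwartz) (i j : 'I_n) (x y : E) (k m : nat).

Definition integral f : C := cintegral_rV f.

(** 1 + x_i^2 <= jap x for each i, so that n powers of jap dominate the
    inverse of the weight. *)
Lemma jap_weight x (v B : R) : jap x ^+ n * v <= B -> 0 <= v -> v <= B * weight x.
Proof.
move=> h v0; have p0 : 0 < \prod_i oneDsqr (x 0 i).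
  by apply: prodr_gt0 => i _; rewrite (lt_le_trans ltr01) // oneDsqr_ge1.
rewrite /weight prodfV ler_pdivlMr // mulrC; apply: le_trans h; apply: ler_wpM2r => //.
rewrite -[X in _ ^+ X]card_ord -prodr_const; apply: ler_prod => i _.
by rewrite (le_trans ler01) ?oneDsqr_ge1 //=; exact: coord_sqr_le_jap.
Qed.

Lemma schwartz_integrand (P : C -> R) f : (forall z, `|P z| <= cabs z) ->
  continuous (fun x => P (f x)) -> integrand (fun x => P (f x)).
Proof.
move=> Pc cP; split=> //; have [B hB] := seminorm_ex n 0 f; exists B => x.
by apply: le_trans (Pc _) (jap_weight (seminorm_le0 hB x) (cabs_ge0 _)).
Qed.

Lemma integrand_Re f : integrand (fun x => Re (f x)).
Proof.
by apply: schwartz_integrand (@Re_le_cabs R) _; case: (regular_ccont (schwartz_regular f 0)).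
Qed.

Lemma integrand_Im f : integrand (fun x => Im (f x)).
Proof.
by apply: schwartz_integrand (@Im_le_cabs R) _; case: (regular_ccont (schwartz_regular f 0)).
Qed.

Lemma integral_is_scalar : scalar integral.
Proof.
move=> c f g; rewrite /integral /cintegral_rV.
have RI := integral_rV_comb (- Im c) (integrand_Im f) (integrand_Re g).
have II := integral_rV_comb (Im c) (integrand_Re f) (integrand_Im g).
have RR := integral_rV_comb (Re c) (integrand_Re f)
   (integrand_comb (- Im c) (integrand_Im f) (integrand_Re g)).
have RIm := integral_rV_comb (Re c) (integrand_Im f)
   (integrand_comb (Im c) (integrand_Re f) (integrand_Im g)).
have -> : (fun x => Re ((c *: f + g) x)) =
    (fun x => Re c * Re (f x) + (- Im c * Im (f x) + Re (g x))).
  by apply/funext => x; rewrite -[(c *: f + g) x]/(c * f x + g x) cReD cReM mulNr addrA.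
have -> : (fun x => Im ((c *: f + g) x)) =
    (fun x => Re c * Im (f x) + (Im c * Re (f x) + Im (g x))).
  by apply/funext => x; rewrite -[(c *: f + g) x]/(c * f x + g x) cImD cImM addrA.
rewrite RR RIm RI II; apply: complex_ext.
  by rewrite cReD cReM /= mulNr addrA.
by rewrite cImD cImM /= addrA.
Qed.

HB.instance Definition _ :=
  GRing.isLinear.Build C schwartz C *%R integral integral_is_scalar.

Lemma integral_bound : exists A : R, 0 <= A /\ forall f B, seminorm_le n 0 B f ->
  cabs (integral f) <= A * B.
Proof.
set c1 := \int[@lebesgue_measure R]_t (oneDsqr t)^-1.
have c0 : 0 <= c1 by apply: Rintegral_ge0 => t _; rewrite invr_ge0.
exists (2 * c1 ^+ n); split; first by rewrite mulr_ge0 // exprn_ge0.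
move=> f B hB; have b (P : C -> R) : (forall z, `|P z| <= cabs z) -> forall x, `|P (f x)| <= B * weight x.
  move=> Pc x; exact: le_trans (Pc _) (jap_weight (seminorm_le0 hB x) (cabs_ge0 _)).
apply: le_trans (cabs_le_ReIm _) _; rewrite mulr2n !mulrDl !mul1r mulrC.
apply: lerD; rewrite /integral /=; apply: integral_rV_bound.
- by case: (integrand_Re f).
- exact: b (@Re_le_cabs R).
- by case: (integrand_Im f).
- exact: b (@Im_le_cabs R).
Qed.

Lemma integral_partial j f : integral (schwartz_partial j f) = 0.
Proof.
have hp := schwartz_has_partial j f.
have key (P : C -> R) (iP : forall g, integrand (fun x => P (g x))) :
    (forall x, is_derive x (basis_vector R j) (fun y => P (f y)) (P (partial j f x))) ->
    integral_rV (fun x => P (schwartz_partial j f x)) = 0.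
  move=> dP.
  have e : 'D_(basis_vector R j) (fun y => P (f y)) = (fun x => P (schwartz_partial j f x)).
    by apply/funext => x; case: (dP x).
  rewrite -e; apply: (integral_rV_derive (iP f)); first by move=> x; case: (dP x).
  by rewrite -/(basis_vector R j) e; exact: iP.
have kR := key Re integrand_Re (fun x => (hp x).1).
have kI := key Im integrand_Im (fun x => (hp x).2).
by rewrite /integral /cintegral_rV kR kI.
Qed.

Lemma integral_eq0 f (u : E -> R) : (forall x, f x = (u x)%:C%C) -> (forall x, 0 <= u x) ->
  integral f = 0 -> forall x, u x = 0.
Proof.
move=> fu u0 /(congr1 Re) /= h x; have e : (fun x => Re (f x)) = u.
  by apply/funext => y; rewrite fu.
have := integrand_Re f; rewrite e => iu; apply: (integral_rV_eq0 iu) => //.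
by rewrite -e.
Qed.

End SchwartzIntegral.

Section Cis.
Variable R : realType.
Local Notation C := R[i].

Definition cis (t : R) : C := (cos t +i* sin t)%C.

Lemma cisD s t : cis (s + t) = cis s * cis t.
Proof. by rewrite /cis cosD sinD; apply: complex_ext; [rewrite cReM|rewrite cImM] => /=; ring. Qed.

Lemma cis0 : cis 0 = 1.
Proof. by rewrite /cis cos0 sin0. Qed.

Lemma cabs_cis t : cabs (cis t) = 1.
Proof. by rewrite /cabs /= cos2Dsin2 sqrtr1. Qed.

Lemma mvt0 (u du : R -> R) (t B : R) : (forall s : R, is_derive s 1 u (du s)) ->
  (forall s, `|s| <= `|t| -> `|du s| <= B) -> `|u t - u 0| <= B * `|t|.
Proof.
move=> D h; have cont : continuous u.
  by move=> s; apply/differentiable_continuous/derivable1_diffP; case: (D s).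
have [t0|t0] := leP 0 t.
  have [c] := @MVT_segment _ u du 0 t t0 (fun s _ => D s) (continuous_subspaceT cont).
  rewrite in_itv /= subr0 => /andP[c0 ct] ->; rewrite normrM ler_wpM2r // h //.
  by rewrite !ger0_norm.
have [c] := @MVT_segment _ u du t 0 (ltW t0) (fun s _ => D s) (continuous_subspaceT cont).
rewrite in_itv /= sub0r => /andP[ct c0] e; rewrite distrC e normrM normrN ler_wpM2r // h //.
by rewrite !ler0_norm // ?lerN2 // ltW.
Qed.

Lemma sin_le t : `|sin t| <= `|t| :> R.
Proof.
have := @mvt0 sin cos t 1 (fun s => is_derive_sin s) (fun s _ => cos_max s).
by rewrite sin0 subr0 mul1r.
Qed.

Lemma cosB1_le t : `|cos t - 1| <= t ^+ 2 :> R.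
Proof.
have := @mvt0 cos (fun s => - sin s) t `|t| (fun s => is_derive_cos s).
rewrite cos0 -expr2 real_normK ?num_real //; apply => s st.
by rewrite normrN (le_trans (sin_le s)).
Qed.

Lemma sinBid_le t : `|t| <= 1 -> `|sin t - t| <= t ^+ 2 :> R.
Proof.
move=> t1; have D (s : R) : is_derive s 1 (fun s : R => sin s - s) (cos s - 1).
  exact: is_deriveB.
have := @mvt0 (fun s => sin s - s) (fun s => cos s - 1) t `|t| D.
rewrite sin0 !subr0 -expr2 real_normK ?num_real //; apply => s st.
apply: le_trans (cosB1_le s) _; rewrite -real_normK ?num_real // expr2.
by rewrite -[leRHS]mulr1 ler_pM // (le_trans st).
Qed.

Lemma sinBid_le' t : `|sin t - t| <= 2 * t ^+ 2 :> R.
Proof.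
have [t1|t1] := leP `|t| 1.
  apply: le_trans (sinBid_le t1) _; have := sqr_ge0 t; lra.
apply: le_trans (ler_normB _ _) _; have := sin_le t.
rewrite -[t ^+ 2]real_normK ?num_real //; nra.
Qed.

Lemma cis_taylor t : cabs (cis t - 1 - (0 +i* t)%C) <= 3 * t ^+ 2.
Proof.
apply: le_trans (cabs_le_ReIm _) _; rewrite /= !subr0.
have := cosB1_le t; have := sinBid_le' t; lra.
Qed.

Lemma cis_lipschitz s t : cabs (cis s - cis t) <= 2 * `|s - t|.
Proof.
have -> : cis s - cis t = cis t * (cis (s - t) - 1).
  by rewrite mulrBr mulr1 -cisD addrCA subrr addr0.
rewrite cabsM cabs_cis mul1r; move: (s - t) => r.
apply: le_trans (cabs_le_ReIm _) _; rewrite /= subr0.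
have D (q : R) : is_derive q 1 (cos : R -> R) (- sin q) by exact: is_derive_cos.
have := @mvt0 cos (fun q => - sin q) r 1 D; rewrite cos0 => h.
have := sin_le r; have : `|cos r - 1| <= 1 * `|r|.
  by apply: h => q _; rewrite normrN sin_max.
lra.
Qed.

End Cis.

Section Fourier.
Variables (R : realType) (n : nat).
Local Notation C := R[i].
Local Notation E := 'rV[R]_n.
Local Notation schwartz := (schwartz R n).
Implicit Types (f g : schwartz) (i j : 'I_n) (x y xi : E) (k m : nat) (s t : R).

Definition imag t : C := (0 +i* t)%C.

Lemma imagM s t : imag s * imag t = (- (s * t))%:C%C.
Proof. by apply: complex_ext; [rewrite cReM|rewrite cImM] => /=; ring. Qed.

Lemma cabs_imag t : cabs (imag t) = `|t|.
Proof. by rewrite /cabs /= expr0n /= add0r sqrtr_sqr. Qed.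

Definition dot xi x : R := \sum_j xi 0 j * x 0 j.

Lemma dotDl xi y x : dot (xi + y) x = dot xi x + dot y x.
Proof. by rewrite /dot -big_split; apply: eq_bigr => j _ /=; rewrite mxE mulrDl. Qed.

Lemma dot_basis t j x : dot (t *: basis_vector R j) x = t * x 0 j.
Proof.
rewrite /dot (bigD1 j) //= !mxE !eqxx mulr1 big1 ?addr0 // => i ij.
by rewrite !mxE eqxx (negbTE ij) mulr0 mul0r.
Qed.

Definition character s xi x : C := cis (s * dot xi x).

Lemma is_derive_dot s xi j x :
  is_derive x (basis_vector R j) (fun x => s * dot xi x) (s * xi 0 j).
Proof.
have h i : is_derive x (basis_vector R j) (fun y : E => (s * xi 0 i) * y 0 i) (s * xi 0 i * (j == i)%:R).
  exact: is_deriveZ (is_derive_coord j i x).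
have d := is_derive_sum (h := fun i (y : E) => (s * xi 0 i) * y 0 i) h.
apply: is_derive_eqfun d _ _ => [y|].
  by rewrite fct_sumE /dot mulr_sumr; apply: eq_bigr => i _; rewrite mulrA.
rewrite (bigD1 j) //= eqxx mulr1 big1 ?addr0 // => i ij.
by rewrite eq_sym (negbTE ij) mulr0.
Qed.

Lemma character_has_partial s xi j :
  has_partial j (character s xi) (fun x => imag (s * xi 0 j) * character s xi x).
Proof.
move=> x; have d := is_derive_dot s xi j x; split.
  apply: is_derive_eqfun (is_derive_comp_line d (is_derive_cos _)) _ _ => //.
  by rewrite cReM /=; ring.
apply: is_derive_eqfun (is_derive_comp_line d (is_derive_sin _)) _ _ => //.
by rewrite cImM /=; ring.
Qed.

Lemma ccont_lipschitz (f : E -> C) (K : R) :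
  (forall x y, cabs (f x - f y) <= K * `|x - y|) -> ccont f.
Proof.
move=> h; have cP (P : C -> R) : (forall z, `|P z| <= cabs z) ->
    (forall z w, P (z - w) = P z - P w) -> continuous (fun x => P (f x)).
  move=> Pc PB x; apply/(@cvgrPdist_lt _ R _ (nbhs x) _ (fun z => P (f z)) (P (f x))) => e e0.
  have K0 : 0 < `|K| + 1 by rewrite ltr_wpDl.
  apply/nbhs_ballP; exists (e / (`|K| + 1)); first by rewrite /= divr_gt0.
  move=> y; rewrite mx_norm_ball /ball_ /= => xy.
  rewrite -PB; apply: le_lt_trans (Pc _) _; apply: le_lt_trans (h x y) _.
  apply: (@le_lt_trans _ _ ((`|K| + 1) * `|x - y|)).
    by rewrite ler_wpM2r // (le_trans (ler_norm _)) // lerDl.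
  by rewrite mulrC -ltr_pdivlMr.
by split; apply: cP => //; [exact: Re_le_cabs|case=> ? ? []|exact: Im_le_cabs|case=> ? ? []].
Qed.

Lemma coord_le_norm x j : `|x 0 j| <= `|x|.
Proof.
rewrite [leRHS]/Num.norm /= mx_normrE; apply: le_trans (le_bigmax _ _ (0, j)) => //=.
Qed.

Lemma dot_le xi x : `|dot xi x| <= n%:R * `|xi| * jap x.
Proof.
apply: le_trans (ler_norm_sum _ _ _) _; rewrite -[n in n%:R]card_ord -sumr_const !mulr_suml.
apply: ler_sum => j _; rewrite mul1r normrM ler_pM ?coord_le_norm ?coord_le_jap //.
Qed.

Lemma dotC xi x : dot xi x = dot x xi.
Proof. by apply: eq_bigr => j _; rewrite mulrC. Qed.

Lemma dotBl xi y x : dot (xi - y) x = dot xi x - dot y x.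
Proof. by rewrite /dot -sumrB; apply: eq_bigr => j _ /=; rewrite !mxE mulrBl. Qed.

Lemma ccont_character s xi : ccont (character s xi).
Proof.
apply: (@ccont_lipschitz _ (2 * `|s| * (n%:R * jap xi))) => x y.
apply: le_trans (cis_lipschitz _ _) _.
rewrite -mulrBr normrM -!mulrA ler_wpM2l // ler_wpM2l //.
by rewrite dotC [dot _ y]dotC -dotBl (le_trans (dot_le _ _)) // -!mulrA [`|_| * _]mulrC.
Qed.

Lemma character_slow s xi : slow (character s xi).
Proof. by exists 0%N, 1 => x; rewrite cabs_cis mulr1. Qed.

Lemma regular_slow_character s xi m : regular (@slow R n) m (character s xi).
Proof.
elim: m => [|m IH]; split=> //; do ?exact: ccont_character; do ?exact: character_slow.
move=> j; eexists; first exact: character_has_partial.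
by apply: regular_slowM => //; exact: regular_slow_cst.
Qed.

Definition modulate s xi : schwartz -> schwartz :=
  multiply (fun m => regular_slow_character s xi m).

Lemma modulate_is_linear s xi : linear (modulate s xi).
Proof. exact: multiply_is_linear. Qed.

HB.instance Definition _ s xi :=
  GRing.isLinear.Build C schwartz schwartz *:%R (modulate s xi) (modulate_is_linear s xi).

Lemma mul_coord_is_linear j : linear (@mul_coord R n j).
Proof. exact: multiply_is_linear. Qed.

HB.instance Definition _ j :=
  GRing.isLinear.Build C schwartz schwartz *:%R (@mul_coord R n j) (mul_coord_is_linear j).

(** The sign s = 1 or -1 selects the transform or, up to a factor, its
    inverse. *)
Definition fourier_fun s f : E -> C := fun xi => integral (modulate s xi f).

Lemma seminorm_sup k (B : R) f : (forall x, jap x ^+ k * cabs (f x) <= B) -> seminorm_le k 0 B f.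
Proof. by move=> h b x; rewrite leqn0 size_eq0 => /eqP ->; exact: h. Qed.

Lemma fourier_fun_bound : exists A : R, 0 <= A /\ forall s f B, seminorm_le n 0 B f ->
  forall xi, cabs (fourier_fun s f xi) <= A * B.
Proof.
have [A [A0 h]] := integral_bound R n; exists A; split=> // s f B hf xi.
apply/h/seminorm_sup => x; rewrite cabsM cabs_cis mul1r; exact: seminorm_le0 hf x.
Qed.

Lemma ccont_fourier s f : ccont (fourier_fun s f).
Proof.
have [A [A0 h]] := integral_bound R n; have [B hB] := seminorm_ex n.+1 0 f.
apply: (@ccont_lipschitz _ (A * (2 * `|s| * n%:R * B))) => xi y.
rewrite /fourier_fun -raddfB -mulrA; apply/h/seminorm_sup => x.
have -> : (modulate s xi f - modulate s y f) x = character s xi x * f x - character s y x * f x by [].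
rewrite -mulrBl cabsM.
have /ler_wpM2l := cis_lipschitz (s * dot xi x) (s * dot y x).
rewrite -mulrBr -dotBl normrM => c.
have c' : cabs (character s xi x - character s y x) <= 2 * (`|s| * (n%:R * `|xi - y| * jap x)).
  apply: le_trans (cis_lipschitz _ _) _.
  by rewrite -mulrBr -dotBl normrM ler_wpM2l // ler_wpM2l // dot_le.
apply: (@le_trans _ _ (jap x ^+ n * (2 * (`|s| * (n%:R * `|xi - y| * jap x)) * cabs (f x)))).
  by rewrite ler_wpM2l ?exprn_ge0 ?jap_ge0 // ler_wpM2r ?cabs_ge0.
rewrite (_ : jap x ^+ n * _ = 2 * `|s| * n%:R * `|xi - y| * (jap x ^+ n.+1 * cabs (f x))); last first.
  by rewrite exprSr; ring.
rewrite [leRHS]mulrAC; apply: ler_wpM2l; first by rewrite !mulr_ge0.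
exact: seminorm_le0 hB x.
Qed.

(** Difference quotients of integrals come with a rate of convergence, from
    the Taylor estimate of the exponential. *)
Lemma is_derive_quick (u : E -> R) x (e : E) (d K : R) :
  (forall h : R, h != 0 -> `|h^-1 * (u (x + h *: e) - u x) - d| <= K * `|h|) ->
  is_derive x e u d.
Proof.
move=> H; have c : (fun h : R => h^-1 *: ((u \o shift x) (h *: e) - u x)) @ 0^' --> d.
  apply/cvgrPdist_lt => eps eps0.
  have K0 : 0 < `|K| + 1 by rewrite ltr_wpDl.
  have dl : 0 < eps / (`|K| + 1) by rewrite divr_gt0.
  near=> h.
  have h0 : h != 0 by near: h; exact: nbhs_dnbhs_neq.
  have hs : `|h| < eps / (`|K| + 1) by near: h; exact: dnbhs0_lt.
  rewrite distrC /= (addrC _ x); apply: le_lt_trans (H h h0) _.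
  apply: (@le_lt_trans _ _ ((`|K| + 1) * `|h|)).
    by rewrite ler_wpM2r // (le_trans (ler_norm _)) // lerDl.
  by rewrite mulrC -ltr_pdivlMr.
split; first by apply/cvg_ex; exists d.
exact: cvg_lim c.
Unshelve. all: by end_near. Qed.

(** Differentiation under the integral: the remainder of the difference
    quotient of the exponential is at most 3 s^2 |h| x_j^2, and x_j^2 f is
    integrable. *)
Lemma fourier_has_partial s f j :
  has_partial j (fourier_fun s f) (fourier_fun s (imag s *: mul_coord j f)).
Proof.
move=> xi; have [A [A0 hA]] := integral_bound R n.
have [B hB] := seminorm_ex n 0 (mul_coord j (mul_coord j f)).
pose D h := h^-1%:C%C *: (modulate s (xi + h *: basis_vector R j) f - modulate s xi f) -
   modulate s xi (imag s *: mul_coord j f).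
have ID h : integral (D h) = h^-1%:C%C * (fourier_fun s f (xi + h *: basis_vector R j) - fourier_fun s f xi) -
    fourier_fun s (imag s *: mul_coord j f) xi.
  by rewrite /D raddfB /= [integral (_ *: _)]linearZ /= raddfB.
have bound h : h != 0 -> cabs (integral (D h)) <= A * (3 * s ^+ 2 * B) * `|h|.
  move=> h0; rewrite -mulrA; apply/hA/seminorm_sup => x.
  have -> : D h x = character s xi x * (h^-1%:C%C * (cis (s * (h * x 0 j)) - 1 - imag (s * (h * x 0 j))) * f x).
    rewrite -[LHS]/(h^-1%:C%C * (character s (xi + h *: basis_vector R j) x * f x - character s xi x * f x) -
      character s xi x * (imag s * ((x 0 j)%:C%C * f x))).
    have -> : imag (s * (h * x 0 j)) = h%:C%C * (imag s * (x 0 j)%:C%C).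
      by apply: complex_ext; rewrite ?cReM ?cImM /= ?cReM ?cImM /=; ring.
    have -> : character s (xi + h *: basis_vector R j) x = character s xi x * cis (s * (h * x 0 j)).
      by rewrite /character dotDl dot_basis mulrDr cisD.
    have hh : h^-1%:C%C * h%:C%C = 1 :> C by rewrite -rmorphM /= mulVf.
    have e2 (w z : C) : h^-1%:C%C * (z - h%:C%C * w) = h^-1%:C%C * z - w.
      by rewrite mulrBr mulrA hh mul1r.
    rewrite e2; ring.
  rewrite cabsM cabs_cis mul1r !cabsM cabs_real normfV.
  apply: (@le_trans _ _ (jap x ^+ n * (`|h|^-1 * (3 * (s * (h * x 0 j)) ^+ 2) * cabs (f x)))).
    rewrite ler_wpM2l ?exprn_ge0 ?jap_ge0 // ler_wpM2r ?cabs_ge0 // ler_wpM2l ?invr_ge0 //.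
    exact: cis_taylor.
  rewrite (_ : jap x ^+ n * _ = 3 * s ^+ 2 * `|h| * (jap x ^+ n * (x 0 j ^+ 2 * cabs (f x)))); last first.
    have hh : `|h|^-1 * h ^+ 2 = `|h|.
      by rewrite -[h ^+ 2]real_normK ?num_real // expr2 mulKf // normr_eq0.
    rewrite -[in RHS]hh; ring.
  rewrite [leRHS]mulrAC; apply: ler_wpM2l.
    by rewrite mulr_ge0 // mulr_ge0 // sqr_ge0.
  have := seminorm_le0 hB x; rewrite /= !cabsM !cabs_real [`|_| * (_ * _)]mulrA.
  by rewrite -expr2 real_normK ?num_real.
have key (P : C -> R) : (forall z, `|P z| <= cabs z) ->
    (forall z w, P (z - w) = P z - P w) -> (forall (a : R) z, P (a%:C%C * z) = a * P z) ->
    is_derive xi (basis_vector R j) (fun y => P (fourier_fun s f y))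
      (P (fourier_fun s (imag s *: mul_coord j f) xi)).
  move=> Pc PB PZ; apply: is_derive_quick => h h0.
  apply: le_trans (bound h h0); rewrite ID.
  by rewrite -PB -PZ -PB; exact: Pc.
split; apply: key.
- exact: Re_le_cabs.
- by case=> ? ? [].
- by move=> a z; rewrite cReM /= mul0r subr0.
- exact: Im_le_cabs.
- by case=> ? ? [].
- by move=> a z; rewrite cImM /= mul0r addr0.
Qed.

Lemma fourier_fun_lin s c f g xi :
  fourier_fun s (c *: f + g) xi = c * fourier_fun s f xi + fourier_fun s g xi.
Proof. by rewrite /fourier_fun linearP /= linearP. Qed.

Lemma fourier_funZ s c f xi : fourier_fun s (c *: f) xi = c * fourier_fun s f xi.
Proof. by rewrite /fourier_fun linearZ /= linearZ. Qed.

(** Integration by parts: the derivative of the product of f with the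
    character has integral 0. *)
Lemma fourier_fun_partial s f j xi :
  fourier_fun s (schwartz_partial j f) xi = imag (- (s * xi 0 j)) * fourier_fun s f xi.
Proof.
have e : schwartz_partial j (modulate s xi f) =
    imag (s * xi 0 j) *: modulate s xi f + modulate s xi (schwartz_partial j f).
  apply: val_inj => /=; apply: has_partialE.
  have := has_partialM (character_has_partial s xi j) (schwartz_has_partial j f).
  congr has_partial; apply/funext => x.
  by rewrite -[RHS]/(imag (s * xi 0 j) * (character s xi x * f x) + character s xi x * partial j f x) mulrA.
have := integral_partial j (modulate s xi f); rewrite e linearP /= => /eqP.
rewrite addrC addr_eq0 => /eqP h; rewrite /fourier_fun h -mulNr; congr (_ * _).
by apply: complex_ext => /=; rewrite ?oppr0.
Qed.

(** The operator 1 + Laplacian for the positive Laplacian; its symbol is jap,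
    whence the decay of the transform. *)
Definition bessel f : schwartz := f - \sum_j schwartz_partial j (schwartz_partial j f).

Lemma fourier_fun_bessel s f xi : s ^+ 2 = 1 ->
  fourier_fun s (bessel f) xi = (jap xi)%:C%C * fourier_fun s f xi.
Proof.
move=> s1; rewrite /bessel {1}/fourier_fun linearB /= linearB /= linear_sum /= linear_sum /=.
rewrite -/(fourier_fun s f xi) /jap rmorphD /= mulrDl mul1r; congr (_ + _).
rewrite rmorph_sum /= mulr_suml -sumrN; apply: eq_bigr => j _.
rewrite -/(fourier_fun s (schwartz_partial j (schwartz_partial j f)) xi).
rewrite !fourier_fun_partial mulrA imagM -mulNr -rmorphN /= opprK; congr (_%:C%C * _).
by rewrite mulrNN mulrACA -!expr2 s1 mul1r.
Qed.

Lemma seminorm_sum k m (B : R) (F : 'I_n -> schwartz) : (forall j, seminorm_le k m B (F j)) ->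
  seminorm_le k m (n%:R * B) (\sum_j F j).
Proof.
move=> h; rewrite -[n in n%:R]card_ord -sumr_const mulr_suml.
elim/big_rec2: _ => [|j f B' _ IH]; last by apply: seminormD IH; rewrite mul1r.
have [B1 hB1] := seminorm_ex k m (0 : schwartz).
by have := seminorm_scale 0 hB1; rewrite scale0r cabs0 mul0r.
Qed.

Lemma seminorm_bessel k m B f : seminorm_le k m.+2 B f ->
  seminorm_le k m ((1 + n%:R) * B) (bessel f).
Proof.
move=> hf; rewrite mulrDl mul1r /bessel -scaleN1r.
have h1 : seminorm_le k m B f by apply: seminorm_leW hf; rewrite // ?leqW.
have h2 := seminorm_sum (fun j => seminorm_partial j (seminorm_partial j hf)).
by have := seminormD h1 (seminorm_scale (-1) h2); rewrite cabsN cabs1 mul1r.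
Qed.

Lemma fourier_fun_seminorm s k : s ^+ 2 = 1 -> exists N (A : R), 0 <= A /\
  forall f B, seminorm_le N N B f -> forall xi, jap xi ^+ k * cabs (fourier_fun s f xi) <= A * B.
Proof.
move=> s1; have [A0 [A00 h]] := fourier_fun_bound.
suff [N [A [A1 H]]] : exists N (A : R), 0 <= A /\
  forall f B, seminorm_le N N B f -> seminorm_le n 0 (A * B) (iter k bessel f).
  exists N, (A0 * A); split; first by rewrite mulr_ge0.
  move=> f B hf xi; rewrite -mulrA.
  have -> : jap xi ^+ k * cabs (fourier_fun s f xi) = cabs (fourier_fun s (iter k bessel f) xi).
    elim: k {H} => [|k IH]; first by rewrite expr0 mul1r.
    by rewrite iterS fourier_fun_bessel // cabsM cabs_real ger0_norm ?jap_ge0 // exprS -mulrA IH.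
  exact/h/H.
exists (n + 2 * k)%N, ((1 + n%:R) ^+ k); split; first by rewrite exprn_ge0.
suff H m f B : seminorm_le n (m + 2 * k) B f -> seminorm_le n m ((1 + n%:R) ^+ k * B) (iter k bessel f).
  by move=> f B hf; apply: (H 0%N); apply: seminorm_leW hf; rewrite ?leq_addr // leq_addl.
elim: k m f B => [|k IH] m f B hf; first by rewrite expr0 mul1r; rewrite muln0 addn0 in hf.
rewrite exprS -mulrA iterS; apply: seminorm_bessel; apply: IH.
by apply: seminorm_leW hf => //; rewrite mulnS; lia.
Qed.

Lemma regular_fourier s f m : s ^+ 2 = 1 -> regular (@rapid R n) m (fourier_fun s f).
Proof.
move=> s1; have r f' : rapid (fourier_fun s f').
  move=> k; have [N [A [_ h]]] := fourier_fun_seminorm k s1.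
  have [B hB] := seminorm_ex N N f'; exists (A * B); exact: h.
elim: m f => [|m IH] f; split=> //; do ?exact: ccont_fourier.
by move=> j; eexists; [exact: fourier_has_partial|exact: IH].
Qed.

Section Transform.
Variables (s : R) (s1 : s ^+ 2 = 1).

Definition fourier f : schwartz := mk_schwartz (fun m => regular_fourier f m s1).

Lemma fourier_lin c f g : fourier (c *: f + g) = c *: fourier f + fourier g.
Proof. by apply: schwartz_eq => xi; exact: fourier_fun_lin. Qed.

HB.instance Definition _ :=
  GRing.isLinear.Build C schwartz schwartz *:%R fourier fourier_lin.

Lemma fourierZ c f : fourier (c *: f) = c *: fourier f.
Proof. by apply: schwartz_eq => xi; exact: fourier_funZ. Qed.

Lemma partial_fourier j f :
  schwartz_partial j (fourier f) = imag s *: fourier (mul_coord j f).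
Proof.
by rewrite -fourierZ; apply: val_inj => /=; apply: has_partialE; exact: fourier_has_partial.
Qed.

Lemma fourier_partial j f :
  fourier (schwartz_partial j f) = imag (- s) *: mul_coord j (fourier f).
Proof.
apply: schwartz_eq => xi.
rewrite -[LHS]/(fourier_fun s (schwartz_partial j f) xi) fourier_fun_partial.
rewrite -[RHS]/(imag (- s) * ((xi 0 j)%:C%C * fourier_fun s f xi)) mulrA; congr (_ * _).
by apply: complex_ext; rewrite ?cReM ?cImM /=; ring.
Qed.

Lemma fourier_seminorm k m : exists N (A : R), 0 <= A /\
  forall f B, seminorm_le N N B f -> seminorm_le k m (A * B) (fourier f).
Proof.
have [N0 [A0 [A00 h0]]] := fourier_fun_seminorm k s1.
elim: m => [|m [N [A [A_ge0 h]]]].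
  by exists N0, A0; split=> // f B hf; apply: seminorm_sup => x; exact: h0.
exists (N0 + N).+1, (A0 + A * N.+1%:R); split; first by rewrite addr_ge0 // mulr_ge0.
move=> f B hf; have B0 := seminorm_le_ge0 hf; apply/seminorm_leS; split=> [x|j].
  apply: le_trans (h0 f B _ x) _; first by apply: seminorm_leW hf => //; lia.
  by rewrite ler_wpM2r // lerDl mulr_ge0.
rewrite -[partial j _]/(schwartz_fun (schwartz_partial j (fourier f))) partial_fourier.
have hj : seminorm_le N N (N.+1%:R * B) (mul_coord j f).
  by apply: seminorm_mul_coord; apply: seminorm_leW hf => //; lia.
have := seminorm_scale (imag s) (h _ _ hj); apply: seminorm_leW => //.
rewrite cabs_imag; have -> : `|s| = 1.
  by have /eqP := s1; rewrite sqrf_eq1 => /orP[] /eqP ->; rewrite ?normrN normr1.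
by rewrite mul1r mulrA ler_wpM2r // lerDr.
Qed.

End Transform.

End Fourier.

(** * Commuting derivatives and translations *)

Section Symmetry.
Variables (R : realType) (n : nat).
Local Notation C := R[i].
Local Notation E := 'rV[R]_n.
Local Notation Re := (@complex.Re R).
Local Notation Im := (@complex.Im R).
Local Notation schwartz := (schwartz R n).
Implicit Types (f g : schwartz) (i j : 'I_n) (x y : E) (k m : nat).

Lemma is_derive_translate (u : E -> R) (x v e : E) (a : R) :
  is_derive (x + v) e u a -> is_derive x e (fun y => u (y + v)) a.
Proof.
have E : (fun h : R => h^-1 *: (((fun y => u (y + v)) \o shift x) (h *: e) - u (x + v))) =
    (fun h : R => h^-1 *: ((u \o shift (x + v)) (h *: e) - u (x + v))).
  by apply/funext => h /=; rewrite addrA.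
by move=> [d1 d2]; split; move: d1 d2; rewrite /derivable /derive E.
Qed.

(** Schwarz's theorem: one and the same second order difference is h^2 times a
    value of either mixed derivative near x. *)
Lemma mixed_derivatives (u ui uj uij uji : E -> R) i j :
  (forall x, is_derive x (basis_vector R i) u (ui x)) ->
  (forall x, is_derive x (basis_vector R j) u (uj x)) ->
  (forall x, is_derive x (basis_vector R j) ui (uji x)) ->
  (forall x, is_derive x (basis_vector R i) uj (uij x)) ->
  continuous uij -> continuous uji -> forall x, uij x = uji x.
Proof.
move=> Di Dj Dji Dij cij cji x.
have key (v vi vji : E -> R) (a b : 'I_n) (h : R) :
    (forall x, is_derive x (basis_vector R a) v (vi x)) ->
    (forall x, is_derive x (basis_vector R b) vi (vji x)) ->
    exists y : E, (forall l, `|y 0 l| <= 2 * `|h|) /\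
    (v (x + h *: basis_vector R a + h *: basis_vector R b) - v (x + h *: basis_vector R a)) -
    (v (x + h *: basis_vector R b) - v x) = vji (x + y) * h * h.
  move=> Da Db; set ea := basis_vector R a; set eb := basis_vector R b.
  pose w y := v (y + h *: eb) - v y.
  have Dw y : is_derive y ea w (vi (y + h *: eb) - vi y).
    apply: is_deriveB (Da y); exact: is_derive_translate.
  have [c ch e1] := @line_MVT _ _ w ea x h (fun y => @ex_derive _ _ _ _ _ _ _ (Dw y)).
  have [d dh e2] := @line_MVT _ _ vi eb (x + c *: ea) h (fun y => @ex_derive _ _ _ _ _ _ _ (Db y)).
  exists (c *: ea + d *: eb); split.
    move=> l; rewrite !mxE eqxx /= mulrDl mul1r; apply: le_trans (ler_normD _ _) _.
    by apply: lerD; case: eqP => _; rewrite ?mulr1 ?mulr0 ?normr0.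
  rewrite -/(w (x + h *: ea)) -/(w x) e1 (@derive_val _ _ _ _ _ _ _ (Dw _)) e2.
  by rewrite (@derive_val _ _ _ _ _ _ _ (Db _)) addrA.
apply/eqP; rewrite -subr_eq0 -normr_eq0 eq_le normr_ge0 andbT.
apply/ler_addgt0Pr => e e0; rewrite add0r.
have e2 : 0 < e / 2 by rewrite divr_gt0.
have near_ball (v : E -> R) : continuous v -> exists2 d : R, 0 < d &
    forall y : E, (forall l, `|y 0 l| < d) -> `|v (x + y) - v x| < e / 2.
  move=> cv; have /(@cvgrPdist_lt _ R _ (nbhs x) _ v (v x)) := cv x.
  move=> /(_ _ e2)/nbhs_ballP[d /= d0 hd]; exists d => // y yd.
  rewrite distrC; apply: hd; split => // k l; rewrite (ord1 k) /ball /= mxE.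
  by rewrite opprD addrA subrr add0r normrN.
have [d1 d10 h1] := near_ball _ cij; have [d2 d20 h2] := near_ball _ cji.
pose h := Num.min d1 d2 / 3.
have m0 : 0 < Num.min d1 d2 by rewrite lt_min d10.
have h0 : 0 < h by rewrite divr_gt0.
have [y [yh ey]] := key u ui uji i j h Di Dji.
have [z [zh ez]] := key u uj uij j i h Dj Dij.
have exy : uji (x + y) = uij (x + z).
  apply: (mulIf (lt0r_neq0 h0)); apply: (mulIf (lt0r_neq0 h0)); rewrite -ey -ez.
  by rewrite [x + h *: basis_vector R j + _]addrAC; ring.
have hd : 2 * `|h| < Num.min d1 d2.
  by rewrite gtr0_norm // /h; move: (Num.min d1 d2) m0 => q q0; lra.
have l1 : Num.min d1 d2 <= d1 by rewrite ge_min lexx.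
have l2 : Num.min d1 d2 <= d2 by rewrite ge_min lexx orbT.
have p1 := h1 z (fun l => le_lt_trans (zh l) (lt_le_trans hd l1)).
have p2 := h2 y (fun l => le_lt_trans (yh l) (lt_le_trans hd l2)).
rewrite -[uij x - uji x](subrKA (uij (x + z))) -{2}exy.
apply: le_trans (ler_normD _ _) _; rewrite distrC [e]splitr; apply: lerD; exact: ltW.
Qed.

Lemma schwartz_partialC i j f :
  schwartz_partial i (schwartz_partial j f) = schwartz_partial j (schwartz_partial i f).
Proof.
have ci g : ccont g by exact: regular_ccont (schwartz_regular g 0).
have hi := schwartz_has_partial i f; have hj := schwartz_has_partial j f.
have hij := schwartz_has_partial i (schwartz_partial j f).
have hji := schwartz_has_partial j (schwartz_partial i f).
apply: schwartz_eq => x; apply: complex_ext.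
  apply: (mixed_derivatives (fun x => (hi x).1) (fun x => (hj x).1) (fun x => (hji x).1)
    (fun x => (hij x).1)).
    exact: (ci (schwartz_partial i (schwartz_partial j f))).1.
  exact: (ci (schwartz_partial j (schwartz_partial i f))).1.
apply: (mixed_derivatives (fun x => (hi x).2) (fun x => (hj x).2) (fun x => (hji x).2)
    (fun x => (hij x).2)).
  exact: (ci (schwartz_partial i (schwartz_partial j f))).2.
exact: (ci (schwartz_partial j (schwartz_partial i f))).2.
Qed.

Lemma tempered_partialC i j (T : tempered R n) :
  tempered_partial i (tempered_partial j T) = tempered_partial j (tempered_partial i T).
Proof. by apply: val_inj; apply/funext => f /=; rewrite schwartz_partialC. Qed.

(** Peetre's inequality: translations preserve rapid decrease. *)
Lemma jap_add x y : jap (x + y) <= 2 * jap x * jap y.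
Proof.
have h : normsq (x + y) <= 2 * (normsq x + normsq y).
  rewrite /normsq mulrDr !mulr_sumr -big_split; apply: ler_sum => i _ /=; rewrite mxE.
  have := sqr_ge0 (x 0 i - y 0 i); nra.
rewrite !japE; have := normsq_ge0 x; have := normsq_ge0 y; nra.
Qed.

Lemma translate_has_partial i y (f g : E -> C) : has_partial i f g ->
  has_partial i (fun x => f (x + y)) (fun x => g (x + y)).
Proof.
move=> h x; have [h1 h2] := h (x + y); split.
  exact: (is_derive_translate (u := fun x => Re (f x))) h1.
exact: (is_derive_translate (u := fun x => Im (f x))) h2.
Qed.

Lemma ccont_translate y (f : E -> C) : ccont f -> ccont (fun x => f (x + y)).
Proof.
have ct : continuous (fun x => x + y).
  move=> x; apply: (@cvgD _ _ _ (nbhs x) _ id (fun=> y)); last exact: cvg_cst.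
  exact: cvg_id.
move=> [c1 c2]; split=> x.
  apply: (@continuous_comp _ _ _ (fun x => x + y) (fun x => Re (f x))); [exact: ct|exact: c1].
apply: (@continuous_comp _ _ _ (fun x => x + y) (fun x => Im (f x))); [exact: ct|exact: c2].
Qed.

Lemma jap_translate_le y k (v : R) x : 0 <= v ->
  jap x ^+ k * v <= (2 * jap y) ^+ k * (jap (x + y) ^+ k * v).
Proof.
move=> v0; rewrite mulrA -exprMn ler_wpM2r // lerXn2r ?nnegrE ?jap_ge0 //.
  by rewrite !mulr_ge0 ?jap_ge0.
have := jap_add (x + y) (- y); rewrite addrK.
have -> : jap (- y) = jap y by rewrite /jap; congr (_ + _); apply: eq_bigr => i _; rewrite mxE sqrrN.
by rewrite mulrAC.
Qed.

Lemma regular_translate y m (f : E -> C) : regular (@rapid R n) m f ->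
  regular (@rapid R n) m (fun x => f (x + y)).
Proof.
have r (f' : E -> C) : rapid f' -> rapid (fun x => f' (x + y)).
  move=> h k; have [M hM] := h k; exists ((2 * jap y) ^+ k * M) => x.
  apply: le_trans (@jap_translate_le y k _ x (cabs_ge0 _)) _.
  by rewrite ler_wpM2l // exprn_ge0 // mulr_ge0 ?jap_ge0.
elim: m f => [|m IH] f [c b h]; split=> //; do ?exact: ccont_translate; do ?exact: r.
move=> i; have [g hg rg] := h i; eexists; first exact: translate_has_partial hg.
exact: IH.
Qed.

Definition translate y f : schwartz := mk_schwartz (fun m => regular_translate y (schwartz_regular f m)).

Lemma translate_seminorm y k m B f : seminorm_le k m B f ->
  seminorm_le k m ((2 * jap y) ^+ k * B) (translate y f).
Proof.
have c0 : 0 <= (2 * jap y) ^+ k by rewrite exprn_ge0 // mulr_ge0 ?jap_ge0.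
have sup g B' : (forall x, jap x ^+ k * cabs (g x) <= B') -> forall x,
    jap x ^+ k * cabs (translate y g x) <= (2 * jap y) ^+ k * B'.
  move=> h x; apply: le_trans (@jap_translate_le y k _ x (cabs_ge0 _)) _.
  by rewrite ler_wpM2l.
elim: m f => [|m IH] f hf.
  by apply: seminorm_sup => x; apply: sup => z; exact: seminorm_le0 hf z.
apply/seminorm_leS; split=> [x|i].
  by apply: sup => z; exact: seminorm_le0 hf z.
have -> : partial i (translate y f) = translate y (schwartz_partial i f).
  by apply: has_partialE; apply: translate_has_partial; exact: schwartz_has_partial.
by apply: IH; exact: seminorm_partial.
Qed.

End Symmetry.

(** * Fourier inversion *)

Section Inversion.
Variables (R : realType) (n : nat).
Local Notation C := R[i].
Local Notation E := 'rV[R]_n.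
Local Notation schwartz := (schwartz R n).
Local Notation tempered := (tempered R n).
Implicit Types (f g : schwartz) (i j : 'I_n) (x y : E) (k m : nat).

Definition gauss x : R := expR (- (normsq x / 2)).

Lemma is_derive_gauss j x : is_derive x (basis_vector R j) gauss (- x 0 j * gauss x).
Proof.
have d1 : is_derive x (basis_vector R j) (fun y => - (normsq y / 2)) (- x 0 j).
  have d := is_deriveZ (- 2^-1) (is_derive_normsq j x).
  by apply: is_derive_eqfun d _ _ => [y|]; rewrite -?[LHS]/(- 2^-1 * _); field.
apply: is_derive_eqfun (is_derive_comp_line d1 (is_derive_expR _)) _ _ => //.
by rewrite /gauss mulrC.
Qed.

Lemma gauss_has_partial j :
  has_partial j (fun x => (gauss x)%:C%C) (fun x => (- x 0 j)%:C%C * (gauss x)%:C%C).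
Proof.
have -> : (fun x => (- x 0 j)%:C%C * (gauss x)%:C%C) = (fun x => (- x 0 j * gauss x)%:C%C).
  by apply/funext => x; rewrite rmorphM.
by apply: has_partial_real => x; exact: is_derive_gauss.
Qed.

Lemma rapid_gauss : rapid (fun x : E => (gauss x)%:C%C).
Proof.
move=> k; exists (expR (1 / 2) * (2 ^+ k.+1 * k.+1`!%:R)) => x.
rewrite cabs_real ger0_norm ?expR_ge0 //.
have -> : gauss x = expR (1 / 2) / expR (jap x / 2).
  by rewrite -expRB /gauss japE; congr expR; field.
(* the exponential dominates the term of degree k.+1 of its series *)
have h : (jap x / 2) ^+ k.+1 / k.+1`!%:R <= expR (jap x / 2).
  have := @expR_ge1Dxn R (jap x / 2) k; rewrite divr_ge0 ?jap_ge0 // => /(_ isT).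
  by apply: le_trans; rewrite lerDr.
rewrite mulrCA ler_wpM2l ?expR_ge0 // ler_pdivrMr ?expR_gt0 //.
apply: (@le_trans _ _ (jap x ^+ k.+1)); first exact: jap_expn_le.
apply: le_trans (ler_wpM2l _ h); last by rewrite mulr_ge0 // exprn_ge0.
rewrite expr_div_n le_eqVlt; apply/orP; left; apply/eqP; field.
by rewrite expf_neq0 ?pnatr_eq0 //= -lt0n fact_gt0.
Qed.

Lemma continuous_gauss : continuous gauss.
Proof.
have c : continuous (fun y : E => (- 2^-1) * normsq y).
  by move=> x; exact: cvgMr (continuous_normsq (x:=x)).
move=> x; have -> : gauss = expR \o (fun y => (- 2^-1) * normsq y).
  by apply/funext => y; rewrite /gauss /=; congr expR; field.
by apply: continuous_comp; [exact: c|exact: continuous_expR].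
Qed.

Lemma regular_gauss m : regular (@rapid R n) m (fun x => (gauss x)%:C%C).
Proof.
elim: m => [|m IH]; split=> //; do ?exact: rapid_gauss;
  do ?(apply: ccont_real; exact: continuous_gauss).
move=> j; eexists; first exact: gauss_has_partial.
apply: (regularM (@slow_rapidM R n) (@rapidD R n)) IH.
rewrite (_ : (fun x => _) = fun x => (-1) * (x 0 j)%:C%C).
  by apply: regular_slowM; [exact: regular_slow_cst|exact: regular_slow_coord].
by apply/funext => x; rewrite rmorphN mulN1r.
Qed.

Definition gaussian : schwartz := mk_schwartz regular_gauss.

Lemma gauss_gt0 x : 0 < gauss x. Proof. exact: expR_gt0. Qed.

Lemma partial_gaussian j : schwartz_partial j gaussian = - mul_coord j gaussian.
Proof.
apply: val_inj => /=; apply: has_partialE; have := gauss_has_partial j.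
congr has_partial; apply/funext => x.
by rewrite -[RHS]/(- ((x 0 j)%:C%C * (gauss x)%:C%C)) rmorphN mulNr.
Qed.

Lemma integral_gaussian_neq0 : integral gaussian != 0.
Proof.
apply/eqP => h; have := @integral_eq0 _ _ gaussian gauss (fun _ => erefl).
move=> /(_ (fun x => ltW (gauss_gt0 x)) h 0) /eqP; rewrite gt_eqF //; exact: gauss_gt0.
Qed.

(** Both sides solve d_j u = - x_j u for all j. Such a u is determined by
    u(0), because exp(|x|^2 / 2) u has zero derivatives. *)
Lemma fourier_gaussian s (s1 : s ^+ 2 = 1) :
  fourier s1 gaussian = integral gaussian *: gaussian.
Proof.
set G := fourier s1 gaussian.
have dG j : schwartz_partial j G = - mul_coord j G.
  rewrite partial_fourier.
  have -> : mul_coord j gaussian = (-1) *: schwartz_partial j gaussian.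
    by rewrite partial_gaussian scalerN scaleN1r opprK.
  rewrite fourierZ fourier_partial !scalerA mulrN1 mulNr imagM mulrN opprK -expr2 s1.
  by have -> : - 1%:C%C = -1 :> C by [rewrite rmorph1]; rewrite scaleN1r.
pose q x : C := (expR (normsq x / 2))%:C%C * G x.
have eD j : has_partial j (fun x => (expR (normsq x / 2))%:C%C) (fun x => (x 0 j * expR (normsq x / 2))%:C%C).
  apply: has_partial_real => x.
  have d1 : is_derive x (basis_vector R j) (fun y => normsq y / 2) (x 0 j).
    have d := is_deriveZ 2^-1 (is_derive_normsq j x).
    by apply: is_derive_eqfun d _ _ => [y|]; rewrite -?[LHS]/(2^-1 * _); field.
  apply: is_derive_eqfun (is_derive_comp_line d1 (is_derive_expR _)) _ _ => //.
  by rewrite mulrC.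
have qD j : has_partial j (fun x => q x - q 0) (fun=> 0).
  have := has_partialD (has_partialM (eD j) (schwartz_has_partial j G)) (has_partial_cst j (- q 0)).
  congr has_partial; apply/funext => x.
  have -> : partial j G x = - ((x 0 j)%:C%C * G x).
    by rewrite -[partial j G]/(schwartz_fun (schwartz_partial j G)) dG.
  by rewrite rmorphM /=; ring.
have q0 x : q x = q 0.
  apply/eqP; rewrite -subr_eq0; apply/eqP/cabs_eq0/eqP; rewrite eq_le cabs_ge0 andbT.
  have -> : 0 = (2 * n)%:R * (`|x| * 0) :> R by rewrite !mulr0.
  apply: (@box_bound _ _ (fun x => q x - q 0) (fun _ _ => 0)) => //.
  - by rewrite subrr.
  - by move=> *; rewrite cabs0.
  - by move=> j; exact: coord_le_norm.
have n0 : normsq (0 : E) = 0 by rewrite /normsq big1 // => j _; rewrite mxE expr0n.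
have q00 : q 0 = integral gaussian.
  rewrite /q n0 mul0r expR0 mul1r -[G 0]/(integral (modulate s 0 gaussian)).
  congr (integral _); apply: schwartz_eq => x; rewrite /= /character /dot big1 ?mulr0 ?cis0 ?mul1r //.
  by move=> j _; rewrite mxE mul0r.
apply: schwartz_eq => x; rewrite -[RHS]/(integral gaussian * (gauss x)%:C%C) -q00 -(q0 x).
rewrite /q mulrAC -rmorphM /= /gauss -expRD subrr expR0 mul1r //.
Qed.

Definition euler f : schwartz := \sum_j mul_coord j (schwartz_partial j f).

Lemma schwartz_partialP i c f g :
  schwartz_partial i (c *: f + g) = c *: schwartz_partial i f + schwartz_partial i g.
Proof. exact: linearP. Qed.

Lemma partial_euler i f : schwartz_partial i (euler f) = schwartz_partial i f + euler (schwartz_partial i f).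
Proof.
rewrite /euler linear_sum /=.
under eq_bigr => j _ do rewrite partial_mul_coord.
rewrite big_split /=; congr (_ + _).
  rewrite (bigD1 i) //= eqxx scale1r big1 ?addr0 // => j ij.
  by rewrite eq_sym (negbTE ij) scale0r.
by apply: eq_bigr => j _; rewrite schwartz_partialC.
Qed.

Lemma iter_partial_euler s f x :
  iter_partial s (euler f) x = (size s)%:R * iter_partial s f x + euler (foldr (@schwartz_partial R n) f s) x.
Proof.
suff H : foldr (@schwartz_partial R n) (euler f) s = (size s)%:R *: foldr (@schwartz_partial R n) f s +
   euler (foldr (@schwartz_partial R n) f s).
  by rewrite !iter_partial_schwartz H.
elim: s => [|i s IH] /=; first by rewrite scale0r add0r.
rewrite IH schwartz_partialP partial_euler addrA; congr (_ + _).
by rewrite -[X in _ + X]scale1r -scalerDl natr1.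
Qed.

(** On jets at 0 the operator sum_j x_j d_j is diagonal, with the degrees as
    eigenvalues. *)
Lemma jet_euler s f : jet s (euler f) = (size s)%:R * jet s f.
Proof.
rewrite /jet iter_partial_euler -[RHS]addr0; congr (_ + _).
by rewrite schwartz_sumE big1 // => j _; rewrite /= mxE mul0r.
Qed.

(** L does not distinguish f from f - E f / m, with E the Euler operator, and
    for m >= 1 the latter has no part of degree m in its jet at 0. Since f(0)
    = 0, finitely many such steps lead to a function that vanishes to the
    order of kernel_mul_normsq. *)
Lemma kernel_mul_coord (L : tempered) : (forall j f, L (mul_coord j f) = 0) ->
  forall f, f 0 = 0 -> L f = 0.
Proof.
move=> hL; have [|M hM] := @kernel_mul_normsq _ _ L.
  by move=> f; rewrite /mul_normsq tempered_sum big1.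
have LE f : L (euler f) = 0 by rewrite /euler tempered_sum big1.
move=> f f0.
suff [g [Lg vg]] : exists g, L g = L f /\ vanishes M.+1 g.
  by rewrite -Lg; apply: hM; exact: vanishesW vg.
elim: M {hM} => [|M [g [Lg vg]]].
  by exists f; split=> // -[|i s] //.
exists ((- (M.+1%:R)^-1) *: euler g + g); split.
  by rewrite tempered_lin LE mulr0 add0r.
move=> s; rewrite ltnS leq_eqVlt => /orP[/eqP sM|sM].
  rewrite -/(jet s _) linearP /= jet_euler sM mulrA mulNr mulVf ?pnatr_eq0 //.
  by rewrite mulN1r addNr.
rewrite -/(jet s _) linearP /= jet_euler.
by have -> : jet s g = 0 by [exact: vg]; rewrite !mulr0 addr0.
Qed.

Variables (s : R) (s1 : s ^+ 2 = 1).

Let s1' : (- s) ^+ 2 = 1. Proof. by rewrite sqrrN. Qed.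

Lemma fourier_fourier_coord j f :
  fourier s1' (fourier s1 (mul_coord j f)) = mul_coord j (fourier s1' (fourier s1 f)).
Proof.
have e : fourier s1 (mul_coord j f) = imag (- s) *: schwartz_partial j (fourier s1 f).
  by rewrite partial_fourier scalerA imagM mulNr opprK -expr2 s1 scale1r.
rewrite e fourierZ fourier_partial scalerA imagM opprK mulNr opprK -expr2 s1.
by rewrite scale1r.
Qed.

(** The composite A of the two transforms commutes with the coordinates. Hence
    g |-> A (translate (- y) g) y kills all x_j g, so it only depends on g(0)
    by kernel_mul_coord: A multiplies g by a function of y, which the
    Gaussian, an eigenvector, shows to be constant. *)
Theorem fourier_inversion f :
  fourier s1' (fourier s1 f) = (integral gaussian ^+ 2) *: f.
Proof.
pose A g := fourier s1' (fourier s1 g).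
have Alin c g h : A (c *: g + h) = c *: A g + A h by rewrite /A !fourier_lin.
suff H y : exists c, forall g, A g y = c * g y.
  apply: schwartz_eq => y; have [c hc] := H y.
  rewrite -[LHS]/(A f y) hc -[RHS]/(integral gaussian ^+ 2 * f y); congr (_ * _).
  have g0 : (gauss y)%:C%C != 0 :> C.
    by rewrite -[0]/((0 : R)%:C%C) (inj_eq (@complexI R)) gt_eqF // gauss_gt0.
  apply: (mulIf g0); rewrite -[(gauss y)%:C%C]/(gaussian y) -hc.
  rewrite /A fourier_gaussian fourierZ fourier_gaussian scalerA.
  by rewrite -expr2.
pose L g := A (translate (- y) g) y.
have tlin c g h : translate (- y) (c *: g + h) = c *: translate (- y) g + translate (- y) h.
  exact: schwartz_eq.
have Llin c g h : L (c *: g + h) = c * L g + L h by rewrite /L tlin Alin.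
have Lb : seminorm_bounded L.
  have [N1 [A1 [A10 h1]]] := fourier_seminorm n s1' 0 0.
  have [N2 [A2 [A20 h2]]] := fourier_seminorm n s1 N1 N1.
  have c0 : 0 <= (2 * jap (- y)) ^+ N2 by rewrite exprn_ge0 // mulr_ge0 ?jap_ge0.
  exists N2, (A1 * (A2 * (2 * jap (- y)) ^+ N2)); split; first by rewrite !mulr_ge0.
  move=> g B hg; have := h1 _ _ (h2 _ _ (translate_seminorm (- y) hg)).
  by move=> /seminorm_le0 /(_ y); rewrite expr0 mul1r !mulrA.
have Lx j g : L (mul_coord j g) = 0.
  have -> : L (mul_coord j g) = A (mul_coord j (translate (- y) g) - (y 0 j)%:C%C *: translate (- y) g) y.
    rewrite /L; congr (A _ y); apply: schwartz_eq => x.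
    rewrite -[RHS]/((x 0 j)%:C%C * g (x - y) - (y 0 j)%:C%C * g (x - y)) -mulrBl /= !mxE.
    by rewrite rmorphB.
  have AB g' c h : A (g' - c *: h) = A g' - c *: A h.
    by rewrite addrC -scaleNr Alin scaleNr addrC.
  rewrite AB /A fourier_fourier_coord.
  by rewrite -[LHS]/((y 0 j)%:C%C * A (translate (- y) g) y - (y 0 j)%:C%C * A (translate (- y) g) y) subrr.
have K := @kernel_mul_coord (Tempered (mk_tempered Llin Lb)) Lx.
exists (L gaussian) => g.
have -> : A g y = L (translate y g).
  by rewrite /L; congr (A _ y); apply: schwartz_eq => x; rewrite /= addrNK.
have gz : gaussian 0 = 1.
  rewrite /= /gauss /normsq big1 ?mul0r ?oppr0 ?expR0 // => j _.
  by rewrite mxE expr0n.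
have h0 : (- (g y) *: gaussian + translate y g) 0 = 0.
  by rewrite -[LHS]/(- g y * gaussian 0 + g (0 + y)) gz mulr1 add0r addNr.
have := K _ h0; rewrite -[X in X = _]/(L (- (g y) *: gaussian + translate y g)) Llin.
by move/eqP; rewrite mulNr addrC subr_eq0 mulrC => /eqP.
Qed.

End Inversion.

(** * Preimages of polynomials under the Laplacian *)

Section PolynomialLaplacian.
Variables (K : fieldType) (n : nat).
Hypothesis K0 : forall k, k.+1%:R != 0 :> K.
Local Notation P := (mpoly n K).
Implicit Types (p q : P) (m : multinom n) (i j : 'I_n).

Definition sum_sqr_mderiv p : P := \sum_i mderiv i (mderiv i p).

Lemma sum_sqr_mderiv_is_linear : linear sum_sqr_mderiv.
Proof.
move=> a p q; rewrite /sum_sqr_mderiv scaler_sumr -big_split; apply: eq_bigr => i _ /=.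
by rewrite !linearP.
Qed.

HB.instance Definition _ := GRing.isLinear.Build K P P *:%R
  sum_sqr_mderiv sum_sqr_mderiv_is_linear.

(** Integrate the monomial twice in the variable i0: the second derivatives in
    the other variables leave an error whose degree in these is smaller by two,
    and the induction takes care of it. *)
Lemma monomial_sum_sqr_mderiv (i0 : 'I_n) d m : (\sum_(j | j != i0) m j < d)%N ->
  exists p, sum_sqr_mderiv p = mpolyX K m.
Proof.
elim: d m => [//|d IH] m md.
pose m' := mnm_add m (mnm_add (mnm1 i0) (mnm1 i0)).
have m'0 : m' i0 = (m i0).+2 by rewrite /m' !mnmDE !mnm1E eqxx addn2.
have m'j j : j != i0 -> m' j = m j.
  by move=> ji; rewrite /m' !mnmDE !mnm1E eq_sym (negbTE ji) !addn0.
have DD j : mderiv j (mderiv j (mpolyX K m')) =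
    ((m' j)%:R * (m' j).-1%:R) *: mpolyX K (mnm_sub (mnm_sub m' (mnm1 j)) (mnm1 j)).
  rewrite mderivX linearZ /= mderivX scalerA; congr (_ * _%:R *: _).
  by rewrite mnmBE mnm1E eqxx subn1.
pose c : K := (m i0).+2%:R * (m i0).+1%:R.
have c0 : c != 0 by rewrite mulf_neq0 // K0.
have hex j : exists p, j != i0 -> sum_sqr_mderiv p =
   ((m' j)%:R * (m' j).-1%:R) *: mpolyX K (mnm_sub (mnm_sub m' (mnm1 j)) (mnm1 j)).
  have [->|ji] := eqVneq j i0; first by exists 0.
  have [mj|mj] := leqP (m' j) 1.
    exists 0 => _; rewrite linear0; case: (m' j) mj => [|[|]] //= _.
      by rewrite mul0r scale0r.
    by rewrite mulr0 scale0r.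
  have [|p hp] := IH (mnm_sub (mnm_sub m' (mnm1 j)) (mnm1 j)); last first.
    by exists (((m' j)%:R * (m' j).-1%:R) *: p) => _; rewrite linearZ /= hp.
  rewrite -ltnS; apply: leq_trans md; rewrite ltnS.
  rewrite (bigD1 j) //= [X in (_ < X)%N](bigD1 j) //=.
  rewrite !mnmBE mnm1E eqxx -(m'j j ji) -addSn leq_add //.
    by rewrite subn1; case: (m' j) mj => [|[|k]] //= _; rewrite subn1.
  apply: leq_sum => k /andP[ki kj]; rewrite !mnmBE mnm1E eq_sym (negbTE kj) !subn0.
  by rewrite m'j.
have [q hq] := choice hex.
exists (c^-1 *: (mpolyX K m' - \sum_(j | j != i0) q j)).
have e1 : sum_sqr_mderiv (mpolyX K m') = mderiv i0 (mderiv i0 (mpolyX K m')) +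
    \sum_(j | j != i0) sum_sqr_mderiv (q j).
  rewrite [LHS](bigD1 i0) //=; congr (_ + _).
  by apply: eq_bigr => j ji; rewrite DD hq.
have e2 : sum_sqr_mderiv (\sum_(j | j != i0) q j) = \sum_(j | j != i0) sum_sqr_mderiv (q j).
  exact: linear_sum.
rewrite linearZ /= linearB /= e1 e2 addrK DD m'0 /= -/c scalerA mulVf // scale1r; congr mpolyX.
apply/mnmP => j; rewrite /m' !mnmBE !mnmDE !mnm1E; case: (i0 == j) => /=.
  by rewrite addn2 !subn1.
by rewrite !addn0 !subn0.
Qed.

Lemma sum_sqr_mderiv_surj p : (0 < n)%N -> exists q, sum_sqr_mderiv q = p.
Proof.
move=> n0; elim/mpolyind: p => [|c m p _ _ [q hq]]; first by exists 0; rewrite linear0.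
have [r hr] := @monomial_sum_sqr_mderiv (Ordinal n0) _ m (leqnn _).
by exists (c *: r + q); rewrite linearP /= hr hq.
Qed.

End PolynomialLaplacian.

(** * Polynomials as tempered distributions *)

Section PolynomialCurrents.
Variables (R : realType) (n : nat).
Local Notation C := R[i].
Local Notation E := 'rV[R]_n.
Local Notation Re := (@complex.Re R).
Local Notation Im := (@complex.Im R).
Local Notation schwartz := (schwartz R n).
Local Notation tempered := (tempered R n).
Local Notation P := (mpoly n C).
Implicit Types (f g : schwartz) (i j : 'I_n) (x y : E) (k m : nat) (p q : P).

Lemma poly_funD p q : poly_fun (p + q) = (fun x : E => poly_fun p x + poly_fun q x).
Proof. by apply/funext => x; rewrite /poly_fun mevalD. Qed.

Lemma poly_funZ c p : poly_fun (c *: p) = (fun x : E => c * poly_fun p x).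
Proof. by apply/funext => x; rewrite /poly_fun mevalZ. Qed.

Lemma poly_funM p q : poly_fun (p * q) = (fun x : E => poly_fun p x * poly_fun q x).
Proof. by apply/funext => x; rewrite /poly_fun mevalM. Qed.

Lemma poly_funX j : poly_fun (mpolyX C (mnm1 j)) = (fun x : E => (x 0 j)%:C%C).
Proof. by apply/funext => x; rewrite /poly_fun mevalXU. Qed.

Lemma poly_fun1 : poly_fun (1 : P) = (fun x : E => 1).
Proof. by apply/funext => x; rewrite /poly_fun meval1. Qed.

Lemma poly_fun0 : poly_fun (0 : P) = (fun x : E => 0).
Proof. by apply/funext => x; rewrite /poly_fun meval0. Qed.

Lemma mpoly_ring_ind (Q : P -> Prop) : Q 0 -> Q 1 -> (forall j, Q (mpolyX C (mnm1 j))) ->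
  (forall c p, Q p -> Q (c *: p)) -> (forall p q, Q p -> Q q -> Q (p + q)) ->
  (forall p q, Q p -> Q q -> Q (p * q)) -> forall p, Q p.
Proof.
move=> q0 q1 qX qZ qD qM p; elim/mpolyind: p => // c m p _ _ hp; apply: qD hp; apply: qZ.
rewrite mpolyXE_id; apply: big_ind => // j _.
by elim: (m j) => [|k IH]; rewrite ?expr0 // exprS; exact: qM.
Qed.

Lemma regular_slow_poly p m : regular (@slow R n) m (poly_fun p).
Proof.
elim/mpoly_ring_ind: p => [||j|c p hp|p q hp hq|p q hp hq].
- by rewrite poly_fun0; exact: regular_slow_cst.
- by rewrite poly_fun1; exact: regular_slow_cst.
- by rewrite poly_funX; exact: regular_slow_coord.
- by rewrite poly_funZ; apply: regular_slowM => //; exact: regular_slow_cst.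
- by rewrite poly_funD; exact: regular_slowD.
- by rewrite poly_funM; exact: regular_slowM.
Qed.

Lemma poly_has_partial p j : has_partial j (@poly_fun R n p) (poly_fun (mderiv j p)).
Proof.
elim/mpoly_ring_ind: p => [||i|c p hp|p q hp hq|p q hp hq].
- by rewrite linear0 poly_fun0; exact: has_partial_cst.
- by rewrite -mpolyC1 mderivC poly_fun0 mpolyC1 poly_fun1; exact: has_partial_cst.
- rewrite poly_funX mderivX mnm1E poly_funZ.
  have [->|ij] := eqVneq i j; last first.
    rewrite (_ : (fun x => _) = fun=> (j == i)%:R); first exact: coord_has_partial.
    by apply/funext => x; rewrite eq_sym (negbTE ij) mul0r.
  rewrite (_ : mnm_sub _ _ = @mnm0 n); last first.
    by apply/mnmP => l; rewrite mnmBE mnm0E subnn.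
  rewrite mpolyX0 poly_fun1 (_ : (fun x => _) = fun=> (j == j)%:R); first exact: coord_has_partial.
  by apply/funext => x; rewrite eqxx mulr1.
- rewrite linearZ /= !poly_funZ.
  have := has_partialM (has_partial_cst j c) hp; congr has_partial.
  by apply/funext => x; rewrite mul0r add0r.
- by rewrite linearD /= !poly_funD; exact: has_partialD.
- rewrite mderivM !(poly_funD, poly_funM); exact: has_partialM.
Qed.

(** The coefficients of p are, up to nonzero factors, values at 0 of its
    derivatives. *)
Lemma poly_fun_eq0 p : (forall x : E, poly_fun p x = 0) -> p = 0.
Proof.
move=> h; have hd q j : (forall x : E, poly_fun q x = 0) -> forall x : E, poly_fun (mderiv j q) x = 0.
  move=> hq x; have := has_partialE (poly_has_partial q j) => <-.
  have -> : (poly_fun q : E -> C) = (fun=> 0) by apply/funext.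
  by rewrite (has_partialE (has_partial_cst j 0)).
apply/mpolyP => m; rewrite mcoeff0; move: {2}(mdeg m) (leqnn (mdeg m)) => d.
elim: d m p h => [|d IH] m p h md.
  have -> : m = @mnm0 n by apply/eqP; rewrite -mdeg_eq0 -leqn0.
  have := h 0; rewrite /poly_fun mevalE.
  have e (l : multinom n) : \prod_i ((0 : E) 0 i)%:C%C ^+ l i = (l == @mnm0 n)%:R :> C.
    have [->|l0] := eqVneq l (@mnm0 n).
      by rewrite big1 // => i _; rewrite mnm0E expr0.
    have [i li] : exists i, l i != 0%N.
      apply/existsP; apply: contraNT l0; rewrite negb_exists => /forallP l0.
      by apply/eqP/mnmP => i; rewrite mnm0E; apply/eqP; have := l0 i; rewrite negbK.
    by rewrite (bigD1 i) //= mxE expr0n (negbTE li) mul0r.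
  rewrite (eq_bigr (fun l => mcoeff l p * (l == @mnm0 n)%:R)) => [s0|l _]; last by rewrite e.
  rewrite -[RHS]s0 [X in mcoeff _ X]mpolyE raddf_sum /=; apply: eq_bigr => l _.
  by rewrite mcoeffZ mcoeffX.
have [m0|m0] := eqVneq (mdeg m) 0%N.
  by apply: IH => //; rewrite m0.
have [i mi] : exists i, m i != 0%N.
  apply/existsP; apply: contraNT m0; rewrite negb_exists => /forallP m0.
  by rewrite mdeg_eq0; apply/eqP/mnmP => i; rewrite mnm0E; apply/eqP; have := m0 i; rewrite negbK.
have le1 : lem (mnm1 i) m.
  by apply/mnm_lepP => l; rewrite mnm1E; case: eqP => // <-; rewrite lt0n.
have mE := submK le1.
have := IH (mnm_sub m (mnm1 i)) (mderiv i p) (hd p i h).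
rewrite mcoeff_mderiv mE; have -> : (mdeg (mnm_sub m (mnm1 i)) <= d)%N.
  by move: md; rewrite -{1}mE mdegD mdeg1 addn1 ltnS.
move=> /(_ isT) /eqP; rewrite -mulr_natr mulf_eq0 pnatr_eq0 orbF => /eqP //.
Qed.

Definition poly_mul p : schwartz -> schwartz := multiply (regular_slow_poly p).

Definition poly_integral p f : C := integral (poly_mul p f).

Lemma poly_integral_tempered p : (poly_integral p : schwartz -> C^o) \in @tempered_pred R n.
Proof.
apply: mk_tempered => [c f g|].
  rewrite /poly_integral.
  have -> : poly_mul p (c *: f + g) = c *: poly_mul p f + poly_mul p g by exact: multiply_is_linear.
  by rewrite linearP.
have [k [M hM]] := regular_bound (regular_slow_poly p 0).
have [A [A0 hA]] := integral_bound R n.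
exists (n + k)%N, (A * `|M|); split; first by rewrite mulr_ge0.
move=> f B hf; rewrite -mulrA; apply/hA/seminorm_sup => x.
rewrite cabsM; apply: (@le_trans _ _ (jap x ^+ n * (`|M| * jap x ^+ k * cabs (f x)))).
  rewrite ler_wpM2l ?exprn_ge0 ?jap_ge0 // ler_wpM2r ?cabs_ge0 //.
  exact: le_trans (hM x) (scale_jap_le _ _ (leqnn k)).
rewrite (_ : jap x ^+ n * _ = `|M| * (jap x ^+ (n + k) * cabs (f x))); last by rewrite exprD; ring.
by rewrite ler_wpM2l // (seminorm_le0 hf).
Qed.

Definition poly_current p : tempered := Tempered (poly_integral_tempered p).

Lemma poly_current_is_linear : linear poly_current.
Proof.
move=> c p q; apply: tempered_eq => f.
rewrite -[LHS]/(poly_integral (c *: p + q) f) -[RHS]/(c * poly_integral p f + poly_integral q f) /poly_integral.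
have -> : poly_mul (c *: p + q) f = c *: poly_mul p f + poly_mul q f.
  apply: schwartz_eq => x; rewrite /= poly_funD poly_funZ.
  by rewrite -[RHS]/(c * (poly_fun p x * f x) + poly_fun q x * f x) mulrDl mulrA.
by rewrite linearP.
Qed.

HB.instance Definition _ := GRing.isLinear.Build C P tempered *:%R
  poly_current poly_current_is_linear.

Lemma poly_current_partial i p :
  tempered_partial i (poly_current p) = poly_current (mderiv i p).
Proof.
apply: val_inj; apply/funext => f; rewrite -[LHS]/(- poly_integral p (schwartz_partial i f)).
have e : schwartz_partial i (poly_mul p f) = poly_mul (mderiv i p) f + poly_mul p (schwartz_partial i f).
  by apply: val_inj => /=; apply: has_partialE; exact: has_partialM (poly_has_partial p i) (schwartz_has_partial i f).
have := integral_partial i (poly_mul p f); rewrite e linearD /= => /eqP.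
by rewrite addr_eq0 => /eqP h; rewrite -[RHS]/(poly_integral (mderiv i p) f) /poly_integral h.
Qed.

Lemma regular_slow_conj m (f : E -> C) : regular (@slow R n) m f ->
  regular (@slow R n) m (fun x => (f x)^*%C).
Proof.
have c1 (g : E -> C) : (fun x => Re ((g x)^*%C)) = (fun x => Re (g x)).
  by apply/funext => x; case: (g x).
have c2 (g : E -> C) : (fun x => Im ((g x)^*%C)) = - (fun x => Im (g x)).
  by apply/funext => x; rewrite /GRing.opp /=; case: (g x).
have cc (g : E -> C) : ccont g -> ccont (fun x => (g x)^*%C).
  move=> [h1 h2]; split; first by rewrite c1.
  by rewrite c2 => x; exact: cvgN (h2 x).
have cs (g : E -> C) : slow g -> slow (fun x => (g x)^*%C).
  move=> [k [M hM]]; exists k, M => x; apply: le_trans (hM x).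
  by rewrite /cabs; case: (g x) => a b /=; rewrite sqrrN.
elim: m f => [|m IH] f [c b h]; split=> //; do ?exact: cc; do ?exact: cs.
move=> i; have [g hg rg] := h i; exists (fun x => (g x)^*%C); last exact: IH.
move=> x; have [h1 h2] := hg x; split.
  by rewrite c1; case: (g x) h1.
rewrite c2; apply: is_derive_eqfun (is_deriveN h2) _ _ => //; by case: (g x).
Qed.

(** Test p against its conjugate times the Gaussian. *)
Lemma poly_current_inj : injective poly_current.
Proof.
suff H p : poly_current p = 0 -> p = 0.
  by move=> p q pq; apply/eqP; rewrite -subr_eq0; apply/eqP/H; rewrite linearB /= pq subrr.
move=> h; apply: poly_fun_eq0 => x.
pose f := multiply (fun m => regular_slow_conj (regular_slow_poly p m)) (gaussian R n).
have : poly_current p f = 0 by rewrite h.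
pose u x := (Re (poly_fun p x) ^+ 2 + Im (poly_fun p x) ^+ 2) * gauss x.
have eu y : poly_mul p f y = (u y)%:C%C.
  rewrite -[LHS]/(poly_fun p y * ((poly_fun p y)^*%C * (gauss y)%:C%C)) mulrA rmorphM /=.
  congr (_ * _); case: (poly_fun p y) => a b.
  by apply: complex_ext => /=; rewrite ?cReM ?cImM /=; ring.
have u0 y : 0 <= u y by rewrite mulr_ge0 ?addr_ge0 ?sqr_ge0 // ltW // gauss_gt0.
rewrite -[LHS]/(integral (poly_mul p f)) => /(integral_eq0 eu u0) /(_ x) /eqP.
rewrite mulf_eq0 [gauss x == 0]gt_eqF ?gauss_gt0 // orbF.
rewrite paddr_eq0 ?sqr_ge0 // !sqrf_eq0 => /andP[/eqP a0 /eqP b0].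
exact: complex_ext.
Qed.

(** Each derivative of the transform brings down a coordinate under the
    integral, and at 0 the character is 1. *)
Lemma jet_fourier s (s1 : s ^+ 2 = 1) w :
  exists q, forall f, jet w (fourier s1 f) = poly_current q f.
Proof.
suff [q hq] : exists q, forall f, iter_partial w (fourier s1 f) = fourier s1 (poly_mul q f).
  exists q => f; rewrite /jet hq -[LHS]/(integral (modulate s 0 (poly_mul q f))).
  congr integral; apply: schwartz_eq => x; rewrite /= /character /dot big1.
    by rewrite mulr0 cis0 mul1r.
  by move=> j _; rewrite mxE mul0r.
elim: w => [|j w [q hq]].
  exists 1 => f; congr (schwartz_fun (fourier s1 _)).
  by apply: schwartz_eq => x; rewrite /= poly_fun1 mul1r.
exists (imag s *: (mpolyX C (mnm1 j) * q)) => f.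
rewrite [LHS]/= -/(iter_partial w _) hq.
rewrite -[LHS]/(schwartz_fun (schwartz_partial j (fourier s1 (poly_mul q f)))) partial_fourier -fourierZ.
congr (schwartz_fun (fourier s1 _)); apply: schwartz_eq => x.
rewrite -[LHS]/(imag s * ((x 0 j)%:C%C * (poly_fun q x * f x))).
by rewrite -[RHS]/(poly_fun (imag s *: (mpolyX C (mnm1 j) * q)) x * f x) poly_funZ poly_funM poly_funX !mulrA.
Qed.

Lemma jets_fourier s (s1 : s ^+ 2 = 1) M (c : nat -> C) :
  exists q, forall f, \sum_(i < size (words n M)) c i * jet (nth [::] (words n M) i) (fourier s1 f) =
    poly_current q f.
Proof.
have [q hq] := choice (jet_fourier s1).
exists (\sum_(i < size (words n M)) c i *: q (nth [::] (words n M) i)) => f.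
rewrite linear_sum /=.
have -> (F : 'I_(size (words n M)) -> tempered) : (\sum_i F i) f = \sum_i F i f.
  by elim/big_rec2: _ => [//|i a b _ <-].
apply: eq_bigr => i _; rewrite linearZ /= hq //.
Qed.

Let s1 : (1 : R) ^+ 2 = 1. Proof. exact: expr1n. Qed.
Let s1' : (- 1 : R) ^+ 2 = 1. Proof. by rewrite sqrrN s1. Qed.

Lemma fourier_tempered s (h : s ^+ 2 = 1) (T : tempered) :
  ((fun f => T (fourier h f)) : schwartz -> C^o) \in @tempered_pred R n.
Proof.
apply: mk_tempered => [c f g|]; first by rewrite fourier_lin tempered_lin.
have [N [A [A0 hT]]] := tempered_seminorm_bounded T.
have [N' [A' [A'0 hF]]] := fourier_seminorm n h N N.
exists N', (A * A'); split; first exact: mulr_ge0.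
by move=> f B hf; rewrite -mulrA; apply/hT/hF.
Qed.

(** * The Laplacian on tempered distributions *)

Definition tempered_laplacian (T : tempered) : tempered :=
  \sum_i tempered_partial i (tempered_partial i T).

Lemma tempered_laplacianE T f : tempered_laplacian T f =
  T (\sum_i schwartz_partial i (schwartz_partial i f)).
Proof.
have -> : tempered_laplacian T f = \sum_i tempered_partial i (tempered_partial i T) f.
  by rewrite /tempered_laplacian; elim/big_rec2: _ => [//|i a b _ <-].
rewrite tempered_sum; apply: eq_bigr => i _ /=; exact: opprK.
Qed.

Lemma tempered_laplacian_poly p : tempered_laplacian (poly_current p) = poly_current (sum_sqr_mderiv p).
Proof.
rewrite linear_sum; apply: eq_bigr => i _.
by rewrite !poly_current_partial.
Qed.

Lemma fourier_laplacian s (h : s ^+ 2 = 1) f :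
  fourier h (\sum_i schwartz_partial i (schwartz_partial i f)) = - mul_normsq (fourier h f).
Proof.
have -> : fourier h (\sum_i schwartz_partial i (schwartz_partial i f)) =
    \sum_i fourier h (schwartz_partial i (schwartz_partial i f)).
  by rewrite linear_sum.
rewrite /mul_normsq -sumrN; apply: eq_bigr => i _.
rewrite fourier_partial fourier_partial.
have -> : mul_coord i (imag (- s) *: mul_coord i (fourier h f)) =
   imag (- s) *: mul_coord i (mul_coord i (fourier h f)) by rewrite linearZ.
by rewrite scalerA imagM mulrNN -expr2 h rmorphN1 scaleN1r.
Qed.

Lemma laplacian_fourier s (h : s ^+ 2 = 1) f :
  \sum_i schwartz_partial i (schwartz_partial i (fourier h f)) = - fourier h (mul_normsq f).
Proof.
have -> : fourier h (mul_normsq f) = \sum_i fourier h (mul_coord i (mul_coord i f)).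
  by rewrite linear_sum.
rewrite -sumrN; apply: eq_bigr => i _.
rewrite partial_fourier.
have -> : schwartz_partial i (imag s *: fourier h (mul_coord i f)) =
   imag s *: schwartz_partial i (fourier h (mul_coord i f)) by rewrite linearZ.
by rewrite partial_fourier scalerA imagM -expr2 h rmorphN1 scaleN1r.
Qed.

Local Notation kappa := (integral (gaussian R n) ^+ 2).

Lemma kappa_neq0 : kappa != 0.
Proof. by rewrite expf_neq0 // integral_gaussian_neq0. Qed.

Lemma fourierK f : fourier s1' (fourier s1 f) = kappa *: f.
Proof.
by rewrite -(fourier_inversion s1); exact: schwartz_eq.
Qed.

(** On the Fourier side one has to divide by |xi|^2. The quotient leaves a
    combination of jets at 0 over, which is a polynomial on the original side,
    and a polynomial is the Laplacian of another one. *)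
Theorem tempered_laplacian_surj (T : tempered) : (0 < n)%N ->
  exists W, tempered_laplacian W = T.
Proof.
move=> n0; have [U [M [c hU]]] := division_by_normsq (Tempered (fourier_tempered s1' T)).
have [q hq] := jets_fourier s1 M c.
pose W0 := Tempered (fourier_tempered s1 U).
have [r hr] : exists r, sum_sqr_mderiv r = q.
  by apply: sum_sqr_mderiv_surj => // k; rewrite pnatr_eq0.
exists ((- kappa^-1) *: (W0 + poly_current r)).
apply: tempered_eq => f; rewrite tempered_laplacianE.
set D := \sum_i _.
rewrite -[LHS]/(- kappa^-1 * (U (fourier s1 D) + poly_current r D)).
have -> : poly_current r D = poly_current q f.
  by rewrite /D -tempered_laplacianE tempered_laplacian_poly hr.
have -> : U (fourier s1 D) = - (kappa * T f + poly_current q f).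
  rewrite /D fourier_laplacian -scaleN1r temperedZ hU hq mulN1r; congr (- (_ + _)).
  by rewrite -[LHS]/(T (fourier s1' (fourier s1 f))) fourierK temperedZ.
have k0 := kappa_neq0.
move: (kappa) k0 (T f) (poly_current q f) => k k0 a b.
by field.
Qed.

(** On the Fourier side T is killed by |xi|^2, hence carried by a jet at 0,
    which is the transform of a polynomial. *)
Theorem tempered_laplacian_kernel (T : tempered) : tempered_laplacian T = 0 ->
  exists2 p, sum_sqr_mderiv p = 0 & T = poly_current p.
Proof.
move=> hT; suff [p hp] : exists p, T = poly_current p.
  exists p => //; apply: poly_current_inj.
  by rewrite -tempered_laplacian_poly -hp hT linear0.
pose S := Tempered (fourier_tempered s1' T).
have [M hM] : exists M, forall f, vanishes M f -> S f = 0.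
  apply: kernel_mul_normsq => f.
  rewrite -[LHS]/(T (fourier s1' (mul_normsq f))).
  rewrite -[fourier s1' _]opprK -laplacian_fourier -scaleN1r temperedZ -tempered_laplacianE hT.
  by rewrite mulr0.
have [c hc] := jet_functional (tempered_lin S) hM.
have [q hq] := jets_fourier s1 M c.
exists (kappa^-1 *: q); apply: tempered_eq => f.
rewrite linearZ /= -[RHS]/(kappa^-1 * poly_current q f) -hq -hc.
rewrite -[S _]/(T (fourier s1' (fourier s1 f))) fourierK temperedZ mulKf //.
exact: kappa_neq0.
Qed.

End PolynomialCurrents.

(** * Exactness for forms and currents *)

Section LaplacianOfForms.
Variables (K : comPzRingType) (n : nat) (V : lmodType K).
Variable D : 'I_n -> {linear V -> V}.
Hypothesis D_comm : forall mu nu v, D mu (D nu v) = D nu (D mu v).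
Hypothesis laplacian_surj : forall v, exists u, \sum_mu D mu (D mu u) = v.

Lemma form_laplacian_surj k : set_surj (of_degree k) (of_degree k) (form_laplacian D).
Proof.
have [sol hsol] := choice laplacian_surj.
(* outside degree k, sol 0 may be a nonzero solution: 0 is the one to take *)
move=> w wk; exists [ffun I : {set 'I_n} => if #|I|%:Z == k then sol (- w I) else 0].
  by move=> I Ik; rewrite ffunE (negbTE Ik).
apply/ffunP => I; rewrite form_laplacianE // ffunE; case: ifPn => Ik.
  by rewrite hsol opprK.
by rewrite wk // big1 ?oppr0 // => mu _; rewrite !linear0.
Qed.

End LaplacianOfForms.

Section Hodge.
Variables (R : realType) (n : nat).
Local Notation C := R[i].
Local Notation poly_form := (ext_form n (mpoly n C)).
Local Notation current := (ext_form n (tempered R n)).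
Implicit Types (w : poly_form) (theta omega : current) (I : {set 'I_n}).

Lemma poly_laplacianE w I : poly_laplacian w I = - sum_sqr_mderiv (w I).
Proof. by apply: form_laplacianE => mu nu p; exact: mderiv_comm. Qed.

Lemma current_laplacianE omega I :
  current_laplacian omega I = - tempered_laplacian (omega I).
Proof. by apply: form_laplacianE => mu nu T; exact: tempered_partialC. Qed.

Lemma poly_laplacian_harmonic k w : poly_forms k w ->
  poly_laplacian w = 0 <-> harmonic_forms k w.
Proof.
move=> wk; split=> [w0|[_ hw]].
  split=> // I; apply/eqP; rewrite -oppr_eq0; apply/eqP.
  by rewrite -[LHS](poly_laplacianE w I) w0 ffunE.
by apply/ffunP => I; rewrite poly_laplacianE [sum_sqr_mderiv _]hw oppr0 ffunE.
Qed.

Lemma poly_laplacian_exact k : (0 < n)%N ->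
  short_exact (harmonic_forms k) (poly_forms k) (poly_forms k) idfun (@poly_laplacian R n).
Proof.
move=> n0; split.
- by move=> w [].
- by move=> w w' _ _.
- apply/seteqP; split=> [w [wk w0]|_ [w hw <-]].
    by exists w => //; exact/poly_laplacian_harmonic.
  have wk : poly_forms k w by case: hw.
  by split=> //; exact/(poly_laplacian_harmonic wk).
- move=> w wk; apply: of_degree_form_laplacian wk => mu nu p; exact: mderiv_comm.
- apply: form_laplacian_surj => [mu nu p|p]; first exact: mderiv_comm.
  by apply: sum_sqr_mderiv_surj => // j; rewrite pnatr_eq0.
Qed.

Definition form_current w : current := [ffun I => poly_current (w I)].

Lemma form_current_is_linear : linear form_current.
Proof. by move=> c w w'; apply/ffunP => I; rewrite !ffunE linearP. Qed.

HB.instance Definition _ := GRing.isLinear.Build C poly_form current *:%R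
  form_current form_current_is_linear.

Lemma form_current_inclusion : is_inclusion form_current.
Proof. by move=> w I f; rewrite ffunE. Qed.

Lemma current_laplacian_exact k : (0 < n)%N ->
  short_exact (harmonic_forms k) (@currents R n k) (currents k) form_current current_laplacian.
Proof.
move=> n0; split.
- by move=> w [wk _] I Ik; rewrite ffunE wk // linear0.
- move=> w w' _ _ ww'; apply/ffunP => I; apply: poly_current_inj.
  by have := congr1 (fun omega : current => omega I) ww'; rewrite !ffunE.
- apply/seteqP; split=> [omega [omegak L0]|_ [w [wk hw] <-]].
    have hT I : exists p, sum_sqr_mderiv p = 0 /\ omega I = poly_current p.
      have [|p p0 pE] := @tempered_laplacian_kernel R n (omega I); last by exists p.
      by apply/eqP; rewrite -oppr_eq0 -current_laplacianE L0 ffunE.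
    have [w hw] := choice hT.
    have wE : form_current [ffun I => w I] = omega.
      by apply/ffunP => I; rewrite !ffunE (hw I).2.
    exists [ffun I => w I] => //; split=> I; last by rewrite ffunE; exact: (hw I).1.
    move=> Ik; apply: poly_current_inj; rewrite linear0.
    by rewrite ffunE -(hw I).2 omegak.
  split; first by move=> I Ik; rewrite ffunE wk // linear0.
  apply/ffunP => I; rewrite current_laplacianE !ffunE tempered_laplacian_poly.
  by rewrite [sum_sqr_mderiv _]hw linear0 oppr0.
- move=> omega omegak; apply: of_degree_form_laplacian omegak => mu nu T.
  exact: tempered_partialC.
- apply: form_laplacian_surj => [mu nu T|T]; first exact: tempered_partialC.
  exact: tempered_laplacian_surj.
Qed.

End Hodge.

Theorem corollary7p3 (R : realType) (n : nat) (k : int)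
    (hn : (1 <= n)%N) (hk : 0 <= k <= n%:Z) :
  short_exact (harmonic_forms k) (poly_forms k) (poly_forms k)
    idfun (@poly_laplacian R n)
  /\
  exists2 iota : {linear ext_form n (mpoly n R[i]) -> ext_form n (tempered R n)},
    is_inclusion iota &
    short_exact (harmonic_forms k) (currents k) (currents k)
      iota current_laplacian
    /\
    forall theta : ext_form n (tempered R n), currents k theta ->
      (exists theta1 theta2, [/\ exact_current k theta1,
         coexact_current k theta2 & theta = theta1 + theta2])
      /\
      (exists2 omega, currents k omega &
         theta = current_laplacian omega /\
         current_laplacian omega =
           current_delta (current_d omega) +
           current_d (current_delta omega))
      /\
      (forall omega omega', currents k omega -> currents k omega' ->
         theta = current_laplacian omega ->
         (theta = current_laplacian omega' <->
          exists2 h, harmonic_forms k h & omega' - omega = iota h)).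
Proof.
split; first exact: poly_laplacian_exact.
exists (@form_current R n); first exact: form_current_inclusion.
have ex := @current_laplacian_exact R n k hn.
split; first exact: ex.
move=> theta theta_k.
have [_ _ ker _ /(_ _ theta_k)[omega omega_k omegaE]] := ex.
split; last split.
- exists (current_d (current_delta omega)), (current_delta (current_d omega)).
  by split=> //; [exists (current_delta omega)|exists (current_d omega)] => //;
    [exact: of_degree_form_delta|exact: of_degree_form_d].
- exists omega => //; split=> //; exact: addrC.
move=> u u' uk u'k uE; split=> [u'E|[h hh hE]].
  have : (currents k `&` current_laplacian @^-1` [set 0]) (u' - u).
    split; last by rewrite /= linearB /= -uE -u'E subrr.
    by move=> I Ik; rewrite !ffunE uk // u'k // subrr.
  by rewrite ker => -[h hh <-]; exists h.
have [_ h0] : (currents k `&` current_laplacian @^-1` [set 0]) (form_current h).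
  by rewrite ker; exists h.
by apply/esym/eqP; rewrite uE -subr_eq0 -linearB /= hE; apply/eqP.
Qed.
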